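(* Let $\nu,\eta>0$, $\sigma\ge0$, $\alpha_1,\alpha_2\ge0$ and $\tau>0$. For $n=1,2,\ldots,N$, given $(\boldsymbol{u}_h^{n-1},p_h^{n-1},\boldsymbol{B}_h^{n-1},\boldsymbol{E}_h^{n-1},\boldsymbol{J}_h^{n-1})\in\mathbb{Y}_h$, there exists a unique $(\boldsymbol{u}_h^n,p_h^n,\boldsymbol{B}_h^n,\boldsymbol{E}_h^n,\boldsymbol{J}_h^n)\in\mathbb{Y}_h$ such that for all $(\boldsymbol{\phi}_h,q_h,\boldsymbol{\psi}_h,\boldsymbol{\chi}_h,\boldsymbol{\omega}_h)\in\mathbb{Y}_h$: $$\langle\mathrm{d}_\tau\boldsymbol{u}_h^n,\boldsymbol{\phi}_h\rangle+\alpha_1\langle\nabla\mathrm{d}_\tau\boldsymbol{u}_h^n,\nabla\boldsymbol{\phi}_h\rangle+\nu\langle\nabla\boldsymbol{u}_h^n,\nabla\boldsymbol{\phi}_h\rangle+\tfrac12\big[\langle(\boldsymbol{u}_h^{n-1}\cdot\nabla)\boldsymbol{u}_h^n,\boldsymbol{\phi}_h\rangle-\langle(\boldsymbol{u}_h^{n-1}\cdot\nabla)\boldsymbol{\phi}_h,\boldsymbol{u}_h^n\rangle\big]-\langle p_h^n,\mathrm{div}\,\boldsymbol{\phi}_h\rangle-\langle\boldsymbol{J}_h^n\times\boldsymbol{B}_h^{n-1},\boldsymbol{\phi}_h\rangle=0,$$ $$\langle\mathrm{d}_\tau\boldsymbol{B}_h^n,\boldsymbol{\psi}_h\rangle+\langle\mathrm{curl}\,\boldsymbol{E}_h^n,\boldsymbol{\psi}_h\rangle=0,$$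 $$\alpha_2\langle\mathrm{d}_\tau\boldsymbol{J}_h^n,\boldsymbol{\chi}_h\rangle+\sigma\langle\boldsymbol{J}_h^n,\boldsymbol{\chi}_h\rangle+\eta\langle\boldsymbol{J}_h^n\times\boldsymbol{B}_h^{n-1},\boldsymbol{\chi}_h\rangle=\langle\boldsymbol{E}_h^n,\boldsymbol{\chi}_h\rangle+\langle\boldsymbol{u}_h^n\times\boldsymbol{B}_h^{n-1},\boldsymbol{\chi}_h\rangle,$$ $$\langle\boldsymbol{J}_h^n,\boldsymbol{\omega}_h\rangle-\langle\boldsymbol{B}_h^n,\mathrm{curl}\,\boldsymbol{\omega}_h\rangle=0,\qquad\langle\mathrm{div}\,\boldsymbol{u}_h^n,q_h\rangle=0.$$ Furthermore, the iterates produced successively from step $0$ satisfy $\mathrm{div}\,\boldsymbol{B}_h^n=\mathrm{div}\,\boldsymbol{B}_h^0$. In particular, $\mathrm{div}\,\boldsymbol{B}_h^n=0$ if $\mathrm{div}\,\boldsymbol{B}_h^0=0$.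
   Context: $\mathscr{D}\subset\mathbb{R}^3$ is a contractible bounded domain with polytopal boundary, $T>0$, $N=\lfloor T/\tau\rfloor$. $\langle\cdot,\cdot\rangle$ is the $L^2(\mathscr{D})$ inner product (scalar, vector or matrix valued); $\mathrm{d}_\tau\boldsymbol{v}^n:=(\boldsymbol{v}^n-\boldsymbol{v}^{n-1})/\tau$. $L^2_0$ is the space of scalar $L^2(\mathscr{D})$ functions of zero mean; $\mathbb{H}^1_0$, $\mathbb{H}_0(\mathrm{div})$, $\mathbb{H}_0(\mathrm{curl})$ are the spaces of $\mathbb{R}^3$-valued functions in $\mathbb{H}^1$, $\mathbb{H}(\mathrm{div})$, $\mathbb{H}(\mathrm{curl})$ with zero trace, zero normal trace, zero tangential trace, respectively. $\{\mathcal{T}_h\}_{h>0}$ is a quasi-uniform family of simplicial triangulations of $\mathscr{D}$ with maximal mesh size $h$. $P_k$, $\mathbb{P}_k$ are scalar, vector polynomials of degree at most $k$. On $K\in\mathcal{T}_h$ let $b_K$ be the product of the four barycentric coordinates. The MINI pair is $\mathbb{V}_h=\{\boldsymbol{v}\in C^0(\overline{\mathscr{D}};\mathbb{R}^3):\boldsymbol{v}|_K\in(P_1(K)\oplus\mathrm{span}\{b_K\})^3\ \forall K\}$, $Q_h=\{q\in C^0(\overline{\mathscr{D}}):q|_K\in P_1(K)\ \forall K\}$. The lowest-order Nédélec and Raviart–Thomas spaces are $\mathbb{X}_h=\{\boldsymbol{v}\in\mathbb{H}(\mathrm{curl}):\boldsymbol{v}|_K\in\mathbb{P}_0(K)\oplus\boldsymbol{x}\times\mathbb{P}_0(K)\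 \forall K\}$, $\mathbb{RT}_h=\{\boldsymbol{v}\in\mathbb{H}(\mathrm{div}):\boldsymbol{v}|_K\in\mathbb{P}_0(K)\oplus\boldsymbol{x}P_0(K)\ \forall K\}$. Set $\mathbb{V}_h^0=\mathbb{V}_h\cap\mathbb{H}^1_0$, $Q_h^0=Q_h\cap L^2_0$, $\mathbb{X}_h^0=\mathbb{X}_h\cap\mathbb{H}_0(\mathrm{curl})$, $\mathbb{RT}_h^0=\mathbb{RT}_h\cap\mathbb{H}_0(\mathrm{div})$, and $\mathbb{Y}_h=\mathbb{V}_h^0\times Q_h^0\times\mathbb{RT}_h^0\times\mathbb{X}_h^0\times\mathbb{X}_h^0$. The MINI pair satisfies the discrete inf-sup condition: there is $\beta>0$, depending only on $\mathscr{D}$, with $\inf_{0\ne q_h\in Q_h^0}\sup_{0\ne\boldsymbol{v}_h\in\mathbb{V}_h^0}\frac{\langle\mathrm{div}\,\boldsymbol{v}_h,q_h\rangle}{\|\nabla\boldsymbol{v}_h\|_{\mathbb{L}^2}\|q_h\|_{L^2}}\ge\beta$. *)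

(* Defs.v *)
From HB Require Import structures.
From mathcomp Require Import all_boot all_order all_algebra.
From mathcomp Require Import all_classical all_reals all_analysis.

Set Implicit Arguments.
Unset Strict Implicit.
Unset Printing Implicit Defensive.

Import Order.TTheory GRing.Theory Num.Theory.
Import numFieldNormedType.Exports.

Local Open Scope classical_set_scope.
Local Open Scope ring_scope.

Notation vec R := ('rV[R]_3).
Notation sfield R := (vec R -> R).
Notation vfield R := (vec R -> vec R).

Section Euclid.
Variable R : realType.
Implicit Types u v : vec R.

Definition row3 (a b c : R) : vec R := \row_(i < 3) [:: a; b; c]`_i.

Definition dot u v : R := \sum_(i < 3) u 0 i * v 0 i.

(* The library norm on ['rV_3] is the sup norm. *)
Definition enorm v : R := Num.sqrt (dot v v).

Definition cross u v : vec R :=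
  let u_ k := u 0 (inord k) in
  let v_ k := v 0 (inord k) in
  row3 (u_ 1%N * v_ 2%N - u_ 2%N * v_ 1%N)
       (u_ 2%N * v_ 0%N - u_ 0%N * v_ 2%N)
       (u_ 0%N * v_ 1%N - u_ 1%N * v_ 0%N).

Definition comp (v : vfield R) (i : 'I_3) : sfield R := fun x => v x 0 i.

End Euclid.

(* The library has no measure on ['rV_3]: integration takes place on [R * R * R]
   with the product Lebesgue measure, transported along [of_triple]. *)
Section Integration.
Variable R : realType.
Implicit Types (D : set (vec R)) (f g : sfield R).

Definition leb3 := ((@lebesgue_measure R \x @lebesgue_measure R)
                       \x @lebesgue_measure R)%E.

Definition of_triple (p : R * R * R) : vec R := row3 p.1.1 p.1.2 p.2.

Definition integral3 D f : R :=
  (\int[leb3]_(p in of_triple @^-1` D) f (of_triple p))%R.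

Definition ae_on D (P : vec R -> Prop) : Prop :=
  {ae leb3, forall p, D (of_triple p) -> P (of_triple p)}.

Definition L2 D f : Prop :=
  measurable_fun (of_triple @^-1` D) (f \o of_triple) /\
  leb3.-integrable (of_triple @^-1` D)
    (EFin \o (fun p => f (of_triple p) ^+ 2)).

Definition vL2 D (v : vfield R) : Prop := forall i, L2 D (comp v i).

Definition ip D f g : R := integral3 D (fun x => f x * g x).

Definition vip D (u v : vfield R) : R := integral3 D (fun x => dot (u x) (v x)).

Definition mip D (A B : vec R -> 'M[R]_3) : R :=
  integral3 D (fun x => \sum_(i < 3) \sum_(j < 3) A x i j * B x i j).

Definition L20 D f : Prop := L2 D f /\ integral3 D f = 0.

End Integration.

Section TestFunctions.
Variable R : realType.
Implicit Types (D : set (vec R)) (f : sfield R) (F : vfield R).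

Definition partial (i : 'I_3) f : sfield R := fun x => 'D_(delta_mx 0 i) f x.

Definition partials (s : seq 'I_3) f : sfield R := foldr partial f s.

Definition smooth f : Prop := forall s : seq 'I_3,
  continuous (partials s f) /\
  forall (i : 'I_3) (x : vec R), derivable (partials s f) x (delta_mx 0 i).

Definition test_fun D f : Prop :=
  let supp := closure [set x | f x != 0] in
  [/\ smooth f, compact supp & supp `<=` D].

Definition vsmooth F : Prop := forall i, smooth (comp F i).
Definition vtest_fun D F : Prop := forall i, test_fun D (comp F i).

Definition cgrad f : vfield R := fun x => \row_i partial i f x.

Definition cdiv F : sfield R := fun x => \sum_(i < 3) partial i (comp F i) x.

Definition ccurl F : vfield R := fun x =>
  let d i j := partial (inord i) (comp F (inord j)) x in
  row3 (d 1%N 2%N - d 2%N 1%N) (d 2%N 0%N - d 0%N 2%N) (d 0%N 1%N - d 1%N 0%N).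

End TestFunctions.

Section Sobolev.
Variable R : realType.
Variable D : set (vec R).
Implicit Types (f g : sfield R) (u v w : vfield R).

Definition is_wgrad f w : Prop := vL2 D w /\
  forall F, vtest_fun D F -> ip D f (cdiv F) = - vip D w F.

Definition is_wdiv v g : Prop := L2 D g /\
  forall phi, test_fun D phi -> vip D v (cgrad phi) = - ip D g phi.

Definition is_wcurl v w : Prop := vL2 D w /\
  forall F, vtest_fun D F -> vip D v (ccurl F) = vip D w F.

Definition H1 f : Prop := L2 D f /\ exists w, is_wgrad f w.
Definition Hdiv v : Prop := vL2 D v /\ exists g, is_wdiv v g.
Definition Hcurl v : Prop := vL2 D v /\ exists w, is_wcurl v w.

(* The weak derivatives, determined up to a null subset of [D]; the default
   value 0 is only met outside [H1], [Hdiv], [Hcurl]. *)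
Definition wgrad f : vfield R := xget (fun=> 0) [set w | is_wgrad f w].
Definition wdiv v : sfield R := xget (fun=> 0) [set g | is_wdiv v g].
Definition wcurl v : vfield R := xget (fun=> 0) [set w | is_wcurl v w].

(* [vgrad v x i j] is the j-th partial derivative of the i-th component. *)
Definition vgrad v : vec R -> 'M[R]_3 :=
  fun x => \matrix_(i, j) wgrad (comp v i) x 0 j.

(* (u . grad) v *)
Definition convect u v : vfield R := fun x => u x *m (vgrad v x)^T.

(* Traces on the boundary, as the functionals given by Green's formulas on
   functions smooth up to the boundary. With n the outer unit normal they are
   the boundary integrals of f (n . F), (v . n) phi and (n x v) . F. *)
Definition trace f F : R := ip D f (cdiv F) + vip D (wgrad f) F.
Definition normal_trace v (phi : sfield R) : R :=
  vip D v (cgrad phi) + ip D (wdiv v) phi.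
Definition tangential_trace v F : R :=
  vip D (wcurl v) F - vip D v (ccurl F).

Definition vH10 v : Prop := forall i,
  H1 (comp v i) /\ forall F, vsmooth F -> trace (comp v i) F = 0.
Definition H0div v : Prop :=
  Hdiv v /\ forall phi, smooth phi -> normal_trace v phi = 0.
Definition H0curl v : Prop :=
  Hcurl v /\ forall F, vsmooth F -> tangential_trace v F = 0.

End Sobolev.

Section Geometry.
Variable R : realType.
Implicit Type D : set (vec R).

Definition hull (s : seq (vec R)) : set (vec R) :=
  [set x | exists c : 'I_(size s) -> R,
     [/\ forall i, 0 <= c i, \sum_i c i = 1 & x = \sum_i c i *: s`_i]].

Definition contractible D : Prop :=
  exists (H : R * vec R -> vec R) (x0 : vec R),
    [/\ {within `[0, 1]%classic `*` D, continuous H},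
        D x0,
        forall t x, `[0, 1]%classic t -> D x -> D (H (t, x)) &
        forall x, D x -> H (0, x) = x /\ H (1, x) = x0].

(* Polytopal boundary: a finite union of triangles, with [D] on one side of it
   (no slits), whence [D = interior (closure D)]. *)
Definition polytopal_boundary D : Prop :=
  D = interior (closure D) /\
  exists s : seq (3.-tuple (vec R)),
    closure D `\` interior D = [set x | exists2 F, F \in s & hull F x].

Definition admissible_domain D : Prop :=
  [/\ open D, connected D, bounded_set D, contractible D
    & polytopal_boundary D].

(* A mesh is a list of simplices, each given by its four vertices. *)
Definition mesh := seq (4.-tuple (vec R)).

Definition nondegenerate (K : 4.-tuple (vec R)) : Prop :=
  row_free (\matrix_(i < 3) (tnth K (lift ord0 i) - tnth K ord0)).

(* The third condition is conformity: two cells meet in the (possibly empty)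
   face spanned by their common vertices. *)
Definition triangulation D (M : mesh) : Prop :=
  [/\ forall K, K \in M -> nondegenerate K,
      closure D = [set x | exists2 K, K \in M & hull K x]
    & forall K L, K \in M -> L \in M ->
        hull K `&` hull L = hull [seq a <- K | a \in tval L]].

Definition diam (A : set (vec R)) : R :=
  sup [set enorm (x.1 - x.2) | x in A `*` A].

Definition mesh_size (M : mesh) : R :=
  \big[Num.max/0]_(K <- M) diam (hull K).

(* A family of triangulations indexed by the set [Hs] of its mesh sizes (a
   bounded domain has no triangulation of arbitrarily large mesh size). *)
Definition quasi_uniform_family D (Hs : set R) (Th : R -> mesh) : Prop :=
  (forall h, Hs h ->
     [/\ 0 < h, triangulation D (Th h) & mesh_size (Th h) = h]) /\
  exists2 rho : R, 0 < rho &
    forall h, Hs h -> forall K, K \in Th h ->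
      exists x0, [set x | enorm (x - x0) <= rho * h] `<=` hull K.

End Geometry.

Section FiniteElements.
Variable R : realType.
Variable D : set (vec R).
Variable M : mesh R.
Implicit Types (f q : sfield R) (v : vfield R) (K : 4.-tuple (vec R)).

(* Row of the barycentric coordinates l of x: the solution of
   sum_i l_i a_i = x, sum_i l_i = 1, where the a_i are the vertices of K. *)
Definition bary K (x : vec R) : 'rV[R]_4 :=
  (row_mx x 1%:M : 'rV[R]_4) *m
  invmx (\matrix_(i < 4) (row_mx (tnth K i) 1%:M : 'rV[R]_4)).

Definition bubble K : sfield R := fun x => \prod_(i < 4) bary K x 0 i.

Definition P1_on (A : set (vec R)) f : Prop :=
  exists (c : R) (b : vec R), forall x, A x -> f x = c + dot b x.

Definition P1_bubble_on K f : Prop :=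
  exists (c : R) (b : vec R) (d : R),
    forall x, hull K x -> f x = c + dot b x + d * bubble K x.

Definition Vh v : Prop :=
  {within closure D, continuous v} /\
  forall K, K \in M -> forall i, P1_bubble_on K (comp v i).

Definition Qh q : Prop :=
  {within closure D, continuous q} /\
  forall K, K \in M -> P1_on (hull K) q.

(* Elements of [Hcurl] and [Hdiv] are defined up to null sets and may jump
   across faces: on each cell, identities hold almost everywhere. *)
Definition Xh v : Prop :=
  Hcurl D v /\
  forall K, K \in M -> exists a b : vec R,
    ae_on (hull K) (fun x => v x = a + cross x b).

Definition RTh v : Prop :=
  Hdiv D v /\
  forall K, K \in M -> exists (a : vec R) (c : R),
    ae_on (hull K) (fun x => v x = a + c *: x).

Definition Vh0 v : Prop := Vh v /\ vH10 D v.
Definition Qh0 q : Prop := Qh q /\ L20 D q.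
Definition Xh0 v : Prop := Xh v /\ H0curl D v.
Definition RTh0 v : Prop := RTh v /\ H0div D v.

Definition vnull v : Prop := ae_on D (fun x => v x = 0).
Definition null q : Prop := ae_on D (fun x => q x = 0).

Definition inf_sup (beta : R) : Prop :=
  (beta%:E <= ereal_inf
     [set ereal_sup
        [set (ip D (wdiv D v) q /
              (Num.sqrt (mip D (vgrad D v) (vgrad D v)) *
               Num.sqrt (ip D q q)))%:E | v in [set v | Vh0 v /\ ~ vnull v]]
     | q in [set q | Qh0 q /\ ~ null q]])%E.

End FiniteElements.

Record state (R : realType) := State {
  vel : vfield R;
  prs : sfield R;
  mag : vfield R;
  elc : vfield R;
  cur : vfield R }.

Section Scheme.
Variable R : realType.
Variable D : set (vec R).
Variable M : mesh R.
Variables nu eta sigma alpha1 alpha2 tau : R.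
Implicit Types y z w : state R.

Definition inY y : Prop :=
  [/\ Vh0 D M (vel y), Qh0 D M (prs y), RTh0 D M (mag y),
      Xh0 D M (elc y) & Xh0 D M (cur y)].

(* Equality of elements of Y_h, i.e. as classes in L^2(D). *)
Definition same_state y z : Prop :=
  [/\ ae_on D (fun x => vel y x = vel z x),
      ae_on D (fun x => prs y x = prs z x),
      ae_on D (fun x => mag y x = mag z x),
      ae_on D (fun x => elc y x = elc z x)
    & ae_on D (fun x => cur y x = cur z x)].

Definition dtau (v v0 : vfield R) : vfield R :=
  fun x => tau^-1 *: (v x - v0 x).

Definition fcross (u v : vfield R) : vfield R := fun x => cross (u x) (v x).

(* [y0] is the previous iterate, [y] the current one, [w] collects the test
   functions (phi, q, psi, chi, omega). *)
Definition momentum y0 y w : Prop :=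
  vip D (dtau (vel y) (vel y0)) (vel w)
  + alpha1 * mip D (vgrad D (dtau (vel y) (vel y0))) (vgrad D (vel w))
  + nu * mip D (vgrad D (vel y)) (vgrad D (vel w))
  + 2^-1 * (vip D (convect D (vel y0) (vel y)) (vel w)
            - vip D (convect D (vel y0) (vel w)) (vel y))
  - ip D (prs y) (wdiv D (vel w))
  - vip D (fcross (cur y) (mag y0)) (vel w) = 0.

Definition faraday y0 y w : Prop :=
  vip D (dtau (mag y) (mag y0)) (mag w)
  + vip D (wcurl D (elc y)) (mag w) = 0.

Definition ohm y0 y w : Prop :=
  alpha2 * vip D (dtau (cur y) (cur y0)) (elc w)
  + sigma * vip D (cur y) (elc w)
  + eta * vip D (fcross (cur y) (mag y0)) (elc w)
  = vip D (elc y) (elc w) + vip D (fcross (vel y) (mag y0)) (elc w).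

Definition ampere y w : Prop :=
  vip D (cur y) (cur w) - vip D (mag y) (wcurl D (cur w)) = 0.

Definition incompressible y w : Prop :=
  ip D (wdiv D (vel y)) (prs w) = 0.

Definition step y0 y : Prop := forall w, inY w ->
  [/\ momentum y0 y w, faraday y0 y w, ohm y0 y w, ampere y w
    & incompressible y w].

End Scheme.

(* Main.v *)
From HB Require Import structures.
From mathcomp Require Import all_boot all_order all_algebra.
From mathcomp Require Import all_classical all_reals all_analysis.
From mathcomp Require Import measurable_realfun ring lra.
Require Import Defs.
Set Implicit Arguments.
Unset Strict Implicit.
Unset Printing Implicit Defensive.
Import Order.TTheory GRing.Theory Num.Theory.
Import numFieldNormedType.Exports.
Local Open Scope classical_set_scope.
Local Open Scope ring_scope.

(** The five equations are linear in the unknown state and every test state [w] enters through one of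
    its components in each equation, so that one step of the scheme asks for a state [y] with
    [scheme_form y w = scheme_rhs yp w] for all [w] in [inY D M], where [yp] is the previous iterate
    ([stepE]).

    Uniqueness. Let [scheme_form y w = 0] for all [w]. Testing with [w = (u, p, B, J, E)] for
    [y = (u, p, B, E, J)] makes the convective, pressure, curl and Lorentz terms cancel, and leaves a
    sum of nonnegative terms among which are the squared norms of [u] and [B], divided by [tau]
    ([energy]). Ampere's law then gives [J = 0], Ohm's law gives [E = 0], and the inf-sup condition
    gives [p = 0] ([scheme_nondegenerate]).

    Existence. Each cell contributes finitely many coefficients, so the space of states is finite
    dimensional up to null sets ([state_coords]), and a square system that is nondegenerate up to null
    states is solvable ([square_system_solvable]).

    Divergence. The curl of a lowest-order Nedelec field with zero tangential trace is constant on each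
    cell ([wcurl_cell]), has zero divergence and zero normal trace, and so is a Raviart-Thomas field.
    Faraday's law may therefore be tested with its own residual, and [B - B_prev + tau curl E] vanishes
    almost everywhere. As curls of fields with zero tangential trace are orthogonal to gradients, [B] and
    [B_prev] have the same weak divergence ([step_div]).

    Weak derivatives being chosen among functions that agree almost everywhere, the bilinearity of the
    forms rests on the fundamental lemma of the calculus of variations ([test_fun_ae_eq0]). Its proof
    approximates indicator functions of boxes by products of bumps exp(-1/t). The orthogonality of curls and
    gradients rests on the symmetry of second derivatives ([mixed_partials]), and the curl on a cell on the
    vanishing integral of a compactly supported divergence ([integral_partial_eq0]). *)

(** * Lebesgue measure on triples *)

Notation triple R := (measurableTypeR R * measurableTypeR R * measurableTypeR R)%type.

HB.instance Definition _ (R : realType) := Measure.on (@leb3 R).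

Instance ae_leb3_filter (R : realType) : Filter (almost_everywhere (@leb3 R)).
Proof. exact: (ae_filter_ringOfSetsType (@leb3 R : {measure set (triple R) -> \bar R})). Qed.

Lemma ord3P (P : 'I_3 -> Prop) :
  P (inord 0) -> P (inord 1) -> P (inord 2) -> forall i, P i.
Proof.
move=> P0 P1 P2 [[|[|[|//]]] lti].
- by have -> : Ordinal lti = inord 0 by apply/val_inj; rewrite /= inordK.
- by have -> : Ordinal lti = inord 1 by apply/val_inj; rewrite /= inordK.
- by have -> : Ordinal lti = inord 2 by apply/val_inj; rewrite /= inordK.
Qed.

Lemma sum_ord3 (V : nmodType) (F : 'I_3 -> V) :
  \sum_(i < 3) F i = F (inord 0) + F (inord 1) + F (inord 2).
Proof.
rewrite !big_ord_recr big_ord0 /= add0r.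
by congr (F _ + F _ + F _); apply/val_inj; rewrite /= inordK.
Qed.

Lemma row3E (R : realType) (a b c : R) :
  [/\ row3 a b c 0 (inord 0) = a, row3 a b c 0 (inord 1) = b
    & row3 a b c 0 (inord 2) = c].
Proof. by rewrite !mxE !inordK. Qed.

Lemma prod_ord3 (V : pzSemiRingType) (F : 'I_3 -> V) :
  \prod_(i < 3) F i = F (inord 0) * F (inord 1) * F (inord 2).
Proof.
rewrite !big_ord_recr big_ord0 /= mul1r.
by congr (F _ * F _ * F _); apply/val_inj; rewrite /= inordK.
Qed.

Lemma ball_rowP (R : realType) (q x : 'rV[R]_3) (r : R) : 0 < r ->
  ball q r x <-> forall i, `|q 0 i - x 0 i| < r.
Proof.
move=> r0; split => [[_ qx] i|qx]; first exact: qx.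
by split=> // i j; rewrite !ord1; exact: qx.
Qed.

(** The centres range over the rational points and the radii over the [1/(n+1)], so that countably
    many cubes suffice. *)
Lemma open_cubes (R : realType) (D : set 'rV[R]_3) : open D ->
  exists (P : set nat) (q : nat -> 'rV[R]_3) (r : nat -> R),
    [/\ forall n, P n -> 0 < r n,
        forall n, P n -> forall x : 'rV[R]_3, (forall i, `|q n 0 i - x 0 i| <= r n) -> D x
      & D `<=` \bigcup_(n in P) ball (q n) (r n)].
Proof.
move=> oD.
pose dec (n : nat) : 'rV[rat]_3 * nat := odflt (0, 0%N) (unpickle n).
pose q n : 'rV[R]_3 := map_mx ratr (dec n).1.
pose r n : R := (dec n).2.+1%:R^-1.
have r0 n : 0 < r n by rewrite invr_gt0.
exists [set n | forall x : 'rV[R]_3, (forall i, `|q n 0 i - x 0 i| <= r n) -> D x], q, r.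
split=> // x Dx.
have [e /= e0 eD] : exists2 e : R, 0 < e & ball x e `<=` D.
  by have := oD _ Dx; rewrite -nbhs_ballE => -[e e0 ?]; exists e.
have [k ke] : exists k : nat, k.+1%:R^-1 < e / 2 :> R.
  have e20 : 0 < e / 2 by rewrite divr_gt0.
  have [k _ kP] := near_infty_natSinv_lt (PosNum e20).
  by exists k; exact: (kP k (leqnn k)).
have ki0 : 0 < k.+1%:R^-1 :> R by rewrite invr_gt0.
have H (i : 'I_3) : exists p : rat, `|ratr p - x 0 i| < k.+1%:R^-1 :> R.
  have : x 0 i - k.+1%:R^-1 < x 0 i + k.+1%:R^-1 by rewrite ltrD2l gtrN.
  move=> /rat_in_itvoo[p]; rewrite in_itv /= => /andP[p1 p2]; exists p.
  by rewrite ltr_distl p1 p2.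
have {H} [p pP] := choice H.
pose n := pickle ((\row_i p i : 'rV[rat]_3), k).
have dn : dec n = (\row_i p i, k) by rewrite /dec pickleK.
have qn i : q n 0 i = ratr (p i) by rewrite /q dn !mxE.
have rn : r n = k.+1%:R^-1 by rewrite /r dn.
exists n; last by apply/ball_rowP => // i; rewrite qn rn.
move=> y /= qy; apply: eD; apply/ball_rowP => // i.
have := qy i; rewrite qn rn => yi; have xi := pP i.
rewrite (splitr e) -(subrKA (ratr (p i))).
rewrite (le_lt_trans (ler_normD _ _))// ltrD//.
  by rewrite distrC (lt_trans xi).
by rewrite (le_lt_trans yi).
Qed.

Lemma measurable_open3 (R : realType) (D : set 'rV[R]_3) :
  open D -> measurable (@of_triple R @^-1` D : set (triple R)).
Proof.
move=> /open_cubes[P [q [r [r0 rD Dr]]]].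
have -> : @of_triple R @^-1` D = \bigcup_(n in P)
    ((ball (q n 0 (inord 0)) (r n) `*` ball (q n 0 (inord 1)) (r n))
      `*` ball (q n 0 (inord 2)) (r n)).
  apply/seteqP; split=> -[[a b] c] /=.
    move=> /Dr[n Pn] /(ball_rowP _ _ (r0 _ Pn)) qx; exists n => //=.
    rewrite /of_triple /= in qx; have [xa xb xc] := row3E a b c.
    have := qx (inord 0); have := qx (inord 1); have := qx (inord 2).
    by rewrite xa xb xc.
  move=> [n Pn /= [[qa qb] qc]]; apply: (rD _ Pn).
  rewrite /of_triple /=; have [xa xb xc] := row3E a b c.
  by elim/ord3P; rewrite ?xa ?xb ?xc; exact: ltW.
apply: bigcup_measurable => n Pn.
by apply: measurableX; [apply: measurableX|];
  apply: measurable_ball.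
Qed.

Lemma measurable_continuous3 (R : realType) (f : 'rV[R]_3 -> R) (A : set (triple R)) :
  continuous f -> measurable A -> measurable_fun A (f \o @of_triple R).
Proof.
move=> cf mA; apply: (measurable_funS measurableT) => //.
apply: (measurability _ (RGenOpens.measurableE R)).
move=> _ [_ [a [b ->] <-]]; rewrite setTI comp_preimage.
apply: measurable_open3.
by move/continuousP : cf; apply; exact: interval_open.
Qed.

Lemma leb3_box (R : realType) (A B C : set (measurableTypeR R)) :
  measurable A -> measurable B -> measurable C ->
  leb3 ((A `*` B) `*` C) =
  (lebesgue_measure A * lebesgue_measure B * lebesgue_measure C)%E.
Proof.
move=> mA mB mC; rewrite /leb3 product_measure1E//; last exact: measurableX.
by congr (_ * _)%E; exact: product_measure1E.
Qed.

Lemma le_norm_row (R : realType) (x : 'rV[R]_3) i : `|x 0 i| <= `|x|.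
Proof. by rewrite /Num.norm /= mx_normrE; exact: (le_bigmax _ (fun j => `|x j.1 j.2|) (0, i)). Qed.

Lemma bounded_rowP (R : realType) (D : set 'rV[R]_3) : bounded_set D ->
  exists2 r : R, 0 < r & forall x, D x -> forall i, `|x 0 i| <= r.
Proof.
move=> [M [Mr bD]]; exists (`|M| + 1); first by rewrite ltr_wpDl.
move=> x Dx i.
have := bD (`|M| + 1); rewrite ltr_pwDr// ?ler_norm// => /(_ isT _ Dx).
by apply: le_trans; exact: le_norm_row.
Qed.

Lemma leb3_bounded (R : realType) (D : set 'rV[R]_3) : bounded_set D ->
  measurable (@of_triple R @^-1` D : set (triple R)) ->
  (leb3 (@of_triple R @^-1` D) < +oo)%E.
Proof.
move=> /bounded_rowP[r r0 Dr] mD.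
pose I := `[(- r), r]%classic.
have mI : measurable (I : set R) by exact: measurable_itv.
apply: (@le_lt_trans _ _ (leb3 ((I `*` I) `*` I))).
  apply: le_measure; rewrite ?inE//.
    by do 2 apply: measurableX => //.
  move=> -[[a b] c] /= /Dr; rewrite /of_triple /=; have [xa xb xc] := row3E a b c.
  move=> H; have := H (inord 0); have := H (inord 1); have := H (inord 2).
  by rewrite xa xb xc /I /= !in_itv /= -!ler_norml => -> -> ->.
rewrite leb3_box// lebesgue_measure_itv /=.
by case: ifP => _; rewrite ?mule0// -EFinB -!EFinM ltry.
Qed.

(** A set that meets each section in a null set is null; stated for both orders of
    integration, so that a plane can be cut along any coordinate that it does not contain. *)
Lemma null_xsection d1 d2 (T1 : measurableType d1) (T2 : measurableType d2)
    (R : realType) (m1 : {sigma_finite_measure set T1 -> \bar R})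
    (m2 : {sigma_finite_measure set T2 -> \bar R}) (A : set (T1 * T2)) :
  (forall x, m2 (xsection A x) = 0) -> (m1 \x m2)%E A = 0.
Proof.
move=> A0; rewrite /product_measure1 /=.
by apply: integral0_eq => x _; exact: A0.
Qed.

Lemma null_ysection d1 d2 (T1 : measurableType d1) (T2 : measurableType d2)
    (R : realType) (m1 : {sigma_finite_measure set T1 -> \bar R})
    (m2 : {sigma_finite_measure set T2 -> \bar R}) (A : set (T1 * T2)) :
  measurable A ->
  (forall y, m1 (ysection A y) = 0) -> (m1 \x m2)%E A = 0.
Proof.
move=> mA A0.
rewrite (@product_measure_unique _ _ _ _ _ m1 m2 (m1 \x^ m2)%E) //.
  by rewrite /product_measure2 /=; apply: integral0_eq => x _; exact: A0.
by move=> B C mB mC; exact: product_measure2E.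
Qed.

Lemma coord_continuous3 (R : realType) (i : 'I_3) :
  continuous (fun x : 'rV[R]_3 => x 0 i).
Proof. exact: coord_continuous. Qed.

Lemma dot_continuous (R : realType) (b : 'rV[R]_3) : continuous (dot b).
Proof.
have -> : dot b = fun x => b 0 (inord 0) * x 0 (inord 0) +
    b 0 (inord 1) * x 0 (inord 1) + b 0 (inord 2) * x 0 (inord 2).
  by apply/funext => x; rewrite /dot sum_ord3.
have H i x : {for x, continuous (fun x : 'rV[R]_3 => b 0 i * x 0 i)}.
  by apply: continuousM; [exact: cst_continuous|exact: coord_continuous3].
by move=> x; exact: (continuousD (continuousD (H _ x) (H _ x)) (H _ x)).
Qed.

Lemma lebesgue_root0 (R : realType) (A : set R) (u v : R) : v != 0 ->
  (forall x, A x -> u + v * x = 0) -> lebesgue_measure A = 0.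
Proof.
move=> v0 Av.
have AS : A `<=` [set - u / v].
  by move=> x /Av /eqP; rewrite addrC addr_eq0 => /eqP uv /=; rewrite -uv mulrC mulKf.
have [->|->] := subset_set1 AS; first exact: measure0.
exact: lebesgue_measure_set1.
Qed.

Definition leb2 (R : realType) := (@lebesgue_measure R \x @lebesgue_measure R)%E.

HB.instance Definition _ (R : realType) := Measure.on (@leb2 R).

Lemma leb2_sigma_finite (R : realType) : sigma_finite setT (@leb2 R).
Proof.
pose I (n : nat) : set R := `]- n%:R, n%:R[%classic.
have mI n : measurable (I n) by exact: measurable_itv.
have II m n x : (m <= n)%N -> I m x -> I n x.
  rewrite /I /= !in_itv /= -!ltr_norml => mn /lt_le_trans; apply.
  by rewrite ler_nat.
have ex x : exists n, I n x.
  exists (Num.truncn `|x|).+1; rewrite /I /= in_itv /= -ltr_norml.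
  exact: truncnS_gt.
exists (fun n => I n `*` I n).
  apply/seteqP; split=> [[x y] _|//].
  have [[m xm] [n yn]] := (ex x, ex y).
  by exists (maxn m n) => //=; split; [apply: II xm|apply: II yn];
     rewrite ?leq_maxl ?leq_maxr.
move=> n; split; first by apply: measurableX; exact: mI.
have fI : (lebesgue_measure (I n) < +oo)%E.
  by rewrite lebesgue_measure_itv /=; case: ifP => _; rewrite ?ltry.
rewrite /leb2 product_measure1E; [|exact: mI|exact: mI].
apply: lte_mul_pinfty; [exact: measure_ge0| |exact: fI].
by rewrite ge0_fin_numE; [exact: fI|exact: measure_ge0].
Qed.

HB.instance Definition _ (R : realType) :=
  Measure_isSigmaFinite.Build _ _ _ (@leb2 R) (leb2_sigma_finite R).

Lemma leb3_plane (R : realType) (k : 'I_3) (b : 'rV[R]_3) (c : R) : b 0 k != 0 ->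
  leb3 (@of_triple R @^-1` [set x | c + dot b x = 0]) = 0.
Proof.
set P := [set x | _].
have mP : measurable (@of_triple R @^-1` P : set (triple R)).
  rewrite (_ : _ @^-1` P = (((fun x => c + dot b x) \o @of_triple R) @^-1` [set 0])) //.
  rewrite -[X in measurable X]setTI; apply: measurable_continuous3 => //.
  by move=> x; apply: continuousD; [exact: cst_continuous|exact: dot_continuous].
have PE p q r : (@of_triple R @^-1` P) (p, q, r) <->
    c + (b 0 (inord 0) * p + b 0 (inord 1) * q + b 0 (inord 2) * r) = 0.
  by rewrite /P /= /dot sum_ord3 /of_triple /=; have [-> -> ->] := row3E p q r.
have -> : @leb3 R = (@leb2 R \x @lebesgue_measure R)%E by [].
move: k; elim/ord3P => bk.
- apply: (@null_ysection _ _ _ _ R (@leb2 R) (@lebesgue_measure R) _ mP) => r.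
  apply: (@null_ysection _ _ _ _ R (@lebesgue_measure R) (@lebesgue_measure R) _ (measurable_ysection r mP)) => q.
  apply: (lebesgue_root0 (u := c + (b 0 (inord 1) * q + b 0 (inord 2) * r)) bk) => p.
  by rewrite /ysection /= !inE /= inE => /PE <-; ring.
- apply: (@null_ysection _ _ _ _ R (@leb2 R) (@lebesgue_measure R) _ mP) => r.
  apply: (@null_xsection _ _ _ _ R (@lebesgue_measure R) (@lebesgue_measure R)) => p.
  apply: (lebesgue_root0 (u := c + (b 0 (inord 0) * p + b 0 (inord 2) * r)) bk) => q.
  by rewrite /ysection /xsection /= !inE /= inE => /PE <-; ring.
- apply: (@null_xsection _ _ _ _ R (@leb2 R) (@lebesgue_measure R)) => -[p q].
  apply: (lebesgue_root0 (u := c + (b 0 (inord 0) * p + b 0 (inord 1) * q)) bk) => r.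
  by rewrite /xsection /= !inE /= => /PE <-; ring.
Qed.

(** * Almost everywhere statements and square-integrable functions *)

Section Almost.
Variables (R : realType) (D : set 'rV[R]_3).
Implicit Types P Q : 'rV[R]_3 -> Prop.

Lemma ae_on_all P : (forall x, D x -> P x) -> ae_on D P.
Proof. by move=> DP; apply: aeW => p; exact: DP. Qed.

Lemma ae_on_mono P Q : (forall x, D x -> P x -> Q x) -> ae_on D P -> ae_on D Q.
Proof.
move=> PQ; rewrite /ae_on; apply: filterS => p Pp Dp.
by apply: PQ => //; exact: Pp.
Qed.

Lemma ae_on_and P Q : ae_on D P -> ae_on D Q -> ae_on D (fun x => P x /\ Q x).
Proof.
by rewrite /ae_on => p q; apply: filterS2 p q => z p q Dz; split; [exact: p|exact: q].
Qed.

Lemma ae_on2 P Q S : (forall x, D x -> P x -> Q x -> S x) ->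
  ae_on D P -> ae_on D Q -> ae_on D S.
Proof.
move=> PQS aP aQ; apply: ae_on_mono (ae_on_and aP aQ) => x Dx [Px Qx].
exact: PQS.
Qed.

Lemma ae_on_ord n (P : 'I_n -> 'rV[R]_3 -> Prop) :
  (forall i, ae_on D (P i)) -> ae_on D (fun x => forall i, P i x).
Proof.
move=> aP; rewrite /ae_on.
have : \forall p \ae (@leb3 R), forall i : 'I_n, D (of_triple p) -> P i (of_triple p).
  by apply: filter_forall; exact: aP.
by apply: filterS => p Pp Dp i; exact: Pp.
Qed.

Lemma ae_onS (D' : set 'rV[R]_3) P : D `<=` D' -> ae_on D' P -> ae_on D P.
Proof. by move=> DD'; rewrite /ae_on; apply: filterS => p Pp /DD'; exact: Pp. Qed.

Lemma ae_on_seq (T : eqType) (s : seq T) (P : T -> 'rV[R]_3 -> Prop) :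
  (forall t, t \in s -> ae_on D (P t)) ->
  ae_on D (fun x => forall t, t \in s -> P t x).
Proof.
elim: s => [_|t s ih ts]; first exact: ae_on_all.
have := ih (fun u us => ts u (mem_behead (s := t :: s) us)).
apply: ae_on2 (ts t (mem_head _ _)) => x Dx Pt Ps u; rewrite inE => /predU1P[->//|].
exact: Ps.
Qed.

End Almost.

Definition meas_on (R : realType) (D : set 'rV[R]_3) (f : 'rV[R]_3 -> R) :=
  measurable_fun (@of_triple R @^-1` D) (f \o @of_triple R).

Definition int_on (R : realType) (D : set 'rV[R]_3) (f : 'rV[R]_3 -> R) :=
  (@leb3 R).-integrable (@of_triple R @^-1` D) (EFin \o (f \o @of_triple R)).

Section Integrals.
Variables (R : realType) (D : set 'rV[R]_3).
Hypothesis oD : open D.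
Implicit Types f g h : 'rV[R]_3 -> R.
Let E := @of_triple R @^-1` D.
Let mE : measurable (E : set (triple R)) := measurable_open3 oD.

Lemma meas_onM f g : meas_on D f -> meas_on D g -> meas_on D (fun x => f x * g x).
Proof. by move=> mf mg; apply: (measurable_funM mf mg). Qed.

Lemma meas_onD f g : meas_on D f -> meas_on D g -> meas_on D (fun x => f x + g x).
Proof. by move=> mf mg; apply: (measurable_funD mf mg). Qed.

Lemma int_on_meas f : int_on D f -> meas_on D f.
Proof. by move=> /measurable_int /measurable_EFinP. Qed.

Lemma int_on_le f g : meas_on D f -> int_on D g ->
  (forall x, D x -> `|f x| <= `|g x|) -> int_on D f.
Proof.
move=> mf ig fg; apply: (le_integrable mE _ _ ig).
  exact/measurable_EFinP.
by move=> p Dp /=; rewrite lee_fin; exact: fg.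
Qed.

Lemma int_onD f g : int_on D f -> int_on D g -> int_on D (fun x => f x + g x).
Proof. by move=> i j; exact: (integrableD mE i j). Qed.

Lemma int_onZ (a : R) f : int_on D f -> int_on D (fun x => a * f x).
Proof. by move=> i; exact: (integrableZl mE a i). Qed.

Lemma integral3D f g : int_on D f -> int_on D g ->
  integral3 D (fun x => f x + g x) = integral3 D f + integral3 D g.
Proof. by move=> i j; exact: (RintegralD mE i j). Qed.

Lemma integral3Z (a : R) f : int_on D f ->
  integral3 D (fun x => a * f x) = a * integral3 D f.
Proof. by move=> i; exact: (RintegralZl a mE i). Qed.

Lemma integral3_ae f g : meas_on D f -> meas_on D g ->
  ae_on D (fun x => f x = g x) -> integral3 D f = integral3 D g.
Proof.
move=> mf mg fg; rewrite /integral3 /Rintegral; congr fine.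
apply: ae_eq_integral => //; [exact/measurable_EFinP|exact/measurable_EFinP|].
by move: fg; rewrite /ae_on; apply: filterS => p fg Dp /=; rewrite fg.
Qed.

Lemma int_on_ae f g : int_on D f -> meas_on D g ->
  ae_on D (fun x => f x = g x) -> int_on D g.
Proof.
move=> /integrableP[mf ifi] mg fg; apply/integrableP; split.
  exact/measurable_EFinP.
apply: le_lt_trans ifi; rewrite le_eqVlt; apply/orP; left; apply/eqP.
apply: ae_eq_integral => //.
- by apply: measurableT_comp => //; exact/measurable_EFinP.
- exact: measurableT_comp.
- by move: fg; rewrite /ae_on; apply: filterS => p fg Dp /=; rewrite fg.
Qed.

Lemma integral3_eq f g : (forall x, D x -> f x = g x) -> integral3 D f = integral3 D g.
Proof. by move=> fg; apply: eq_Rintegral => p; rewrite inE; exact: fg. Qed.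

Lemma integral3_eq0 f : meas_on D f -> (forall x, D x -> 0 <= f x) -> int_on D f ->
  integral3 D f = 0 -> ae_on D (fun x => f x = 0).
Proof.
move=> mf f0 /[dup] fi /integrableP[_ ify] If0.
have H : (\int[@leb3 R]_(p in E) `|(EFin \o (f \o @of_triple R)) p| = 0)%E.
  move: If0; rewrite /integral3 /Rintegral => If0.
  rewrite -(@fineK _ (\int[@leb3 R]_(p in E) _)%E); last first.
    by rewrite ge0_fin_numE//; exact: integral_ge0.
  congr EFin; rewrite -[RHS]If0; congr fine; apply: eq_integral => p.
  by rewrite inE => Ep /=; rewrite ger0_norm//; exact: f0.
have := (ae_eq_integral_abs (@leb3 R) mE (measurable_int _ fi)).1 H.
by rewrite /ae_on; apply: filterS => p Hp Ep; have [] := Hp Ep.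
Qed.

End Integrals.

Section SquareIntegrable.
Variables (R : realType) (D : set 'rV[R]_3).
Hypotheses (oD : open D) (bD : bounded_set D).
Implicit Types f g h : 'rV[R]_3 -> R.
Let E := @of_triple R @^-1` D.
Let mE : measurable (E : set (triple R)) := measurable_open3 oD.

Lemma L2_meas f : L2 D f -> meas_on D f. Proof. by case. Qed.

Lemma L2_sqr f : L2 D f -> int_on D (fun x => f x ^+ 2).
Proof. by case. Qed.

Lemma L2_le f g h : meas_on D f -> L2 D g -> L2 D h ->
  (forall x, D x -> f x ^+ 2 <= g x ^+ 2 + h x ^+ 2) -> L2 D f.
Proof.
move=> mf g2 h2 fgh; split=> //.
change (int_on D (fun x => f x ^+ 2)).
apply: (int_on_le oD (g := fun x => g x ^+ 2 + h x ^+ 2)).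
- exact: measurable_funX.
- by apply: int_onD => //; exact: L2_sqr.
- move=> x Dx; rewrite ger0_norm ?sqr_ge0// ger0_norm ?addr_ge0 ?sqr_ge0//.
  exact: fgh.
Qed.

Lemma L2Z (a : R) f : L2 D f -> L2 D (fun x => a * f x).
Proof.
move=> [mf f2]; split; first by apply: measurable_funM => //; exact: measurable_cst.
rewrite (_ : EFin \o _ = EFin \o ((fun x => a ^+ 2 * f x ^+ 2) \o @of_triple R)).
  exact: int_onZ.
by apply/funext => p /=; rewrite exprMn.
Qed.

Lemma L2D f g : L2 D f -> L2 D g -> L2 D (fun x => f x + g x).
Proof.
move=> f2 g2; apply: (L2_le _ (L2Z 2 f2) (L2Z 2 g2)).
  by apply: meas_onD; exact: L2_meas.
by move=> x _; rewrite -subr_ge0; have := sqr_ge0 (f x - g x);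
  have := sqr_ge0 (f x); have := sqr_ge0 (g x); nra.
Qed.

Lemma L2_lin (a : R) f g : L2 D f -> L2 D g -> L2 D (fun x => a * f x + g x).
Proof. by move=> f2 g2; apply: L2D => //; exact: L2Z. Qed.

Lemma L2_bounded (c : R) f : meas_on D f -> (forall x, D x -> `|f x| <= c) -> L2 D f.
Proof.
move=> mf fc; split=> //.
change (int_on D (fun x => f x ^+ 2)).
apply: (int_on_le oD (g := fun=> c ^+ 2)); first exact: measurable_funX.
- apply/integrableP; split; first by apply/measurable_EFinP; exact: measurable_cst.
  rewrite (eq_integral (cst (`|c ^+ 2|)%:E))//.
  rewrite integral_cst// lte_mul_pinfty//.
  exact: leb3_bounded.
- move=> x Dx; rewrite !normrX; apply: lerXn2r; rewrite ?nnegrE//.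
  exact: le_trans (fc x Dx) (ler_norm _).
Qed.

Lemma L2_cst (c : R) : L2 D (fun=> c).
Proof. by apply: (@L2_bounded `|c|) => //; exact: measurable_cst. Qed.

Lemma L2_sum n (F : 'I_n -> 'rV[R]_3 -> R) : (forall i, L2 D (F i)) ->
  L2 D (fun x => \sum_(i < n) F i x).
Proof.
move=> F2; have : forall s : seq 'I_n, L2 D (fun x => \sum_(i <- s) F i x).
  elim=> [|i s ih].
    by rewrite (_ : (fun x => _) = fun=> 0); [exact: L2_cst|apply/funext => x; rewrite big_nil].
  rewrite (_ : (fun x => _) = fun x => F i x + \sum_(i <- s) F i x); first exact: L2D.
  by apply/funext => x; rewrite big_cons.
exact.
Qed.

Lemma L2_mul f g : L2 D f -> L2 D g -> int_on D (fun x => f x * g x).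
Proof.
move=> f2 g2.
apply: (int_on_le oD (g := fun x => f x ^+ 2 + g x ^+ 2)).
- by apply: meas_onM; exact: L2_meas.
- by apply: int_onD => //; exact: L2_sqr.
- move=> x _; rewrite [leRHS]ger0_norm ?addr_ge0 ?sqr_ge0//.
  rewrite ler_norml -subr_ge0 -[X in _ && X]subr_ge0.
  have := sqr_ge0 (f x - g x); have := sqr_ge0 (f x + g x);
  have := sqr_ge0 (f x); have := sqr_ge0 (g x) => *; apply/andP; split; nra.
Qed.

Lemma L2_int f : L2 D f -> int_on D f.
Proof.
move=> f2; have := L2_mul f2 (L2_cst 1).
by under [X in int_on _ X -> _]funext do rewrite mulr1.
Qed.

(** Truncating [g] at the essential bound changes it only on a null set. A pointwise bound would be
    too much to ask of piecewise polynomial fields that are determined up to null sets. *)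
Lemma L2_mul_ae_bounded (c : R) f g : L2 D f -> meas_on D g ->
  ae_on D (fun x => `|g x| <= c) -> L2 D (fun x => g x * f x).
Proof.
move=> f2 mg gc.
have mf := L2_meas f2.
split; first by apply: measurable_funM.
pose c' := Num.max c 0.
pose g' x := Num.max (- c') (Num.min (g x) c').
have mg' : meas_on D g'.
  apply: measurable_maxr; first exact: measurable_cst.
  by apply: measurable_minr => //; exact: measurable_cst.
have c'0 : 0 <= c' by rewrite le_max lexx orbT.
have g'c x : `|g' x| <= c'.
  rewrite ler_norml /g' le_max lexx /= ge_max ge_min lexx orbT andbT.
  by rewrite (le_trans _ c'0)// oppr_le0.
change (int_on D (fun x => (g x * f x) ^+ 2)).
apply: (int_on_ae oD (f := fun x => (g' x * f x) ^+ 2)).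
- apply: (int_on_le oD (g := fun x => c' ^+ 2 * f x ^+ 2)).
  + by apply: measurable_funX; exact: meas_onM.
  + by apply: int_onZ => //; exact: L2_sqr.
  + move=> x Dx; rewrite exprMn [leLHS]normrM [leRHS]normrM; apply: ler_wpM2r => //.
    by rewrite !normrX (ger0_norm c'0); apply: lerXn2r; rewrite ?nnegrE.
- by apply: measurable_funX; exact: meas_onM.
- apply: ae_on_mono gc => x Dx gc; congr ((_ * _) ^+ 2).
  have := gc; rewrite ler_norml => /andP[gc1 gc2].
  have c'c : c <= c' by rewrite le_max lexx.
  rewrite /g' min_l ?(le_trans gc2)// max_r// (le_trans _ gc1)//.
  by rewrite lerN2.
Qed.

Lemma ipC f g : ip D f g = ip D g f.
Proof. by apply: integral3_eq => x _; rewrite mulrC. Qed.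

Lemma ip_linl (a : R) f g h : L2 D f -> L2 D g -> L2 D h ->
  ip D (fun x => a * f x + g x) h = a * ip D f h + ip D g h.
Proof.
move=> f2 g2 h2; rewrite /ip -integral3Z//; last exact: L2_mul.
rewrite -integral3D//; [|apply: int_onZ => //; exact: L2_mul|exact: L2_mul].
by apply: integral3_eq => x _; ring.
Qed.

Lemma ip_linr (a : R) f g h : L2 D f -> L2 D g -> L2 D h ->
  ip D h (fun x => a * f x + g x) = a * ip D h f + ip D h g.
Proof. by move=> f2 g2 h2; rewrite !(ipC h) ip_linl. Qed.

Lemma ip_ael f f' g : L2 D f -> L2 D f' -> L2 D g ->
  ae_on D (fun x => f x = f' x) -> ip D f g = ip D f' g.
Proof.
move=> f2 f'2 g2 ff'; apply: integral3_ae => //.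
- by apply: meas_onM; exact: L2_meas.
- by apply: meas_onM; exact: L2_meas.
- by apply: ae_on_mono ff' => x _ ->.
Qed.

Lemma ip_aer f f' g : L2 D f -> L2 D f' -> L2 D g ->
  ae_on D (fun x => f x = f' x) -> ip D g f = ip D g f'.
Proof. by move=> f2 f'2 g2 ff'; rewrite !(ipC g); exact: ip_ael. Qed.

Lemma ip_ge0 f : 0 <= ip D f f.
Proof. by apply: Rintegral_ge0 => x _; rewrite -expr2 sqr_ge0. Qed.

Lemma ip_eq0 f : L2 D f -> ip D f f = 0 -> null D f.
Proof.
move=> f2 f0.
have : ae_on D (fun x => f x ^+ 2 = 0).
  apply: (integral3_eq0 oD _ _ (L2_sqr f2)).
  - by apply: measurable_funX; exact: L2_meas.
  - by move=> x _; exact: sqr_ge0.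
  - by rewrite -f0; apply: integral3_eq => x _; rewrite expr2.
by apply: ae_on_mono => x _ /eqP; rewrite sqrf_eq0 => /eqP.
Qed.

Lemma bounded_within (f : 'rV[R]_3 -> R) : {within closure D, continuous f} ->
  exists c : R, forall x, D x -> `|f x| <= c.
Proof.
move=> cf.
have bcD : bounded_set (closure D).
  have [r r0 Dr] := bounded_rowP bD.
  exists r; split; first exact: gtr0_real.
  move=> s rs x Dx /=; have s0 : 0 <= s by rewrite (le_trans (ltW r0))// ltW.
  have [y [Dy xy]] : exists y, D y /\ ball x (s - r) y.
    have [|y [Dy xy]] := Dx (ball x (s - r)); last by exists y.
    by apply: nbhsx_ballx; rewrite subr_gt0.
  rewrite /Num.norm /= mx_normrE; apply: bigmax_le => //= -[i j] _ /=.
  rewrite !ord1; move/ball_rowP : xy => /(_ _); rewrite subr_gt0 => /(_ rs j) xy.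
  rewrite -(subrK (y 0 j) (x 0 j)) (le_trans (ler_normD _ _))//.
  by rewrite -(subrK r s); apply: lerD; [exact: ltW|exact: Dr].
have cc : compact (closure D).
  by apply: bounded_closed_compact => //; exact: closed_closure.
have /compact_bounded[M [Mr fM]] := continuous_compact cf cc.
exists (`|M| + 1) => x Dx.
apply: (fM (`|M| + 1)); first by rewrite ltr_pwDr// ler_norm.
by exists x => //; exact: subset_closure.
Qed.

Lemma L2_continuous (f : 'rV[R]_3 -> R) : continuous f -> L2 D f.
Proof.
move=> cf; have [c fc] : exists c : R, forall x, D x -> `|f x| <= c.
  by apply: bounded_within; exact: continuous_subspaceT.
by apply: (@L2_bounded c) => //; exact: measurable_continuous3.
Qed.

End SquareIntegrable.

(** * Smooth bump functions on the line *)

Section Flat.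
Variable R : realType.

(** [flat 1] is exp(-1/t) for positive t, extended by 0; the polynomial in 1/t makes the family closed
    under differentiation. *)
Definition flat (P : {poly R}) (t : R) : R :=
  if 0 < t then P.[t^-1] * expR (- t^-1) else 0.

Definition flat_deriv (P : {poly R}) : {poly R} := 'X^2 * (P - P^`()).

(** Since [s ^+ n / n!] is a term of the exponential series, [s ^+ n * expR (- s) <= n!]. *)
Lemma poly_expRN_bounded (P : {poly R}) :
  exists2 C : R, 0 <= C & forall s, 0 < s -> `|P.[s]| * expR (- s) <= C.
Proof.
have mono n (s : R) : 0 < s -> s ^+ n * expR (- s) <= n`!%:R.
  move=> s0; rewrite expRN ler_pdivrMr ?expR_gt0//.
  case: n => [|n]; first by rewrite expr0 fact0 mul1r -[leLHS]expR0 ler_expR ltW.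
  have := expR_ge1Dxn n (ltW s0).
  have f0 : 0 < (n.+1)`!%:R :> R by rewrite ltr0n fact_gt0.
  move=> H; rewrite -(ler_pdivrMl _ _ f0) mulrC; apply: le_trans H.
  by rewrite lerDr.
exists (\sum_(i < size P) `|P`_i| * i`!%:R).
  by apply: sumr_ge0 => i _; rewrite mulr_ge0.
move=> s s0; rewrite horner_coef.
apply: (@le_trans _ _ (\sum_(i < size P) `|P`_i * s ^+ i| * expR (- s))).
  by rewrite -mulr_suml ler_wpM2r ?expR_ge0// ler_norm_sum.
apply: ler_sum => i _; rewrite normrM (ger0_norm (exprn_ge0 _ (ltW s0))) -mulrA.
by rewrite ler_wpM2l// mono.
Qed.

(** Decay of order two at the origin makes the derivative there vanish. *)
Lemma flat_le_sqr (P : {poly R}) :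
  exists2 C : R, 0 <= C & forall t, `|flat P t| <= C * t ^+ 2.
Proof.
have [C C0 PC] := poly_expRN_bounded (P * 'X^2).
exists C => // t; rewrite /flat; case: ifPn => [t0|_]; last first.
  by rewrite normr0 mulr_ge0// sqr_ge0.
have := PC t^-1; rewrite invr_gt0 => /(_ t0).
have -> : `|(P * 'X^2).[t^-1]| = `|P.[t^-1]| / t ^+ 2.
  by rewrite hornerM hornerXn normrM exprVn [X in _ * X]ger0_norm// invr_ge0 sqr_ge0.
rewrite normrM (ger0_norm (expR_ge0 _)) mulrAC.
by rewrite ler_pdivrMr// exprn_gt0.
Qed.

Lemma is_derive_ext (V : normedModType R) (f g : V -> R) (x v : V) (d d' : R) :
  is_derive x v f d -> f =1 g -> d = d' -> is_derive x v g d'.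
Proof. by move=> fd fg <-; have <- : f = g by apply/funext. Qed.

Lemma is_derive_flat (P : {poly R}) (t : R) :
  is_derive t 1 (flat P) (flat (flat_deriv P) t).
Proof.
have [t0|t0|t0] := ltgtP 0 t.
- apply: (@near_eq_is_derive R R R (fun s : R => P.[s^-1] * expR (- s^-1))).
    near=> s; rewrite /flat ifT//; near: s; exact: lt_nbhsr.
  have tn0 : t != 0 by rewrite gt_eqF.
  have dV : is_derive t 1 (fun s : R => s^-1) (- t ^- 2).
    have := @is_deriveV R id t 1 1 tn0 (is_derive_id _ _).
    by rewrite /= -[X in is_derive _ _ _ X]/(- t ^- 2 * 1) mulr1.
  have dP := is_derive1_comp (is_derive_poly P t^-1) dV.
  have dE := @is_derive1_comp R expR (fun s : R => - s^-1) t _ _ (is_derive_expR _) (is_deriveN dV).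
  have := is_deriveM dP dE.
  move/is_derive_ext; apply => //; rewrite /flat t0 /flat_deriv /= -![_ *: _]/(_ * _).
  by rewrite hornerM hornerXn hornerD hornerN exprVn; ring.
- apply: (@near_eq_is_derive R R R (cst 0)).
    near=> s; rewrite /flat ifF//; apply/negbTE; rewrite -leNgt ltW//.
    near: s; exact: lt_nbhsl.
  by rewrite /flat ifF; [exact: is_derive_cst|apply/negbTE; rewrite -leNgt ltW].
- rewrite -t0 /flat ltxx; have [C C0 PC] := flat_le_sqr P.
  have H : h^-1 *: ((flat P \o shift 0) (h *: 1) - flat P 0) @[h --> 0^'] --> (0 : R).
    apply/cvgrPdist_le => e e0; near=> h.
    rewrite /= sub0r normrN /flat ltxx subr0 addr0 -/(flat P _).
    rewrite -[_ *: _]/(_ * _) -[_ *: _]/(_ * _) mulr1 normrM normfV.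
    have h0 : 0 < `|h| by rewrite normr_gt0; near: h; exact: nbhs_dnbhs_neq.
    have hC : `|h| < e / (C + 1).
      by near: h; apply: dnbhs0_lt; rewrite divr_gt0// ltr_wpDl.
    rewrite ler_pdivrMl// (le_trans (PC h))// -real_normK ?num_real// expr2.
    rewrite mulrCA ler_wpM2l//.
    move: hC; rewrite ltr_pdivlMr ?ltr_wpDl// => /ltW; apply: le_trans.
    by rewrite mulrC ler_wpM2l// lerDl.
  by apply: DeriveDef; [exact: cvgP H|exact: cvg_lim H].
Unshelve. all: by end_near. Qed.

(** The inductive presentation makes this class of smooth functions closed under differentiation, so that
    all derivatives exist as soon as the first one does. *)
Inductive smooth1 : (R -> R) -> Prop :=
| smooth1_flat P s a : smooth1 (fun t => flat P (s * t + a))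
| smooth1_cst c : smooth1 (fun=> c)
| smooth1D f g : smooth1 f -> smooth1 g -> smooth1 (fun t => f t + g t)
| smooth1M f g : smooth1 f -> smooth1 g -> smooth1 (fun t => f t * g t).

Lemma smooth1_derive f : smooth1 f ->
  exists2 f', smooth1 f' & forall t : R, is_derive t 1 f (f' t).
Proof.
elim=> [P s a|c|{}f g _ [f' sf' ff'] _ [g' sg' gg']|{}f g sf [f' sf' ff'] sg [g' sg' gg']].
- exists (fun t => s * flat (flat_deriv P) (s * t + a)).
    by apply: smooth1M; [exact: smooth1_cst|exact: smooth1_flat].
  move=> t; have da : is_derive t 1 (fun t => s * t + a) s.
    have := is_deriveD (is_deriveM (is_derive_cst s t 1) (is_derive_id t 1)) (is_derive_cst a t 1).
    by move/is_derive_ext; apply => //; rewrite -![_ *: _]/(_ * _) /= /cst; ring.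
  have := @is_derive1_comp R (flat P) (fun t : R => s * t + a) t _ _ (is_derive_flat P _) da.
  by move/is_derive_ext; apply => //; rewrite mulrC.
- exists (fun=> 0); first exact: smooth1_cst.
  by move=> t; exact: is_derive_cst.
- exists (fun t => f' t + g' t); first exact: smooth1D.
  by move=> t; exact: is_deriveD.
- exists (fun t => f t * g' t + g t * f' t).
    by apply: smooth1D; exact: smooth1M.
  by move=> t; exact: is_deriveM.
Qed.

Lemma smooth1_continuous f : smooth1 f -> continuous f.
Proof.
move=> /smooth1_derive[f' _ ff'] t.
apply: differentiable_continuous; apply/derivable1_diffP.
by have [] := ff' t.
Qed.

Definition bump (a b t : R) : R := flat 1 (t - a) * flat 1 (b - t).

Lemma flat1_itv (t : R) : 0 <= flat 1 t <= 1 /\ (0 < flat 1 t <-> 0 < t).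
Proof.
rewrite /flat; case: ifPn => [t0|t0]; last by rewrite lexx ler01 ltxx.
rewrite hornerC mul1r expR_ge0 expR_gt0; split=> //.
by rewrite -[leRHS]expR0 ler_expR oppr_le0 invr_ge0 ltW.
Qed.

Lemma bump_itv (a b t : R) : 0 <= bump a b t <= 1 /\ (0 < bump a b t <-> a < t < b).
Proof.
have [/andP[f0 f1] fp] := flat1_itv (t - a).
have [/andP[g0 g1] gp] := flat1_itv (b - t).
split; first by rewrite /bump mulr_ge0//= mulr_ile1.
rewrite /bump; split=> [fg|/andP[ta tb]]; last first.
  by apply: mulr_gt0; [apply/fp|apply/gp]; rewrite subr_gt0.
have : 0 < flat 1 (t - a).
  by rewrite lt_neqAle f0 andbT; apply: contraL fg => /eqP <-; rewrite mul0r ltxx.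
have : 0 < flat 1 (b - t).
  by rewrite lt_neqAle g0 andbT; apply: contraL fg => /eqP <-; rewrite mulr0 ltxx.
by move=> /gp + /fp; rewrite !subr_gt0 => -> ->.
Qed.

Lemma smooth1_bump (a b : R) : smooth1 (bump a b).
Proof.
rewrite (_ : bump a b = fun t => flat 1 (1 * t + - a) * flat 1 (-1 * t + b)).
  by apply: smooth1M; exact: smooth1_flat.
by apply/funext => t; rewrite /bump mul1r mulN1r (addrC _ b).
Qed.

(** Where the bump is positive, [1 - bump] is less than 1 and its powers tend to 0; elsewhere the
    plateau is 0. The plateaus thus converge to the indicator function of the open interval. *)
Definition plateau (n : nat) (a b t : R) : R := 1 - (1 - bump a b t) ^+ n.+1.

Lemma smooth1X f n : smooth1 f -> smooth1 (fun t => f t ^+ n).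
Proof.
move=> sf; elim: n => [|n ih].
  by rewrite (_ : (fun _ => _) = fun=> 1); [exact: smooth1_cst|apply/funext => t; rewrite expr0].
rewrite (_ : (fun _ => _) = fun t => f t * f t ^+ n); first exact: smooth1M.
by apply/funext => t; rewrite exprS.
Qed.

Lemma smooth1_plateau n (a b : R) : smooth1 (plateau n a b).
Proof.
rewrite (_ : plateau n a b = fun t => 1 + -1 * (1 + -1 * bump a b t) ^+ n.+1); last first.
  by apply/funext => t; rewrite /plateau !mulN1r.
apply: smooth1D; first exact: smooth1_cst.
apply: smooth1M; first exact: smooth1_cst.
apply: smooth1X; apply: smooth1D; first exact: smooth1_cst.
apply: smooth1M; first exact: smooth1_cst.
exact: smooth1_bump.
Qed.

Lemma plateau_itv n (a b t : R) : 0 <= plateau n a b t <= 1.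
Proof.
have [/andP[b0 b1] _] := bump_itv a b t.
rewrite /plateau subr_ge0 gerBl exprn_ge0 ?subr_ge0// andbT.
by rewrite exprn_ile1// ?subr_ge0// gerBl.
Qed.

Lemma plateau_out n (a b t : R) : ~~ (a < t < b) -> plateau n a b t = 0.
Proof.
move=> tab; have [/andP[b0 _] bp] := bump_itv a b t.
suff -> : plateau n a b t = 1 - (1 - 0) ^+ n.+1 by rewrite subr0 expr1n subrr.
rewrite /plateau; congr (1 - (1 - _) ^+ _); apply/eqP.
by rewrite eq_le b0 andbT leNgt; apply: contra tab => /bp.
Qed.

Lemma plateau_cvg (a b t : R) :
  plateau n a b t @[n --> \oo] --> ((a < t < b)%R%:R : R).
Proof.
case: (boolP (a < t < b)) => tab; last first.
  rewrite (_ : (fun _ => _) = fun=> 0); first exact: cvg_cst.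
  by apply/funext => n; rewrite plateau_out.
have [/andP[b0 b1] bp] := bump_itv a b t.
rewrite -[X in _ --> X]subr0; apply: cvgB; first exact: cvg_cst.
have : (1 - bump a b t) ^+ n @[n --> \oo] --> (0 : R).
  apply: cvg_expr; rewrite ger0_norm ?subr_ge0// gtrBl.
  exact/bp.
by rewrite -(cvg_shiftS _).
Qed.

End Flat.

(** * The fundamental lemma of the calculus of variations *)

Notation unit3 i := (delta_mx 0 i).

Lemma is_derive_line (R : realType) (F : 'rV[R]_3 -> R) (x v : 'rV[R]_3) (t d : R) :
  is_derive (t *: v + x) v F d <-> is_derive t 1 (fun s : R => F (s *: v + x)) d.
Proof.
have H : (fun h : R => h^-1 *: ((F \o shift (t *: v + x)) (h *: v) - F (t *: v + x))) =
    (fun h : R => h^-1 *: (((fun s : R => F (s *: v + x)) \o shift t) (h *: 1) - F (t *: v + x))).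
  apply/funext => h /=; congr (_ *: (F _ - _)).
  by rewrite addrA scalerDl -[h *: 1]/(h * 1) mulr1.
have dE : derivable F (t *: v + x) v = derivable (fun s : R => F (s *: v + x)) t 1.
  by rewrite /derivable H.
have vE : 'D_v F (t *: v + x) = 'D_1 (fun s : R => F (s *: v + x)) t.
  by rewrite /derive H.
split=> -[de dv]; apply: DeriveDef.
- by move: de; rewrite dE.
- by move: dv; rewrite vE.
- by move: de; rewrite -dE.
- by move: dv; rewrite -vE.
Qed.

Lemma is_derive_line0 (R : realType) (F : 'rV[R]_3 -> R) (x v : 'rV[R]_3) (d : R) :
  is_derive x v F d <-> is_derive (0 : R) 1 (fun s : R => F (s *: v + x)) d.
Proof. by rewrite -is_derive_line scale0r add0r. Qed.

Section Tensor.
Variable R : realType.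
Implicit Types (f : 'I_3 -> R -> R) (x : 'rV[R]_3).

Definition tensor f : 'rV[R]_3 -> R := fun x => \prod_j f j (x 0 j).

(** Products of functions of one coordinate are closed under partial derivatives, which turns
    smoothness in one variable into smoothness in the sense of iterated partial derivatives. *)
Lemma tensor_partial f : (forall j, smooth1 (f j)) -> forall i,
  exists2 f', (forall j, smooth1 (f' j)) &
    forall x, is_derive x (unit3 i) (tensor f) (tensor f' x).
Proof.
move=> sf i; have [g sg fg] := smooth1_derive (sf i).
exists (fun j => if j == i then g else f j); first by move=> j; case: ifP.
move=> x; apply/is_derive_line0.
pose c := \prod_(j | j != i) f j (x 0 j).
have dx : is_derive (0 : R) 1 (fun s => s + x 0 i) 1.
  have := is_deriveD (is_derive_id (0 : R) 1) (is_derive_cst (x 0 i) (0 : R) 1).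
  by move/is_derive_ext; apply => //; rewrite addr0.
have := @is_derive1_comp R (f i) (fun s => s + x 0 i) 0 _ _ (fg _) dx.
rewrite add0r mulr1 => dfi.
have := is_deriveM (is_derive_cst c (0 : R) 1) dfi.
move/is_derive_ext; apply => [s|].
  rewrite /tensor (bigD1 i)//= !mxE !eqxx mulr1 [RHS]mulrC; congr (_ * _).
  by apply: eq_bigr => j ji; rewrite !mxE eqxx (negbTE ji) mulr0 add0r.
rewrite scaler0 addr0 /tensor (bigD1 i)//= eqxx -[_ *: _]/(_ * _) mulrC; congr (_ * _).
by apply: eq_bigr => j /negbTE ->.
Qed.

Lemma tensor_continuous f : (forall j, smooth1 (f j)) -> continuous (tensor f).
Proof.
move=> sf x.
rewrite (_ : tensor f = (fun y => f (inord 0) (y 0 (inord 0)) *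
   f (inord 1) (y 0 (inord 1)) * f (inord 2) (y 0 (inord 2)))); last first.
  by apply/funext => y; rewrite /tensor prod_ord3.
have H j : {for x, continuous (fun y : 'rV[R]_3 => f j (y 0 j))}.
  apply: continuous_comp; first exact: coord_continuous3.
  exact: (smooth1_continuous (sf j)).
exact: (continuousM (continuousM (H _) (H _)) (H _)).
Qed.

Lemma tensor_smooth f : (forall j, smooth1 (f j)) -> smooth (tensor f).
Proof.
move=> sf s.
suff [g sg ->] : exists2 g, (forall j, smooth1 (g j)) & partials s (tensor f) = tensor g.
  split; first exact: tensor_continuous.
  by move=> i x; have [g' _ /(_ x)[]] := tensor_partial sg i.
elim: s => [|i s [g sg gE]]; first by exists f.
have [g' sg' gg'] := tensor_partial sg i.
exists g' => //; apply/funext => x.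
by rewrite [LHS]/= gE; have [_] := gg' x.
Qed.

Definition box (a b : 'rV[R]_3) : set 'rV[R]_3 := [set x | forall j, a 0 j < x 0 j < b 0 j].
Definition cbox (a b : 'rV[R]_3) : set 'rV[R]_3 := [set x | forall j, a 0 j <= x 0 j <= b 0 j].

Lemma compact_cbox (a b : 'rV[R]_3) : compact (cbox a b).
Proof.
apply: bounded_closed_compact.
  exists (`|a| + `|b|); split; first exact: num_real.
  move=> s rs x Dx /=; apply: ltW; apply: le_lt_trans rs.
  rewrite [leLHS]/Num.norm /= mx_normrE; apply: bigmax_le => [|[i j] _ /=].
    by rewrite addr_ge0.
  rewrite !ord1; have /andP[ax xb] := Dx j.
  have /ler_normlP[a1 a2] := le_norm_row a j; have /ler_normlP[b1 b2] := le_norm_row b j.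
  have aa := normr_ge0 a; have bb := normr_ge0 b.
  by rewrite ler_norml; apply/andP; split; lra.
rewrite (_ : cbox a b = \bigcap_(j : 'I_3) ((fun x : 'rV[R]_3 => x 0 j) @^-1` `[a 0 j, b 0 j])).
  apply: closed_bigI => j _; apply: closed_comp; last exact: interval_closed.
  by move=> x _; exact: coord_continuous3.
apply/seteqP; split=> [x ab j _ /=|x ab j]; first by rewrite in_itv /= ab.
by have := ab j I; rewrite /= in_itv.
Qed.

Definition plateau3 (a b : 'rV[R]_3) n := tensor (fun j => plateau n (a 0 j) (b 0 j)).

Lemma plateau3_test D (a b : 'rV[R]_3) n : cbox a b `<=` D -> test_fun D (plateau3 a b n).
Proof.
move=> abD; have cl : closure [set x | plateau3 a b n x != 0] `<=` cbox a b.
  have /closure_id -> : closed (cbox a b).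
    by apply: compact_closed => //; exact: compact_cbox.
  apply: closure_subset => x /= xn0 j.
  case: (boolP (a 0 j < x 0 j < b 0 j)) => [/andP[/ltW -> /ltW ->]//|xab].
  by move: xn0; rewrite /plateau3 /tensor (bigD1 j)//= plateau_out// mul0r eqxx.
split.
- by apply: tensor_smooth => j; exact: smooth1_plateau.
- have cc := @compact_cbox a b.
  by apply: subclosed_compact cc cl; exact: closed_closure.
- exact: subset_trans cl abD.
Qed.

Lemma plateau3_bound (a b : 'rV[R]_3) n x : `|plateau3 a b n x| <= 1.
Proof.
have H j : 0 <= plateau n (a 0 j) (b 0 j) (x 0 j) <= 1 by exact: plateau_itv.
rewrite ger0_norm /plateau3 /tensor.
  by apply: prodr_ile1 => j _.
by apply: prodr_ge0 => j _; have /andP[] := H j.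
Qed.

Lemma plateau3_cvg (a b : 'rV[R]_3) x :
  plateau3 a b n x @[n --> \oo] --> (\1_(box a b) x : R).
Proof.
rewrite (_ : \1_(box a b) x = \prod_j (a 0 j < x 0 j < b 0 j)%R%:R).
  rewrite prod_ord3 (_ : (fun n => _) = fun n => plateau n (a 0 (inord 0)) (b 0 (inord 0)) (x 0 (inord 0)) *
      plateau n (a 0 (inord 1)) (b 0 (inord 1)) (x 0 (inord 1)) *
      plateau n (a 0 (inord 2)) (b 0 (inord 2)) (x 0 (inord 2))); last first.
    by apply/funext => n; rewrite /plateau3 /tensor prod_ord3.
  by apply: cvgM; [apply: cvgM|]; exact: plateau_cvg.
rewrite indicE; have [xab|xab] := pselect (box a b x).
  by rewrite mem_set// big1// => j _; rewrite xab.
rewrite memNset//; have [j xj] : exists j, ~~ (a 0 j < x 0 j < b 0 j).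
  apply: contrapT => H; apply: xab => j; apply: contrapT => /negP xj; apply: H.
  by exists j.
by rewrite (bigD1 j)//= (negbTE xj) mul0r.
Qed.

End Tensor.

(** Products of generating families generate the product sigma-algebra, provided each family contains the
    whole space: a rectangle is then the intersection of two cylinders. *)
Lemma prod_sigma_generated d1 d2 (T1 : measurableType d1) (T2 : measurableType d2)
    (C1 : set (set T1)) (C2 : set (set T2)) :
  C1 setT -> C2 setT ->
  @measurable _ T1 = <<s C1 >> -> @measurable _ T2 = <<s C2 >> ->
  @measurable _ (T1 * T2)%type = <<s [set A `*` B | A in C1 & B in C2] >>.
Proof.
move=> C1T C2T m1 m2; set G := [set A `*` B | A in C1 & B in C2].
have sG : sigma_algebra setT <<s G >> by exact: smallest_sigma_algebra.
apply/seteqP; split; last first.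
  apply: smallest_sub; first exact: sigma_algebra_measurable.
  move=> _ [A C1A [B C2B <-]]; apply: measurableX.
    by rewrite m1; exact: sub_sigma_algebra.
  by rewrite m2; exact: sub_sigma_algebra.
have cyl1 A : measurable A -> <<s G >> (A `*` setT).
  rewrite m1 => mA; have : <<s C1 >> `<=` image_set_system setT (@fst T1 T2) <<s G >>.
    apply: smallest_sub; first exact: sigma_algebra_image.
    move=> B C1B; rewrite /image_set_system /= setTI.
    apply: sub_sigma_algebra; exists B => //; exists setT => //.
    by apply/seteqP; split=> -[x y] //= [].
  move=> /(_ _ mA); rewrite /image_set_system /= setTI.
  by congr (<<s G >> _); apply/seteqP; split=> -[x y] //= [].
have cyl2 B : measurable B -> <<s G >> (setT `*` B).
  rewrite m2 => mB; have : <<s C2 >> `<=` image_set_system setT (@snd T1 T2) <<s G >>.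
    apply: smallest_sub; first exact: sigma_algebra_image.
    move=> A C2A; rewrite /image_set_system /= setTI.
    apply: sub_sigma_algebra; exists setT => //; exists A => //.
    by apply/seteqP; split=> -[x y] //= [].
  move=> /(_ _ mB); rewrite /image_set_system /= setTI.
  by congr (<<s G >> _); apply/seteqP; split=> -[x y] //= [].
rewrite measurable_prod_measurableType.
apply: smallest_sub => // _ [A mA [B mB <-]].
have -> : A `*` B = (A `*` setT) `&` (setT `*` B).
  by apply/seteqP; split=> -[x y] /=; tauto.
have [_ _ _] := (sigma_algebraP (fun _ _ => @subsetT _ _)).1 sG.
by apply; [exact: cyl1|exact: cyl2].
Qed.

Definition itv_family (R : realType) : set (set (measurableTypeR R)) :=
  [set A | A = setT \/ exists a b : R, A = [set x | a < x < b]].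

Lemma itv_family_generates (R : realType) :
  @measurable _ (measurableTypeR R) = <<s @itv_family R >>.
Proof.
apply/seteqP; split.
  rewrite {1}/measurable /= RGenOpens.measurableE.
  apply: sub_sigma_algebra2 => _ [a [b ->]]; right; exists a, b.
  by apply/seteqP; split=> x /=; rewrite in_itv.
apply: smallest_sub; first exact: sigma_algebra_measurable.
move=> A [->|[a [b ->]]]; first exact: measurableT.
rewrite (_ : [set x | _] = `]a, b[%classic); first exact: measurable_itv.
by apply/seteqP; split=> x /=; rewrite in_itv.
Qed.

Lemma itv_familyI (R : realType) : setI_closed (@itv_family R).
Proof.
move=> _ _ [->|[a [b ->]]] [->|[c [d ->]]]; rewrite ?setTI ?setIT.
- by left.
- by right; exists c, d.
- by right; exists a, b.
- right; exists (Num.max a c), (Num.min b d).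
  apply/seteqP; split=> x /=; rewrite gt_max lt_min.
    by move=> [/andP[-> ->] /andP[-> ->]].
  by move=> /andP[/andP[-> ->] /andP[-> ->]].
Qed.

Definition box_family (R : realType) : set (set (triple R)) :=
  [set P `*` C | P in [set A `*` B | A in @itv_family R & B in @itv_family R] & C in @itv_family R].

Lemma box_family_generates (R : realType) :
  @measurable _ (triple R) = <<s @box_family R >>.
Proof.
apply: prod_sigma_generated.
- by exists setT; [by left|exists setT; [by left|exact: setXTT]].
- by left.
- by apply: prod_sigma_generated; [by left|by left|exact: itv_family_generates|exact: itv_family_generates].
- exact: itv_family_generates.
Qed.

Lemma box_familyI (R : realType) : setI_closed (@box_family R).
Proof.
move=> _ _ [_ [A fA [B fB <-]] [C fC <-]] [_ [A' fA' [B' fB' <-]] [C' fC' <-]].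
exists ((A `&` A') `*` (B `&` B')).
  by exists (A `&` A'); [exact: itv_familyI|exists (B `&` B'); [exact: itv_familyI|]].
exists (C `&` C'); first exact: itv_familyI.
by apply/seteqP; split=> -[[x y] z] /=; tauto.
Qed.

Section FundamentalLemma.
Variables (R : realType) (D : set 'rV[R]_3).
Hypothesis oD : open D.
Let E : set (triple R) := @of_triple R @^-1` D.
Let mE : measurable E := measurable_open3 oD.

Lemma int_on_integral0 (f : 'rV[R]_3 -> R) : int_on D f -> integral3 D f = 0 ->
  (\int[@leb3 R]_(p in E) (f (of_triple p))%:E = 0)%E.
Proof.
move=> fi f0; rewrite -[RHS]/(0%:E) -f0 /integral3 /Rintegral fineK//.
exact: integrable_fin_num.
Qed.

Lemma measurable_box (a b : 'rV[R]_3) :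
  measurable (@of_triple R @^-1` (box a b) : set (triple R)).
Proof.
apply: measurable_open3.
pose S j := (fun x : 'rV[R]_3 => x 0 j) @^-1` `]a 0 j, b 0 j[.
have oS j : open (S j).
  apply: open_comp; last exact: interval_open.
  by move=> x _; exact: coord_continuous3.
rewrite (_ : box a b = S (inord 0) `&` S (inord 1) `&` S (inord 2)).
  by apply: openI => //; exact: openI.
apply/seteqP; split=> [x ab|x [[x0 x1] x2]]; first by rewrite /S /= !in_itv /= !ab.
by rewrite /S /= !in_itv /= in x0 x1 x2; elim/ord3P.
Qed.

Variable g : 'rV[R]_3 -> R.
Hypotheses (gi : int_on D g)
  (g0 : forall phi, test_fun D phi -> integral3 D (fun x => g x * phi x) = 0).

(** The plateaus over the box are bounded test functions that converge to its indicator
    function: dominated convergence applies. *)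
Lemma integral_box_eq0 (a b : 'rV[R]_3) : cbox a b `<=` D ->
  (\int[@leb3 R]_(p in @of_triple R @^-1` (box a b)) (g (of_triple p))%:E = 0)%E.
Proof.
move=> abD; have mb := measurable_box a b.
set B : set (triple R) := _ @^-1` _ in mb *.
have BE : B `<=` E.
  by move=> p Bp; apply: abD => j; have /andP[/ltW -> /ltW ->] := Bp j.
pose f_ n (p : triple R) := (g (of_triple p) * plateau3 a b n (of_triple p))%:E.
have mf n : measurable_fun E (f_ n).
  apply/measurable_EFinP; apply: measurable_funM; first exact: int_on_meas gi.
  apply: measurable_continuous3 => //.
  by have [sm _ _] := plateau3_test n abD; have [] := sm [::].
have mgB : measurable_fun E ((fun p => (g (of_triple p))%:E) \_ B).
  apply/(measurable_restrict _ mb mE).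
  by apply: measurable_funS (measurable_int _ gi) => //; exact: subIsetl.
have f_cvg : \forall p \ae (@leb3 R), E p -> f_ n p @[n --> \oo] --> ((fun p => (g (of_triple p))%:E) \_ B) p.
  apply: aeW => p Ep; rewrite /patch /f_.
  have := @plateau3_cvg R a b (of_triple p); rewrite indicE => H.
  have -> : (if p \in B then (g (of_triple p))%:E else 0%E) =
      (g (of_triple p) * (of_triple p \in box a b)%:R)%:E.
    have -> : (p \in B) = (of_triple p \in box a b) by apply/idP/idP; rewrite !inE.
    by case: ifP => _; rewrite ?mulr1 ?mulr0.
  apply: cvg_EFin; first exact: nearW.
  by apply: cvgM => //; exact: cvg_cst.
have f_le : \forall p \ae (@leb3 R), forall n, E p -> (`|f_ n p| <= `|(g (of_triple p))%:E|)%E.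
  apply: aeW => p n Ep; rewrite /f_ /= lee_fin normrM ler_piMr//.
  exact: plateau3_bound.
have [_ _] := dominated_convergence mE mf mgB f_cvg (integrable_abse gi) f_le.
have f_0 n : (\int[@leb3 R]_(p in E) f_ n p = 0)%E.
  have tp := plateau3_test n abD.
  apply: (int_on_integral0 (f := fun x => g x * plateau3 a b n x)); last exact: g0.
  apply: (int_on_le oD _ gi).
    apply: meas_onM; first exact: int_on_meas.
    apply: measurable_continuous3 => //; case: tp => [sm _ _].
    by have [] := sm [::].
  move=> x _; rewrite normrM ler_piMr//; exact: plateau3_bound.
rewrite (_ : [sequence _]_n = fun=> 0%E); last by apply/funext => n; exact: f_0.
move=> cvg0.
have -> : 0%E = (\int[@leb3 R]_(p in E) (((fun p => (g (of_triple p))%:E) \_ B) p))%E.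
  by apply: (cvg_unique (@ereal_hausdorff R) _ cvg0); exact: cvg_cst.
by rewrite -integral_mkcondr (setIidr BE).
Qed.

(** The sets whose trace on the cube integrates [g] to zero form a Dynkin system; it contains the
    boxes, which generate the measurable sets. A function with zero integral over all measurable sets
    vanishes almost everywhere. *)
Lemma ae_eq0_cube (q : 'rV[R]_3) (r : R) : 0 < r ->
  (forall x : 'rV[R]_3, (forall i, `|q 0 i - x 0 i| <= r) -> D x) ->
  ae_on (ball q r) (fun x => g x = 0).
Proof.
move=> r0 qrD.
pose a : 'rV[R]_3 := \row_j (q 0 j - r); pose b : 'rV[R]_3 := \row_j (q 0 j + r).
have abE : ball q r = box a b.
  apply/seteqP; split=> x.
    by move/(ball_rowP _ _ r0) => qx j; have := qx j; rewrite !mxE distrC ltr_distl.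
  by move=> abx; apply/ball_rowP => // j; have := abx j; rewrite !mxE distrC ltr_distl.
have abD : cbox a b `<=` D.
  by move=> x abx; apply: qrD => j; have := abx j; rewrite !mxE distrC ler_distl.
have mb := measurable_box a b.
set B : set (triple R) := _ @^-1` _ in mb.
have BE : B `<=` E.
  by move=> p Bp; apply: abD => j; have /andP[/ltW -> /ltW ->] := Bp j.
have giB : (@leb3 R).-integrable B (fun p => (g (of_triple p))%:E).
  exact: integrableS gi.
have mg A : measurable A -> measurable_fun (A `&` B) (fun p : triple R => (g (of_triple p))%:E).
  move=> mA; apply: measurable_funS (measurable_int _ giB) => //; exact: subIsetr.
have B0 := integral_box_eq0 abD.
have AB0 A : measurable A -> (\int[@leb3 R]_(p in A `&` B) (g (of_triple p))%:E = 0)%E.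
  pose P (A : set (triple R)) := (\int[@leb3 R]_(p in A `&` B) (g (of_triple p))%:E = 0)%E.
  rewrite box_family_generates; move: A.
  apply: (@dynkin_induction _ (triple R) (@box_family R) P); rewrite /P.
  - exact: box_family_generates.
  - exact: box_familyI.
  - by rewrite setTI.
  - move=> _ [_ [A1 fA1 [A2 fA2 <-]] [A3 fA3 <-]].
    (* intersected with the cube, a generating box is a box whose closure lies in [D] *)
    have trace j (A' : set R) : itv_family A' -> exists cd : R * R, (forall t,
        (A' t /\ a 0 j < t < b 0 j) <-> (cd.1 < t < cd.2)) /\ (a 0 j <= cd.1 /\ cd.2 <= b 0 j).
      move=> [->|[c [d ->]]].
        by exists (a 0 j, b 0 j); split=> // t; split=> [[]|].
      exists (Num.max c (a 0 j), Num.min d (b 0 j)); split=> /=.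
        move=> t; rewrite gt_max lt_min.
        by split=> [[/andP[-> ->] /andP[-> ->]]|/andP[/andP[-> ->] /andP[-> ->]]].
      by rewrite le_max lexx orbT ge_min lexx orbT.
    have [[c0 d0] /= [A1E [ac0 db0]]] := trace (inord 0) _ fA1.
    have [[c1 d1] /= [A2E [ac1 db1]]] := trace (inord 1) _ fA2.
    have [[c2 d2] /= [A3E [ac2 db2]]] := trace (inord 2) _ fA3.
    have [cE0 cE1 cE2] := row3E c0 c1 c2; have [dE0 dE1 dE2] := row3E d0 d1 d2.
    rewrite (_ : _ `&` B = @of_triple R @^-1` (box (row3 c0 c1 c2) (row3 d0 d1 d2))).
      apply: integral_box_eq0 => x xcd; apply: abD => j.
      have /andP[] := xcd j; move: j; elim/ord3P; rewrite ?cE0 ?cE1 ?cE2 ?dE0 ?dE1 ?dE2 => cx xd;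
        by apply/andP; split; [apply: le_trans cx|apply: le_trans xd _].
    apply/seteqP; split=> -[[x y] z] /=.
      have [xE yE zE] := row3E x y z.
      move=> [[[A1x A2y] A3z] Bp]; rewrite /B /of_triple /= in Bp *; elim/ord3P.
      - by rewrite xE cE0 dE0; apply/A1E; split=> //; rewrite -xE; exact: Bp.
      - by rewrite yE cE1 dE1; apply/A2E; split=> //; rewrite -yE; exact: Bp.
      - by rewrite zE cE2 dE2; apply/A3E; split=> //; rewrite -zE; exact: Bp.
    have [xE yE zE] := row3E x y z; rewrite /B /of_triple /= => H.
    have := H (inord 0); rewrite xE cE0 dE0 => /A1E[A1x ax].
    have := H (inord 1); rewrite yE cE1 dE1 => /A2E[A2y ay].
    have := H (inord 2); rewrite zE cE2 dE2 => /A3E[A3z az].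
    by split=> //; elim/ord3P; rewrite ?xE ?yE ?zE.
  - move=> A' mA' A'0.
    have := @integral_setU _ _ _ (@leb3 R) (A' `&` B) (~` A' `&` B) (fun p => (g (of_triple p))%:E).
    rewrite -setIUl setUCr setTI B0 A'0 add0e => <- //.
    + exact: measurableI.
    + by apply: measurableI => //; exact: measurableC.
    + by have := mg setT measurableT; rewrite setTI.
    + by rewrite disj_set2E setIACA setICr set0I.
  - move=> F mF tF F0; rewrite setI_bigcupl integral_bigcup//.
    + by apply: eseries0 => k _ _; exact: F0.
    + by apply: trivIset_setIr.
    + by move=> k; exact: measurableI.
    + apply: integrableS giB => //; first by apply: bigcup_measurable => k _; exact: measurableI.
      by move=> p [k _ []].
have H := @integral_ae_eq _ _ _ (@leb3 R) B mb (cst 0%E) _ giB (measurable_cst _).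
rewrite abE; apply: filterS (H _) => [p Hp Bp|A AB mA].
  by have [] := Hp Bp.
by rewrite integral_cst// mul0e -(setIidl AB); exact: AB0.
Qed.

(** Countably many cubes on which [g] vanishes almost everywhere cover the open set [D]. *)
Lemma test_fun_ae_eq0 : ae_on D (fun x => g x = 0).
Proof.
have [P [q [r [r0 rD Dr]]]] := open_cubes oD.
have H n : ae_on D (fun x => P n -> ball (q n) (r n) x -> g x = 0).
  have [Pn|Pn] := pselect (P n); last exact: ae_on_all.
  have := ae_eq0_cube (r0 n Pn) (rD n Pn).
  by rewrite /ae_on; apply: filterS => p Hp Dp _; exact: Hp.
have : (@leb3 R).-negligible (\bigcup_n (~` [set p | D (of_triple p) -> P n ->
    ball (q n) (r n) (of_triple p) -> g (of_triple p) = 0])).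
  by apply: negligible_bigcup => n; exact: H.
apply: negligibleS => p /= /not_implyP[Dp gp].
have [n Pn qn] := Dr _ Dp; exists n => //= K; apply: gp; exact: K.
Qed.

End FundamentalLemma.

(** * Mixed partial derivatives and integrals of derivatives *)

Section SecondDifference.
Variable R : realType.
Implicit Types (F : 'rV[R]_3 -> R) (x u v : 'rV[R]_3).

Lemma line_MVT F F' x u (h : R) : 0 < h ->
  (forall y, is_derive y u F (F' y)) ->
  exists2 s : R, 0 < s < h & F (h *: u + x) - F x = F' (s *: u + x) * h.
Proof.
move=> h0 dF.
have dl (s : R) : is_derive s 1 (fun s => F (s *: u + x)) (F' (s *: u + x)).
  by apply/is_derive_line; exact: dF.
have cl : {within `[0, h], continuous (fun s : R => F (s *: u + x))}.
  by apply: derivable_within_continuous => s _; have [] := dl s.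
have [s sh] := MVT h0 (fun s _ => dl s) cl.
rewrite scale0r add0r subr0 => E; by exists s.
Qed.

(** The mean value theorem is applied first to the difference of [F] along [v], in direction [u],
    and then to [Fu] in direction [v]. *)
Lemma second_difference F Fu Fuv x u v (h k : R) : 0 < h -> 0 < k ->
  (forall y, is_derive y u F (Fu y)) -> (forall y, is_derive y v Fu (Fuv y)) ->
  exists s t, [/\ 0 < s < h, 0 < t < k &
    F (h *: u + (k *: v + x)) - F (h *: u + x) - F (k *: v + x) + F x =
      Fuv (t *: v + (s *: u + x)) * (h * k)].
Proof.
move=> h0 k0 dF dFu.
have dG y : is_derive y u (fun z => F (k *: v + z) - F z) (Fu (k *: v + y) - Fu y).
  have dk : is_derive y u (fun z => F (k *: v + z)) (Fu (k *: v + y)).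
    have /is_derive_line0 := dF (k *: v + y) => dl; apply/is_derive_line0.
    by move/is_derive_ext : dl; apply => // s; rewrite addrCA.
  exact: is_deriveB.
have [s sh sE] := line_MVT x h0 dG.
have [t tk tE] := line_MVT (s *: u + x) k0 dFu.
exists s, t; split=> //.
rewrite (mulrC h) mulrA -tE -sE (addrCA (k *: v)); ring.
Qed.

(** Clairaut's theorem: both mixed derivatives are limits of the same symmetric second difference. *)
Lemma mixed_partials F Fu Fv Fuv Fvu x u v :
  (forall y, is_derive y u F (Fu y)) -> (forall y, is_derive y v F (Fv y)) ->
  (forall y, is_derive y v Fu (Fuv y)) -> (forall y, is_derive y u Fv (Fvu y)) ->
  {for x, continuous Fuv} -> {for x, continuous Fvu} -> Fuv x = Fvu x.
Proof.
move=> dFu dFv dFuv dFvu cuv cvu.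
apply/eqP; rewrite -subr_eq0 -normr_le0; apply/ler_addgt0Pl => e e0; rewrite addr0.
have e2 : 0 < e / 2 by rewrite divr_gt0.
have Huv : \forall y \near x, `|Fuv x - Fuv y| < e / 2 by move/cvgrPdist_lt : cuv; exact.
have Hvu : \forall y \near x, `|Fvu x - Fvu y| < e / 2 by move/cvgrPdist_lt : cvu; exact.
have [d /= d0 dP] : exists2 d : R, 0 < d & forall y, `|x - y| < d ->
    `|Fuv x - Fuv y| < e / 2 /\ `|Fvu x - Fvu y| < e / 2.
  have Hx : \forall y \near x, `|Fuv x - Fuv y| < e / 2 /\ `|Fvu x - Fvu y| < e / 2.
    exact: filterI Huv Hvu.
  move/nbhs_ballP : Hx => [d /= d0 dP].
  by exists d => // y xy; apply: (dP y); rewrite -ball_normE.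
pose c := `|u| + `|v| + 1.
have c0 : 0 < c by rewrite ltr_wpDl// addr_ge0.
have h0 : 0 < d / c by rewrite divr_gt0.
have near_x (s t : R) w w' : 0 < s < d / c -> 0 < t < d / c -> `|w| + `|w'| < c ->
    `|x - (t *: w + (s *: w' + x))| < d.
  move=> /andP[s0 sd] /andP[t0 td] wc.
  rewrite addrA opprD addrCA subrr addr0 normrN (le_lt_trans (ler_normD _ _))//.
  rewrite !normrZ (gtr0_norm s0) (gtr0_norm t0).
  apply: (@le_lt_trans _ _ (d / c * (`|w| + `|w'|))).
    by rewrite mulrDr lerD// ler_wpM2r// ltW.
  by rewrite mulrAC ltr_pdivrMr// ltr_pM2l.
have [s [t [sh th E1]]] := second_difference x h0 h0 dFu dFuv.
have [s' [t' [s'h t'h E2]]] := second_difference x h0 h0 dFv dFvu.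
have E : Fuv (t *: v + (s *: u + x)) = Fvu (t' *: u + (s' *: v + x)).
  apply: (@mulIf _ (d / c * (d / c))); first by rewrite mulf_neq0// gt_eqF.
  by rewrite -E1 -E2 (addrCA (d / c *: u)); ring.
have uv : `|u| + `|v| < c by rewrite /c ltrDl.
have vu : `|v| + `|u| < c by rewrite addrC.
have [H1 _] := dP _ (near_x _ _ v u sh th vu).
have [_ H2] := dP _ (near_x _ _ u v s'h t'h uv).
rewrite (_ : Fuv x - Fvu x = (Fuv x - Fuv (t *: v + (s *: u + x))) -
    (Fvu x - Fvu (t' *: u + (s' *: v + x)))); last by rewrite E; ring.
by rewrite (le_trans (ler_normB _ _))// (splitr e) lerD// ltW.
Qed.

End SecondDifference.

Section CompactSupport.
Variable R : realType.

Lemma integral_derive_eq0 (h h' : R -> R) (r : R) :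
  (forall t : R, is_derive t 1 h (h' t)) -> continuous h' ->
  (forall t, r <= `|t| -> h t = 0 /\ h' t = 0) ->
  (\int[@lebesgue_measure R]_t (h' t)%:E = 0)%E.
Proof.
move=> dh ch' hr; pose s := `|r| + 1.
have s0 : 0 < s by rewrite ltr_wpDl.
have rs : r <= s by rewrite (le_trans (ler_norm _))// lerDl.
have hs t : s <= `|t| -> h t = 0 /\ h' t = 0.
  by move=> st; apply: hr; exact: le_trans st.
have ss : - s < s by rewrite gtrN.
have ch : continuous h.
  move=> t; apply: differentiable_continuous; apply/derivable1_diffP.
  by have [] := dh t.
have := @continuous_FTC2 R h' h (- s) s ss (continuous_subspaceT ch').
have -> : h s = 0 by apply: (hs s _).1; rewrite ger0_norm// ltW.
have -> : h (- s) = 0 by apply: (hs (- s) _).1; rewrite normrN ger0_norm// ltW.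
rewrite subee// => H; rewrite -H.
- rewrite [RHS]integral_mkcond; apply: eq_integral => t _; rewrite /patch.
  case: ifPn => //; rewrite notin_setE /= in_itv /= => /negP; rewrite -ler_norml -ltNge.
  by move=> /ltW st; have [_ ->] := hs t st.
- split; first by move=> t _; have [] := dh t.
    exact: cvg_at_right_filter (ch _).
  exact: cvg_at_left_filter (ch _).
- by move=> t _; rewrite derive1E; have [] := dh t.
Qed.

Lemma integrable_bounded_support d (T : measurableType d) (mu : {measure set T -> \bar R})
    (B : set T) (f : T -> R) (c : R) :
  measurable B -> (mu B < +oo)%E -> measurable_fun setT f ->
  (forall x, `|f x| <= c) -> (forall x, ~ B x -> f x = 0) ->
  mu.-integrable setT (EFin \o f).
Proof.
move=> mB Boo mf fc fB.
have -> : EFin \o f = (EFin \o f) \_ B.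
  apply/funext => x; rewrite /patch; case: ifPn => //.
  by rewrite notin_setE => /fB /= ->.
apply: (integrable_mkcond _ mB).1; apply/integrableP; split.
  by apply/measurable_EFinP; apply: measurable_funS mf.
apply: (@le_lt_trans _ _ (\int[mu]_(x in B) (cst `|c|%:E x))%E).
  apply: ge0_le_integral => //.
  - by apply: measurableT_comp => //; apply/measurable_EFinP; apply: measurable_funS mf.
  - by move=> x _; rewrite /= lee_fin (le_trans (fc x))// ler_norm.
by rewrite integral_cst// lte_mul_pinfty.
Qed.

Let L := @lebesgue_measure R.
(** By Fubini, integration along the direction of differentiation can come first; on each line the
    fundamental theorem of calculus gives zero. *)
Lemma integral_partial_eq0 (psi psi' : 'rV[R]_3 -> R) (k : 'I_3) (r : R) :
  continuous psi' -> (forall x, is_derive x (unit3 k) psi (psi' x)) ->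
  (forall (x : 'rV[R]_3) j, r <= `|x 0 j| -> psi x = 0 /\ psi' x = 0) ->
  integral3 setT psi' = 0.
Proof.
move=> cpsi' dpsi psi0.
pose I : set (measurableTypeR R) := `[- r, r]%classic.
have mI : measurable I by exact: measurable_itv.
have Ioo : (L I < +oo)%E by rewrite /L lebesgue_measure_itv /=; case: ifP => _; rewrite ?ltry.
have out t : ~ I t -> r <= `|t|.
  by rewrite /I /= in_itv /= -ler_norml => /negP; rewrite -ltNge => /ltW.
have [c psi'c] : exists c : R, forall x, `|psi' x| <= c.
  pose K := cbox (const_mx (- r)) (const_mx r : 'rV[R]_3).
  have /compact_bounded[M [Mr KM]] : compact [set psi' x | x in K].
    apply: continuous_compact; last exact: compact_cbox.
    exact: continuous_subspaceT.
  exists (Num.max (M + 1) 0) => x; have [Kx|Kx] := pselect (K x).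
    by rewrite le_max (KM (M + 1))// ?ltrDl//; exists x.
  have [j xj] : exists j, r <= `|x 0 j|.
    apply: contrapT => H; apply: Kx => j; rewrite !mxE -ler_norml leNgt.
    by apply/negP => rx; apply: H; exists j; exact: ltW.
  by have [_ ->] := psi0 x j xj; rewrite normr0 le_max lexx orbT.
have mf : measurable_fun setT (psi' \o @of_triple R).
  exact: measurable_continuous3.
have m12 z : measurable_fun setT (fun p : (measurableTypeR R * measurableTypeR R)%type => (psi' \o @of_triple R) (p, z)).
  by apply: measurableT_comp => //; exact: measurable_pair2.
have support p j : r <= `|(of_triple p : 'rV[R]_3) 0 j| -> psi' (of_triple p) = 0.
  by move=> H; have [] := psi0 _ j H.
have IIoo : (@leb2 R (I `*` I) < +oo)%E.
  by rewrite /leb2 product_measure1E// lte_mul_pinfty// ge0_fin_numE.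
have int3 : (@leb2 R \x L)%E.-integrable setT (EFin \o (psi' \o @of_triple R)).
  apply: (@integrable_bounded_support _ _ _ ((I `*` I) `*` I) _ c) => //.
  - by apply: measurableX => //; exact: measurableX.
  - rewrite /= product_measure1E//; last exact: measurableX.
    by rewrite lte_mul_pinfty// ge0_fin_numE.
  - by move=> p; exact: psi'c.
  - move=> -[[x y] z] /= H; have [xE yE zE] := row3E x y z.
    have [Ix|Ix] := pselect (I x); last first.
      by apply: (support _ (inord 0)); rewrite /of_triple xE; exact: out.
    have [Iy|Iy] := pselect (I y); last first.
      by apply: (support _ (inord 1)); rewrite /of_triple yE; exact: out.
    have [Iz|Iz] := pselect (I z); first by exfalso; exact: H.
    by apply: (support _ (inord 2)); rewrite /of_triple zE; exact: out.
have int2 z : (@leb2 R).-integrable setT (fun p => (psi' (of_triple (p, z)))%:E).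
  apply: (@integrable_bounded_support _ _ _ (I `*` I) (fun p => psi' (of_triple (p, z))) c) => //.
  - exact: measurableX.
  - exact: m12.
  - move=> -[x y] /= H; have [xE yE zE] := row3E x y z.
    have [Ix|Ix] := pselect (I x); last first.
      by apply: (support _ (inord 0)); rewrite /of_triple xE; exact: out.
    have [Iy|Iy] := pselect (I y); first by exfalso; exact: H.
    by apply: (support _ (inord 1)); rewrite /of_triple yE; exact: out.
have line x : (\int[L]_t (psi' (t *: unit3 k + x))%:E = 0)%E.
  apply: (@integral_derive_eq0 (fun t => psi (t *: unit3 k + x)) _ (r + `|x 0 k|)).
  - by move=> t; apply/is_derive_line; exact: dpsi.
  - move=> t; apply: continuous_comp; last exact: cpsi'.
    by apply: continuousD; [exact: scalel_continuous|exact: cst_continuous].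
  - move=> t rt; apply: (psi0 _ k); rewrite !mxE !eqxx mulr1.
    rewrite -(lerD2r `|x 0 k|) (le_trans rt)//.
    by rewrite -[X in `|X|](addrK (x 0 k)) (le_trans (ler_normB _ _)).
suff H : (\int[@leb3 R]_p (psi' (of_triple p))%:E = 0)%E.
  by rewrite /integral3 preimage_setT /Rintegral H.
have lineE (a b t : R) : [/\ t *: unit3 (inord 0) + row3 0 a b = row3 t a b,
    t *: unit3 (inord 1) + row3 a 0 b = row3 a t b &
    t *: unit3 (inord 2) + row3 a b 0 = row3 a b t :> 'rV[R]_3].
  by split; apply/rowP; elim/ord3P; rewrite !mxE !inordK//= -!val_eqE /= !inordK//=; ring.
rewrite (_ : @leb3 R = (@leb2 R \x L)%E)//.
move: (k) line; elim/ord3P => line.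
- rewrite -(integral21_prod_meas1 int3); apply: integral0_eq => z _.
  rewrite /fubini_G /leb2 -(integral21_prod_meas1 (int2 z)).
  apply: integral0_eq => y _; rewrite /fubini_G -[RHS](line (row3 0 y z)).
  by apply: eq_integral => x _; have [-> _ _] := lineE y z x.
- rewrite -(integral21_prod_meas1 int3); apply: integral0_eq => z _.
  rewrite /fubini_G /leb2 -(integral12_prod_meas1 (int2 z)).
  apply: integral0_eq => x _; rewrite /fubini_F -[RHS](line (row3 x 0 z)).
  by apply: eq_integral => y _; have [_ -> _] := lineE x z y.
- rewrite -(integral12_prod_meas1 int3); apply: integral0_eq => -[x y] _.
  rewrite /fubini_F -[RHS](line (row3 x y 0)).
  by apply: eq_integral => z _; have [_ _ ->] := lineE x y z.
Qed.

End CompactSupport.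

(** * Smooth fields and pairings *)

Section SmoothFunctions.
Variable R : realType.
Implicit Types (f phi : 'rV[R]_3 -> R) (F : 'rV[R]_3 -> 'rV[R]_3) (D : set 'rV[R]_3).

Lemma smooth_partial f i : smooth f -> smooth (partial i f).
Proof. by move=> sf s; have := sf (rcons s i); rewrite /partials foldr_rcons. Qed.

Lemma smooth_continuous f : smooth f -> continuous f.
Proof. by move=> sf; have [] := sf [::]. Qed.

Lemma smooth_is_derive f i x : smooth f -> is_derive x (unit3 i) f (partial i f x).
Proof. by move=> sf; have [_ df] := sf [::]; exact: derivableP. Qed.

Lemma partial_cst (c : R) i : partial i (fun=> c) = fun=> 0.
Proof. by apply/funext => x; rewrite /partial derive_cst. Qed.

Lemma smooth_cst0 : smooth (fun=> 0 : R).
Proof.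
move=> s; suff -> : partials s (fun=> 0 : R) = fun=> 0.
  by split=> [|i x]; [exact: cst_continuous|exact: derivable_cst].
by elim: s => //= i s ->; exact: partial_cst.
Qed.

Lemma test_fun0 D : test_fun D (fun=> 0 : R).
Proof.
have E : [set x : 'rV[R]_3 | (fun=> 0 : R) x != 0] = set0.
  by apply/seteqP; split=> x //=; rewrite eqxx.
rewrite /test_fun E closure0.
by split; [exact: smooth_cst0|exact: compact0|exact: sub0set].
Qed.

Lemma near_zero_derive f (x v : 'rV[R]_3) :
  (\forall y \near x, f y = 0) -> 'D_v f x = 0.
Proof.
move=> f0; rewrite (@near_eq_derive _ _ _ f (cst 0))//; exact: derive_cst.
Qed.

Lemma partial_support f i :
  closure [set x | partial i f x != 0] `<=` closure [set x | f x != 0].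
Proof.
have cl : closed (closure [set x | f x != 0]) by exact: closed_closure.
rewrite [X in _ `<=` X](closure_id _).1//; apply: closure_subset => x /= fx.
apply: contrapT => xf; move/negP: fx; apply.
apply/eqP; apply: near_zero_derive.
have : nbhs x (~` closure [set x | f x != 0]).
  by apply: open_nbhs_nbhs; split=> //; exact: closed_openC.
apply: filterS => y yf; apply/eqP; apply: contrapT => /negP fy.
by apply: yf; exact: subset_closure.
Qed.

Lemma test_partial D phi i : test_fun D phi -> test_fun D (partial i phi).
Proof.
move=> [sphi cphi phiD]; have sub := @partial_support phi i.
split; first exact: smooth_partial.
- have clo : closed (closure [set x | partial i phi x != 0]) by exact: closed_closure.
  exact: subclosed_compact clo cphi sub.
- exact: subset_trans sub phiD.
Qed.

Lemma test_continuous D phi : test_fun D phi -> continuous phi.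
Proof. by move=> [s _ _]; exact: smooth_continuous. Qed.

Lemma test_funS D D' phi : D `<=` D' -> test_fun D phi -> test_fun D' phi.
Proof. by move=> DD' [s c sub]; split=> //; exact: subset_trans DD'. Qed.

Lemma test_off D phi x : test_fun D phi -> ~ D x -> phi x = 0.
Proof.
move=> [_ _ sub] Dx; apply/eqP; apply: contrapT => /negP phix; apply: Dx.
by apply: sub; exact: subset_closure.
Qed.

(** Fields with one nonzero component reduce statements about fields to statements about functions. *)
Definition single (k : 'I_3) phi : 'rV[R]_3 -> 'rV[R]_3 := fun x => phi x *: unit3 k.

Lemma comp_single k phi j : comp (single k phi) j = if j == k then phi else fun=> 0.
Proof.
apply/funext => x; rewrite /comp /single !mxE eqxx /=.
by case: ifP; rewrite ?mulr1 ?mulr0.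
Qed.

Lemma vtest_single D k phi : test_fun D phi -> vtest_fun D (single k phi).
Proof. by move=> tphi j; rewrite comp_single; case: ifP => // _; exact: test_fun0. Qed.

Lemma cdiv_single k phi : cdiv (single k phi) = partial k phi.
Proof.
apply/funext => x; rewrite /cdiv (bigD1 k)//= comp_single eqxx big1 ?addr0// => j jk.
by rewrite comp_single (negbTE jk) partial_cst.
Qed.

Lemma vsmooth_cgrad phi : smooth phi -> vsmooth (cgrad phi).
Proof.
move=> tphi i; rewrite (_ : comp _ i = partial i phi); first exact: smooth_partial.
by apply/funext => x; rewrite /comp mxE.
Qed.

Lemma partialC phi i j : smooth phi -> partial i (partial j phi) = partial j (partial i phi).
Proof.
move=> sphi; apply/funext => x.
apply: (@mixed_partials R phi (partial j phi) (partial i phi) _ _ x (unit3 j) (unit3 i)).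
- by move=> y; exact: smooth_is_derive.
- by move=> y; exact: smooth_is_derive.
- by move=> y; apply: smooth_is_derive; exact: smooth_partial.
- by move=> y; apply: smooth_is_derive; exact: smooth_partial.
- by apply: smooth_continuous; do 2 apply: smooth_partial.
- by apply: smooth_continuous; do 2 apply: smooth_partial.
Qed.

Lemma ccurl_cgrad phi : smooth phi -> ccurl (cgrad phi) = fun=> 0.
Proof.
move=> sphi; apply/funext => x; rewrite /ccurl.
have E j : comp (cgrad phi) j = partial j phi.
  by apply/funext => y; rewrite /comp mxE.
have P i j : partial i (partial j phi) x - partial j (partial i phi) x = 0.
  by rewrite partialC// subrr.
rewrite !E; transitivity (row3 (0 : R) 0 0).
  congr row3; [exact: (P (inord 1) (inord 2))|exact: (P (inord 2) (inord 0))|].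
  exact: (P (inord 0) (inord 1)).
have [e0 e1 e2] := row3E (0 : R) 0 0.
by apply/rowP; elim/ord3P; rewrite ?e0 ?e1 ?e2 mxE.
Qed.

Lemma cdiv_continuous F : vsmooth F -> continuous (cdiv F).
Proof.
move=> sF x.
have -> : cdiv F = fun x => partial (inord 0) (comp F (inord 0)) x +
    partial (inord 1) (comp F (inord 1)) x + partial (inord 2) (comp F (inord 2)) x.
  by apply/funext => y; rewrite /cdiv sum_ord3.
have H i : {for x, continuous (partial i (comp F i))}.
  by apply: smooth_continuous; apply: smooth_partial; exact: sF.
exact: (continuousD (continuousD (H _) (H _)) (H _)).
Qed.

Lemma ccurl_continuous F i : vsmooth F -> continuous (comp (ccurl F) i).
Proof.
move=> sF; have H j k : continuous (partial j (comp F k)).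
  by apply: smooth_continuous; apply: smooth_partial; exact: sF.
have HB j k l m : continuous (fun x => partial j (comp F k) x - partial l (comp F m) x).
  by move=> x; apply: continuousB; exact: H.
have E x := row3E (partial (inord 1) (comp F (inord 2)) x - partial (inord 2) (comp F (inord 1)) x)
  (partial (inord 2) (comp F (inord 0)) x - partial (inord 0) (comp F (inord 2)) x)
  (partial (inord 0) (comp F (inord 1)) x - partial (inord 1) (comp F (inord 0)) x).
move: i; elim/ord3P.
- rewrite (_ : comp _ _ = fun x => partial (inord 1) (comp F (inord 2)) x - partial (inord 2) (comp F (inord 1)) x) //.
  by apply/funext => x; rewrite /comp /ccurl; have [] := E x.
- rewrite (_ : comp _ _ = fun x => partial (inord 2) (comp F (inord 0)) x - partial (inord 0) (comp F (inord 2)) x) //.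
  by apply/funext => x; rewrite /comp /ccurl; have [] := E x.
- rewrite (_ : comp _ _ = fun x => partial (inord 0) (comp F (inord 1)) x - partial (inord 1) (comp F (inord 0)) x) //.
  by apply/funext => x; rewrite /comp /ccurl; have [] := E x.
Qed.

Lemma vtest_smooth D F : vtest_fun D F -> vsmooth F.
Proof. by move=> tF i; have [] := tF i. Qed.

End SmoothFunctions.

Section VectorFields.
Variables (R : realType) (D : set 'rV[R]_3).
Hypotheses (oD : open D) (bD : bounded_set D).
Implicit Types (f g phi : 'rV[R]_3 -> R) (u v w F : 'rV[R]_3 -> 'rV[R]_3).

Lemma comp_lin (a : R) u v i :
  comp (fun x => a *: u x + v x) i = fun x => a * comp u i x + comp v i x.
Proof. by apply/funext => x; rewrite /comp !mxE. Qed.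

Lemma vL2_lin (a : R) u v : vL2 D u -> vL2 D v -> vL2 D (fun x => a *: u x + v x).
Proof. by move=> u2 v2 i; rewrite comp_lin; exact: L2_lin. Qed.

Lemma vL2_0 : vL2 D (fun=> 0).
Proof.
move=> i; rewrite (_ : comp _ _ = fun=> 0); first exact: L2_cst.
by apply/funext => x; rewrite /comp mxE.
Qed.

Lemma vL2_vsmooth F : vsmooth F -> vL2 D F.
Proof. by move=> sF i; apply: L2_continuous => //; exact: smooth_continuous. Qed.

Lemma integral3_sum n (G : 'I_n -> 'rV[R]_3 -> R) : (forall i, int_on D (G i)) ->
  integral3 D (fun x => \sum_(i < n) G i x) = \sum_(i < n) integral3 D (G i).
Proof.
move=> iG; suff H (s : seq 'I_n) : int_on D (fun x => \sum_(i <- s) G i x) /\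
    integral3 D (fun x => \sum_(i <- s) G i x) = \sum_(i <- s) integral3 D (G i).
  by have [] := H (index_enum 'I_n).
have i0 : int_on D (fun=> 0) by apply: L2_int => //; exact: L2_cst.
elim: s => [|i s [ihi ihE]].
  rewrite big_nil (_ : (fun x => _) = fun=> 0); last by apply/funext => x; rewrite big_nil.
  split=> //; transitivity (integral3 D (fun=> 0 * 0 : R)); last by rewrite (integral3Z oD)// mul0r.
  by congr integral3; apply/funext => x; rewrite mulr0.
rewrite big_cons (_ : (fun x => _) = fun x => G i x + \sum_(i <- s) G i x); last first.
  by apply/funext => x; rewrite big_cons.
by split; [exact: int_onD|rewrite (integral3D oD)// ihE].
Qed.

Lemma vipE u v : vL2 D u -> vL2 D v -> vip D u v = \sum_i ip D (comp u i) (comp v i).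
Proof.
move=> u2 v2; rewrite /vip /dot.
by rewrite (@integral3_sum _ (fun i x => u x 0 i * v x 0 i))// => i;
  exact: (L2_mul oD (u2 i) (v2 i)).
Qed.

Lemma vipC u v : vip D u v = vip D v u.
Proof.
by apply: integral3_eq => x _; apply: eq_bigr => i _; rewrite mulrC.
Qed.

Lemma vip_linl (a : R) u v w : vL2 D u -> vL2 D v -> vL2 D w ->
  vip D (fun x => a *: u x + v x) w = a * vip D u w + vip D v w.
Proof.
move=> u2 v2 w2; rewrite !vipE//; last exact: vL2_lin.
rewrite mulr_sumr -big_split; apply: eq_bigr => i _ /=.
by rewrite comp_lin ip_linl.
Qed.

Lemma vip_ael u u' v : vL2 D u -> vL2 D u' -> vL2 D v ->
  ae_on D (fun x => u x = u' x) -> vip D u v = vip D u' v.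
Proof.
move=> u2 u'2 v2 uu'; rewrite !vipE//; apply: eq_bigr => i _.
by apply: ip_ael => //; apply: ae_on_mono uu' => x _; rewrite /comp => ->.
Qed.

Lemma vip0l v : vip D (fun=> 0) v = 0.
Proof.
have i0 : int_on D (fun=> 0) by apply: L2_int => //; exact: L2_cst.
transitivity (integral3 D (fun=> 0 * 0 : R)); last by rewrite (integral3Z oD)// mul0r.
apply: integral3_eq => x _.
by rewrite /dot big1 ?mulr0// => i _; rewrite mxE mul0r.
Qed.

Lemma ip0l f : ip D (fun=> 0) f = 0.
Proof.
have i0 : int_on D (fun=> 0) by apply: L2_int => //; exact: L2_cst.
transitivity (integral3 D (fun=> 0 * 0 : R)); last by rewrite (integral3Z oD)// mul0r.
by apply: integral3_eq => x _; rewrite mul0r mulr0.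
Qed.

Lemma vip_single u k phi : vip D u (single k phi) = ip D (comp u k) phi.
Proof.
apply: integral3_eq => x _; rewrite /dot (bigD1 k)//= big1 => [|j jk].
  by rewrite addr0 /single !mxE !eqxx mulr1.
by rewrite /single !mxE (negbTE jk) andbF mulr0 mulr0.
Qed.

Lemma ip_test_ae_eq f g : L2 D f -> L2 D g ->
  (forall phi, test_fun D phi -> ip D f phi = ip D g phi) ->
  ae_on D (fun x => f x = g x).
Proof.
move=> f2 g2 fg; have h2 : L2 D (fun x => -1 * g x + f x) by exact: L2_lin.
have : ae_on D (fun x => -1 * g x + f x = 0).
  apply: test_fun_ae_eq0 => //; first exact: L2_int.
  move=> phi tphi; rewrite -[LHS]/(ip D (fun x => -1 * g x + f x) phi).
  have phi2 : L2 D phi by apply: L2_continuous => //; exact: test_continuous tphi.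
  by rewrite ip_linl// fg// mulN1r addNr.
by apply: ae_on_mono => x _ /eqP; rewrite mulN1r addrC subr_eq0 => /eqP.
Qed.

Lemma ae_on_row (u v : 'rV[R]_3 -> 'rV[R]_3) :
  (forall i, ae_on D (fun x => comp u i x = comp v i x)) -> ae_on D (fun x => u x = v x).
Proof.
by move=> /ae_on_ord; apply: ae_on_mono => x _ uv; apply/rowP; exact: uv.
Qed.

Lemma vip_test_ae_eq u v : vL2 D u -> vL2 D v ->
  (forall F, vtest_fun D F -> vip D u F = vip D v F) ->
  ae_on D (fun x => u x = v x).
Proof.
move=> u2 v2 uv; apply: ae_on_row => i; apply: ip_test_ae_eq => // phi tphi.
by rewrite -!vip_single; apply: uv; exact: vtest_single.
Qed.

Lemma vip_eq0 u : vL2 D u -> vip D u u = 0 -> vnull D u.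
Proof.
move=> u2; rewrite vipE// => /eqP; rewrite psumr_eq0 => [/allP u0|i _]; last exact: ip_ge0.
have := @ae_on_row u (fun=> 0); apply=> i.
have /eqP := u0 i (mem_index_enum _); move/(ip_eq0 oD (u2 i)).
by apply: ae_on_mono => x _; rewrite /comp mxE.
Qed.

Lemma vip_ge0 u : vL2 D u -> 0 <= vip D u u.
Proof. by move=> u2; rewrite vipE//; apply: sumr_ge0 => i _; exact: ip_ge0. Qed.

End VectorFields.

(** * Weak derivatives and traces *)

Section WeakDerivatives.
Variables (R : realType) (D : set 'rV[R]_3).
Hypotheses (oD : open D) (bD : bounded_set D).
Implicit Types (f g phi : 'rV[R]_3 -> R) (u v w F : 'rV[R]_3 -> 'rV[R]_3) (a : R).

Let L2s phi : smooth phi -> L2 D phi.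
Proof. by move=> sphi; apply: L2_continuous => //; exact: smooth_continuous. Qed.

Let L2cdiv F : vsmooth F -> L2 D (cdiv F).
Proof. by move=> sF; apply: L2_continuous => //; exact: cdiv_continuous. Qed.

Let L2ccurl F : vsmooth F -> vL2 D (ccurl F).
Proof. by move=> sF i; apply: L2_continuous => //; exact: ccurl_continuous. Qed.

Let L2cgrad phi : smooth phi -> vL2 D (cgrad phi).
Proof. by move=> sphi; exact: vL2_vsmooth oD bD _ (vsmooth_cgrad sphi). Qed.

Let tL2 phi : test_fun D phi -> L2 D phi.
Proof. by case=> sphi _ _; exact: L2s. Qed.

Let vtL2 F : vtest_fun D F -> vL2 D F.
Proof. by move=> tF; apply: vL2_vsmooth => //; exact: vtest_smooth tF. Qed.

Lemma is_wgrad_lin a f g w w' : L2 D f -> L2 D g ->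
  is_wgrad D f w -> is_wgrad D g w' ->
  is_wgrad D (fun x => a * f x + g x) (fun x => a *: w x + w' x).
Proof.
move=> f2 g2 [w2 fw] [w'2 gw']; split; first exact: vL2_lin.
move=> F tF; have F2 := vtL2 tF; have dF2 := L2cdiv (vtest_smooth tF).
by rewrite ip_linl// vip_linl// fw// gw'//; ring.
Qed.

Lemma is_wdiv_lin a v v' g g' : vL2 D v -> vL2 D v' ->
  is_wdiv D v g -> is_wdiv D v' g' ->
  is_wdiv D (fun x => a *: v x + v' x) (fun x => a * g x + g' x).
Proof.
move=> v2 v'2 [g2 vg] [g'2 v'g']; split; first exact: L2_lin.
move=> phi tphi; have phi2 := tL2 tphi; have dphi2 := L2cgrad (let: And3 s _ _ := tphi in s).
by rewrite ip_linl// vip_linl// vg// v'g'//; ring.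
Qed.

Lemma is_wcurl_lin a v v' w w' : vL2 D v -> vL2 D v' ->
  is_wcurl D v w -> is_wcurl D v' w' ->
  is_wcurl D (fun x => a *: v x + v' x) (fun x => a *: w x + w' x).
Proof.
move=> v2 v'2 [w2 vw] [w'2 v'w']; split; first exact: vL2_lin.
move=> F tF; have F2 := vtL2 tF; have dF2 := L2ccurl (vtest_smooth tF).
by rewrite !vip_linl// vw// v'w'.
Qed.

Lemma null_wgrad f : L2 D f -> null D f -> is_wgrad D f (fun=> 0).
Proof.
move=> f2 f0; split=> [|F tF]; first exact: vL2_0.
have dF2 := L2cdiv (vtest_smooth tF).
by rewrite vip0l// oppr0 (ip_ael (f' := fun=> 0) oD)// ?ip0l//; exact: L2_cst.
Qed.

Lemma null_wcurl v : vL2 D v -> vnull D v -> is_wcurl D v (fun=> 0).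
Proof.
move=> v2 v0; split=> [|F tF]; first exact: vL2_0.
have dF2 := L2ccurl (vtest_smooth tF).
by rewrite vip0l// (vip_ael oD bD (u' := fun=> 0))// ?vip0l//; exact: vL2_0.
Qed.

Lemma wgradP f : H1 D f -> is_wgrad D f (wgrad D f).
Proof. by move=> [_ ex]; exact: (xgetPex _ ex). Qed.

Lemma wdivP v : Hdiv D v -> is_wdiv D v (wdiv D v).
Proof. by move=> [_ ex]; exact: (xgetPex _ ex). Qed.

Lemma wcurlP v : Hcurl D v -> is_wcurl D v (wcurl D v).
Proof. by move=> [_ ex]; exact: (xgetPex _ ex). Qed.

(** Equal pairings with gradients make the two sets of weak divergences the same set, so that the
    chosen representatives are the same function. *)
Lemma wdiv_eq v w :
  (forall phi, test_fun D phi -> vip D v (cgrad phi) = vip D w (cgrad phi)) ->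
  wdiv D v = wdiv D w.
Proof.
move=> vw; rewrite /wdiv; congr (xget _ _); apply/funext => g; apply/propext.
by split=> -[g2 H]; split=> // phi tphi; rewrite -H// vw.
Qed.

#[local] Opaque wgrad wdiv wcurl.

(** The fundamental lemma identifies two weak derivatives of the same function almost everywhere;
    linearity of the chosen weak derivatives, up to null sets, follows. *)
Lemma wgrad_unique f w : H1 D f -> is_wgrad D f w ->
  ae_on D (fun x => wgrad D f x = w x).
Proof.
move=> f1 [w2 fw]; have [u2 fu] := wgradP f1.
apply: vip_test_ae_eq => // F tF; apply: oppr_inj.
by rewrite -fu// -fw.
Qed.

Lemma wdiv_unique v g : Hdiv D v -> is_wdiv D v g ->
  ae_on D (fun x => wdiv D v x = g x).
Proof.
move=> v1 [g2 vg]; have [u2 vu] := wdivP v1.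
apply: ip_test_ae_eq => // phi tphi; apply: oppr_inj.
by rewrite -vu// -vg.
Qed.

Lemma wcurl_unique v w : Hcurl D v -> is_wcurl D v w ->
  ae_on D (fun x => wcurl D v x = w x).
Proof.
move=> v1 [w2 vw]; have [u2 vu] := wcurlP v1.
by apply: vip_test_ae_eq => // F tF; rewrite -vu// -vw.
Qed.

Lemma H1_lin a f g : H1 D f -> H1 D g -> H1 D (fun x => a * f x + g x).
Proof.
move=> f1 g1; have [[f2 _] [g2 _]] := (f1, g1); split; first exact: L2_lin.
by eexists; exact: is_wgrad_lin f2 g2 (wgradP f1) (wgradP g1).
Qed.

Lemma Hdiv_lin a v w : Hdiv D v -> Hdiv D w -> Hdiv D (fun x => a *: v x + w x).
Proof.
move=> f1 g1; have [[f2 _] [g2 _]] := (f1, g1); split; first exact: vL2_lin.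
by eexists; exact: is_wdiv_lin f2 g2 (wdivP f1) (wdivP g1).
Qed.

Lemma Hcurl_lin a v w : Hcurl D v -> Hcurl D w -> Hcurl D (fun x => a *: v x + w x).
Proof.
move=> f1 g1; have [[f2 _] [g2 _]] := (f1, g1); split; first exact: vL2_lin.
by eexists; exact: is_wcurl_lin f2 g2 (wcurlP f1) (wcurlP g1).
Qed.

Lemma wgrad_lin a f g : H1 D f -> H1 D g ->
  ae_on D (fun x => wgrad D (fun x => a * f x + g x) x = a *: wgrad D f x + wgrad D g x).
Proof.
move=> f1 g1; apply: wgrad_unique; first exact: H1_lin.
by apply: is_wgrad_lin; [case: f1|case: g1|exact: wgradP|exact: wgradP].
Qed.

Lemma wdiv_lin a v w : Hdiv D v -> Hdiv D w ->
  ae_on D (fun x => wdiv D (fun x => a *: v x + w x) x = a * wdiv D v x + wdiv D w x).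
Proof.
move=> f1 g1; apply: wdiv_unique; first exact: Hdiv_lin.
by apply: is_wdiv_lin; [case: f1|case: g1|exact: wdivP|exact: wdivP].
Qed.

Lemma wcurl_lin a v w : Hcurl D v -> Hcurl D w ->
  ae_on D (fun x => wcurl D (fun x => a *: v x + w x) x = a *: wcurl D v x + wcurl D w x).
Proof.
move=> f1 g1; apply: wcurl_unique; first exact: Hcurl_lin.
by apply: is_wcurl_lin; [case: f1|case: g1|exact: wcurlP|exact: wcurlP].
Qed.

Lemma wgrad_L2 f : H1 D f -> vL2 D (wgrad D f).
Proof. by move=> /wgradP[]. Qed.

Lemma wdiv_L2 v : Hdiv D v -> L2 D (wdiv D v).
Proof. by move=> /wdivP[]. Qed.

Lemma wcurl_L2 v : Hcurl D v -> vL2 D (wcurl D v).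
Proof. by move=> /wcurlP[]. Qed.

Definition H1vec v := forall i, H1 D (comp v i).

(** Testing the weak gradient of the i-th component with the field [single i phi] produces the i-th
    term of the divergence. *)
Lemma H1vec_wdiv v : H1vec v ->
  is_wdiv D v (fun x => \sum_(i < 3) wgrad D (comp v i) x 0 i).
Proof.
move=> v1.
have g2 i : L2 D (fun x => wgrad D (comp v i) x 0 i) by exact: (wgrad_L2 (v1 i) i).
have v2 : vL2 D v by move=> i; have [] := v1 i.
split=> [|phi tphi]; first exact: L2_sum.
have phi2 := tL2 tphi; have dphi2 := L2cgrad (let: And3 s _ _ := tphi in s).
rewrite vipE// /ip.
rewrite (_ : (fun x => _ * phi x) = fun x => \sum_(i < 3) (wgrad D (comp v i) x 0 i * phi x)); last first.
  by apply/funext => x; rewrite mulr_suml.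
rewrite (@integral3_sum _ _ oD bD _ (fun i x => wgrad D (comp v i) x 0 i * phi x)); last first.
  by move=> i; exact: (L2_mul oD (g2 i) phi2).
rewrite -sumrN; apply: eq_bigr => i _.
have [_ H] := wgradP (v1 i).
have := H _ (vtest_single i tphi); rewrite cdiv_single vip_single => <-.
by congr ip; apply/funext => x; rewrite /comp mxE.
Qed.

Lemma H1vec_Hdiv v : H1vec v -> Hdiv D v.
Proof.
move=> v1; split; first by move=> i; have [] := v1 i.
by eexists; exact: H1vec_wdiv.
Qed.

#[local] Opaque vip ip.

Lemma trace_lin a f g F : H1 D f -> H1 D g -> vsmooth F ->
  trace D (fun x => a * f x + g x) F = a * trace D f F + trace D g F.
Proof.
move=> f1 g1 sF; rewrite /trace; have [[f2 _] [g2 _]] := (f1, g1).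
have F2 : vL2 D F by exact: vL2_vsmooth.
have dF2 := L2cdiv sF.
rewrite ip_linl// (vip_ael oD bD _ _ F2 (wgrad_lin a f1 g1)); last first.
- by apply: vL2_lin => //; exact: wgrad_L2.
- by apply: wgrad_L2; exact: H1_lin.
by rewrite (vip_linl oD bD a (wgrad_L2 f1) (wgrad_L2 g1) F2) mulrDr addrACA.
Qed.

Lemma normal_trace_lin a v w phi : Hdiv D v -> Hdiv D w -> smooth phi ->
  normal_trace D (fun x => a *: v x + w x) phi = a * normal_trace D v phi + normal_trace D w phi.
Proof.
move=> f1 g1 sF; rewrite /normal_trace; have [[f2 _] [g2 _]] := (f1, g1).
have F2 := L2s sF; have dF2 := L2cgrad sF.
rewrite vip_linl// (ip_ael oD _ _ F2 (wdiv_lin a f1 g1)); last first.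
- by apply: L2_lin => //; exact: wdiv_L2.
- by apply: wdiv_L2; exact: Hdiv_lin.
by rewrite (ip_linl oD a (wdiv_L2 f1) (wdiv_L2 g1) F2) mulrDr addrACA.
Qed.

Lemma tangential_trace_lin a v w F : Hcurl D v -> Hcurl D w -> vsmooth F ->
  tangential_trace D (fun x => a *: v x + w x) F =
  a * tangential_trace D v F + tangential_trace D w F.
Proof.
move=> f1 g1 sF; rewrite /tangential_trace; have [[f2 _] [g2 _]] := (f1, g1).
have F2 : vL2 D F by exact: vL2_vsmooth.
have dF2 := L2ccurl sF.
rewrite vip_linl// (vip_ael oD bD _ _ F2 (wcurl_lin a f1 g1)); last first.
- by apply: vL2_lin => //; exact: wcurl_L2.
- by apply: wcurl_L2; exact: Hcurl_lin.
rewrite (vip_linl oD bD a (wcurl_L2 f1) (wcurl_L2 g1) F2).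
move: (vip D (wcurl D v) F) (vip D (wcurl D w) F) (vip D v (ccurl F)) (vip D w (ccurl F)).
by move=> A B A' B'; ring.
Qed.

Lemma vH10_lin a v w : vH10 D v -> vH10 D w -> vH10 D (fun x => a *: v x + w x).
Proof.
move=> v1 w1 i; have [[vi tvi] [wi twi]] := (v1 i, w1 i).
rewrite comp_lin; split=> [|F sF]; first exact: H1_lin.
by rewrite trace_lin// tvi// twi// mulr0 addr0.
Qed.

Lemma H0div_lin a v w : H0div D v -> H0div D w -> H0div D (fun x => a *: v x + w x).
Proof.
move=> [v1 tv] [w1 tw]; split=> [|phi sphi]; first exact: Hdiv_lin.
by rewrite normal_trace_lin// tv// tw// mulr0 addr0.
Qed.

Lemma H0curl_lin a v w : H0curl D v -> H0curl D w -> H0curl D (fun x => a *: v x + w x).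
Proof.
move=> [v1 tv] [w1 tw]; split=> [|phi sphi]; first exact: Hcurl_lin.
by rewrite tangential_trace_lin// tv// tw// mulr0 addr0.
Qed.

(** div curl = 0, tested against gradients that need not vanish at the boundary thanks to the zero
    tangential trace. *)
Lemma wcurl_orth_cgrad v phi : H0curl D v -> smooth phi ->
  vip D (wcurl D v) (cgrad phi) = 0.
Proof.
move=> [v1 tv] sphi; have /eqP := tv _ (vsmooth_cgrad sphi).
rewrite /tangential_trace subr_eq0 => /eqP ->.
by rewrite ccurl_cgrad// vipC vip0l.
Qed.

Lemma wcurl_is_wdiv0 v : H0curl D v -> is_wdiv D (wcurl D v) (fun=> 0).
Proof.
move=> v0; split=> [|phi [sphi _ _]]; first exact: L2_cst.
by rewrite wcurl_orth_cgrad// ip0l// oppr0.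
Qed.

Lemma wcurl_H0div v : H0curl D v -> H0div D (wcurl D v).
Proof.
move=> v0; have d0 := wcurl_is_wdiv0 v0.
have cv : Hdiv D (wcurl D v).
  by split; [by apply: wcurl_L2; case: v0|exists (fun=> 0)].
split=> // phi sphi; rewrite /normal_trace wcurl_orth_cgrad// add0r.
rewrite (ip_ael oD _ _ _ (wdiv_unique cv d0)) ?ip0l//.
- exact: wdiv_L2.
- exact: L2_cst.
- exact: L2s.
Qed.

End WeakDerivatives.

(** * Simplices, and the curl of an affine field *)

Section Simplex.
Variable R : realType.
Implicit Types (K : 4.-tuple 'rV[R]_3).

Lemma dot_mxE (b x : 'rV[R]_3) : dot b x = (x *m b^T) 0 0.
Proof. by rewrite /dot mxE; apply: eq_bigr => i _; rewrite mxE mulrC. Qed.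

(** The functions [c i + dot (b i) x] are the barycentric coordinates, obtained by inverting the
    matrix of the edges issued from the first vertex. The last clause is their uniqueness. *)
Lemma barycentric K : nondegenerate K ->
  exists (c : 'I_4 -> R) (b : 'I_4 -> 'rV[R]_3),
    (forall x, \sum_i (c i + dot (b i) x) = 1 /\
               x = \sum_i (c i + dot (b i) x) *: tnth K i) /\
    (forall d : 'I_4 -> R, \sum_i d i = 1 ->
       forall i, c i + dot (b i) (\sum_j d j *: tnth K j) = d i).
Proof.
rewrite /nondegenerate; set A := (\matrix_(i < 3) _) => Kfree.
have uA : A \in unitmx by rewrite -row_free_unit.
pose y x := (x - tnth K ord0) *m invmx A.
pose l (i : 'I_4) x := if unlift ord0 i is Some j then y x 0 j else 1 - \sum_j y x 0 j.
have l0 x : l ord0 x = 1 - \sum_j y x 0 j by rewrite /l unlift_none.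
have lS j x : l (lift ord0 j) x = y x 0 j by rewrite /l liftK.
have suml x : \sum_i l i x = 1.
  rewrite big_ord_recl (eq_bigr (fun j => y x 0 j)) => [|j _]; last by rewrite lS.
  by rewrite l0 subrK.
have yA x : \sum_j y x 0 j *: (tnth K (lift ord0 j) - tnth K ord0) = x - tnth K ord0.
  rewrite -[RHS](mulmxKV uA) -/(y x) [RHS]mulmx_sum_row; apply: eq_bigr => j _.
  by rewrite rowK.
have xE x : x = \sum_i l i x *: tnth K i.
  rewrite big_ord_recl l0 (eq_bigr (fun j => y x 0 j *: tnth K (lift ord0 j))) => [|j _]; last by rewrite lS.
  have {1}-> : x = tnth K ord0 + \sum_j y x 0 j *: (tnth K (lift ord0 j) - tnth K ord0).
    by rewrite yA addrC subrK.
  rewrite (eq_bigr (fun j => y x 0 j *: tnth K (lift ord0 j) - y x 0 j *: tnth K ord0)) => [|j _]; last by rewrite scalerBr.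
  by rewrite sumrB -scaler_suml scalerBl scale1r addrA addrAC.
have yE x j : y x 0 j = - dot (\row_i invmx A i j) (tnth K ord0) + dot (\row_i invmx A i j) x.
  rewrite [RHS]addrC /y mxE /dot -sumrB; apply: eq_bigr => i _.
  by rewrite !mxE; ring.
pose cS j := - dot (\row_i invmx A i j) (tnth K ord0).
pose bS j : 'rV[R]_3 := \row_i invmx A i j.
pose c (i : 'I_4) := if unlift ord0 i is Some j then cS j else 1 - \sum_j cS j.
pose b (i : 'I_4) := if unlift ord0 i is Some j then bS j else - \sum_j bS j.
exists c, b.
have lE i x : c i + dot (b i) x = l i x.
  rewrite /c /b; case: (unliftP ord0 i) => [j ->|->].
    by rewrite lS yE.
  rewrite l0 -addrA; congr (1 + _).
  rewrite dot_mxE linearN /= mulmxN mxE -opprD; congr (- _).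
  rewrite [RHS](eq_bigr (fun j => cS j + dot (bS j) x)) => [|j _]; last by rewrite yE.
  rewrite big_split /=; congr (_ + _).
  rewrite linear_sum /= mulmx_sumr summxE.
  by apply: eq_bigr => j _; rewrite -dot_mxE.
split=> [x|d d1 i].
  split; first by rewrite -(suml x); apply: eq_bigr => i _; exact: lE.
  by rewrite [LHS]xE; apply: eq_bigr => i _; rewrite lE.
rewrite lE; set x := \sum_j _.
have dS : y x = \row_j d (lift ord0 j).
  have dA : x - tnth K ord0 = (\row_j d (lift ord0 j)) *m A.
    rewrite mulmx_sum_row /x big_ord_recl /=.
    rewrite [RHS](eq_bigr (fun j => d (lift ord0 j) *: tnth K (lift ord0 j) - d (lift ord0 j) *: tnth K ord0)) => [|j _]; last first.
      by rewrite rowK mxE scalerBr.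
    rewrite sumrB -scaler_suml.
    have -> : d ord0 = 1 - \sum_i d (lift ord0 i) by rewrite -d1 big_ord_recl addrK.
    by apply/eqP; rewrite scalerBl scale1r subr_eq addrAC [X in _ == X]addrC addrA.
  by rewrite /y dA mulmxK.
case: (unliftP ord0 i) => [j ->|->]; first by rewrite lS dS mxE.
have -> : l ord0 x = 1 - \sum_j d (lift ord0 j).
  by rewrite l0 dS; congr (_ - _); apply: eq_bigr => j _; rewrite mxE.
by rewrite -d1 big_ord_recl addrK.
Qed.

Lemma hullE K (x : 'rV[R]_3) : hull K x <->
  exists d : 'I_4 -> R, [/\ forall i, 0 <= d i, \sum_i d i = 1 & x = \sum_i d i *: tnth K i].
Proof.
case: K => [s sz]; have /eqP ss := sz; rewrite /hull /=.
split=> -[d [d0 d1 xE]].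
  exists (fun i => d (cast_ord (esym ss) i)); split=> //.
    by rewrite -d1 (reindex (cast_ord (esym ss))) //=; exists (cast_ord ss) => i _; rewrite ?cast_ordK ?cast_ordKV.
  rewrite xE (reindex (cast_ord (esym ss))) /=; last by exists (cast_ord ss) => i _; rewrite ?cast_ordK ?cast_ordKV.
  by apply: eq_bigr => i _; rewrite (tnth_nth 0).
exists (fun i => d (cast_ord ss i)); split=> //.
  by rewrite -d1 (reindex (cast_ord ss)) //=; exists (cast_ord (esym ss)) => i _; rewrite ?cast_ordK ?cast_ordKV.
rewrite xE (reindex (cast_ord ss)) /=; last by exists (cast_ord (esym ss)) => i _; rewrite ?cast_ordK ?cast_ordKV.
by apply: eq_bigr => i _; rewrite (tnth_nth 0).
Qed.

Lemma negligible_plane (b : 'rV[R]_3) (c : R) : b != 0 ->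
  ae_on setT (fun x => c + dot b x != 0).
Proof.
move=> b0; have [k bk] : exists k, b 0 k != 0.
  apply: contrapT => H; move/negP: b0; apply; apply/eqP/rowP => k; rewrite mxE.
  by apply/eqP/negP => /negP bk; apply: H; exists k.
have P0 := leb3_plane c bk.
exists (@of_triple R @^-1` [set x | c + dot b x = 0]); split=> //.
  rewrite (_ : _ @^-1` _ = (((fun x => c + dot b x) \o @of_triple R) @^-1` [set 0])) //.
  rewrite -[X in measurable X]setTI; apply: measurable_continuous3 => //.
  by move=> x; apply: continuousD; [exact: cst_continuous|exact: dot_continuous].
by move=> p /= /not_implyP[_ /negP]; rewrite negbK => /eqP.
Qed.

(** [U] is the set where all barycentric coordinates are positive: the rest of the simplex lies in
    the four planes where one of them vanishes. *)
Lemma open_simplex K : nondegenerate K -> exists U : set 'rV[R]_3,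
  [/\ open U, U `<=` hull K & ae_on (hull K) U].
Proof.
move=> /barycentric[c [b [cb1 cb2]]].
pose U : set 'rV[R]_3 := [set x | forall i, 0 < c i + dot (b i) x].
exists U; split.
- rewrite openE => x Ux.
  have H i : \forall y \near x, 0 < c i + dot (b i) y.
    have oi : open ((fun x => c i + dot (b i) x) @^-1` `]0, +oo[).
      apply: open_comp => [y _|]; last exact: interval_open.
      by apply: continuousD; [exact: cst_continuous|exact: dot_continuous].
    have /oi : ((fun x => c i + dot (b i) x) @^-1` `]0, +oo[) x.
      by rewrite /= in_itv /= andbT; exact: Ux.
    by apply: filterS => y /=; rewrite in_itv /= andbT.
  have H' : \forall y \near x, forall i, 0 < c i + dot (b i) y.
    exact: (@filter_forall _ _ (fun i y => 0 < c i + dot (b i) y) (nbhs x) _ H).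
  exact: H'.
- move=> x Ux; apply/hullE; have [s1 xE] := cb1 x.
  by exists (fun i => c i + dot (b i) x); split=> // i; exact: ltW.
- have b0 i : b i != 0.
    apply/eqP => bi0.
    have K1 j : c i + dot (b i) (tnth K j) = (j == i)%:R.
      have -> : tnth K j = \sum_k (k == j)%:R *: tnth K k.
        rewrite (bigD1 j)//= eqxx scale1r big1 ?addr0// => k /negbTE ->.
        by rewrite scale0r.
      rewrite cb2 1?eq_sym// (bigD1 j)//= eqxx big1 ?addr0// => k /negbTE ->.
      by [].
    have := K1 i; have [j ji] : exists j : 'I_4, j != i.
      by have [->|i0] := eqVneq i ord0; [exists ord_max|exists ord0; rewrite eq_sym].
    have := K1 j; rewrite bi0 !dot_mxE trmx0 !mulmx0 !mxE (negbTE ji) eqxx => -> /eqP.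
    by rewrite eq_sym oner_eq0.
  have := ae_on_ord (fun i => negligible_plane (c i) (b0 i)).
  move/(ae_onS (@subsetT _ (hull K))); apply: ae_on_mono => x /hullE[d [d0 d1 xE]] xn0 i.
  by rewrite lt_neqAle eq_sym xn0 /= xE cb2.
Qed.

End Simplex.

Section Cells.
Variables (R : realType).
Implicit Types (f g : 'rV[R]_3 -> R) (u v w F : 'rV[R]_3 -> 'rV[R]_3).

Lemma integral3_support (D U : set 'rV[R]_3) f : U `<=` D ->
  (forall x, ~ U x -> f x = 0) -> integral3 D f = integral3 U f.
Proof.
move=> UD fU; rewrite /integral3 Rintegral_mkcond [RHS]Rintegral_mkcond.
congr Rintegral; apply/funext => p; rewrite /patch.
case: ifPn => pD; case: ifPn => pU //.
- by rewrite fU// => Up; move: pU; rewrite notin_setE; apply.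
- by rewrite notin_setE in pD; rewrite inE in pU; exfalso; apply: pD; exact: UD.
Qed.

Lemma L2S (D U : set 'rV[R]_3) f : open D -> open U -> U `<=` D -> L2 D f -> L2 U f.
Proof.
move=> oD oU UD [mf f2]; have mD := measurable_open3 oD; have mU := measurable_open3 oU.
split; first by apply: (measurable_funS mD _ mf) => p; exact: UD.
by apply: (integrableS mD mU _ f2) => p; exact: UD.
Qed.

Lemma coord_is_derive (i k : 'I_3) (x : 'rV[R]_3) :
  is_derive x (unit3 i) (fun y : 'rV[R]_3 => y 0 k) (k == i)%:R.
Proof.
apply/is_derive_line0.
have := is_deriveD (is_deriveM (is_derive_cst ((k == i)%:R : R) (0 : R) 1) (is_derive_id (0 : R) 1))
  (is_derive_cst (x 0 k) (0 : R) 1).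
move/is_derive_ext; apply => [s|].
  by rewrite !mxE eqxx /= mulrC.
by rewrite -![_ *: _]/(_ * _) /cst !mulr0 !addr0 mulr1.
Qed.

Lemma crossE (u v : 'rV[R]_3) :
  [/\ cross u v 0 (inord 0) = u 0 (inord 1) * v 0 (inord 2) - u 0 (inord 2) * v 0 (inord 1),
      cross u v 0 (inord 1) = u 0 (inord 2) * v 0 (inord 0) - u 0 (inord 0) * v 0 (inord 2) &
      cross u v 0 (inord 2) = u 0 (inord 0) * v 0 (inord 1) - u 0 (inord 1) * v 0 (inord 0)].
Proof. by have [-> -> ->] := row3E (u 0 (inord 1) * v 0 (inord 2) - u 0 (inord 2) * v 0 (inord 1))
  (u 0 (inord 2) * v 0 (inord 0) - u 0 (inord 0) * v 0 (inord 2))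
  (u 0 (inord 0) * v 0 (inord 1) - u 0 (inord 1) * v 0 (inord 0)). Qed.

Lemma int_on_dot (U : set 'rV[R]_3) u v : open U -> bounded_set U -> vL2 U u -> vL2 U v ->
  int_on U (fun x => dot (u x) (v x)).
Proof.
move=> oU bU u2 v2; have H i : int_on U (fun x => comp u i x * comp v i x) by exact: L2_mul.
rewrite (_ : (fun x => _) = fun x => comp u (inord 0) x * comp v (inord 0) x +
   comp u (inord 1) x * comp v (inord 1) x + comp u (inord 2) x * comp v (inord 2) x).
  by apply: int_onD => //; exact: int_onD.
by apply/funext => x; rewrite /dot sum_ord3.
Qed.

Lemma affine_cross_continuous (a b : 'rV[R]_3) k :
  continuous (fun x : 'rV[R]_3 => a 0 k + cross x b 0 k).
Proof.
have cl c d (m n : 'I_3) : continuous (fun y : 'rV[R]_3 => a 0 k + (y 0 m * c - y 0 n * d)).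
  move=> y; have H p s : {for y, continuous (fun y : 'rV[R]_3 => y 0 p * s)}.
    by apply: continuousM; [exact: coord_continuous3|exact: cst_continuous].
  have H0 : {for y, continuous (fun _ : 'rV[R]_3 => a 0 k)} by exact: cst_continuous.
  exact: (continuousD H0 (continuousB (H m c) (H n d))).
move: k cl; elim/ord3P => cl y.
- rewrite (_ : (fun x => _) = (fun y : 'rV[R]_3 => a 0 (inord 0) + (y 0 (inord 1) * b 0 (inord 2) - y 0 (inord 2) * b 0 (inord 1)))); first exact: cl.
  by apply/funext => z; have [-> _ _] := crossE z b.
- rewrite (_ : (fun x => _) = (fun y : 'rV[R]_3 => a 0 (inord 1) + (y 0 (inord 2) * b 0 (inord 0) - y 0 (inord 0) * b 0 (inord 2)))); first exact: cl.
  by apply/funext => z; have [_ -> _] := crossE z b.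
- rewrite (_ : (fun x => _) = (fun y : 'rV[R]_3 => a 0 (inord 2) + (y 0 (inord 0) * b 0 (inord 1) - y 0 (inord 1) * b 0 (inord 0)))); first exact: cl.
  by apply/funext => z; have [_ _ ->] := crossE z b.
Qed.

Lemma ccurl_off (U : set 'rV[R]_3) F x : vtest_fun U F -> ~ U x -> ccurl F x = 0.
Proof.
move=> tF xU; have off i j : partial i (comp F j) x = 0 by exact: (test_off (test_partial i (tF j)) xU).
rewrite /ccurl !off subr0; have [z0 z1 z2] := row3E (0 : R) 0 0.
by apply/rowP; elim/ord3P; rewrite ?z0 ?z1 ?z2 mxE.
Qed.

(** For [G x = a + cross x b], whose curl is [-2 *: b], the divergence of the field [cross (F x) (G x)]
    is [dot (G x) (ccurl F x) - dot (-2 *: b) (F x)], and the integral of a divergence of compact support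
    is zero. *)
Lemma integral_curl_affine (U : set 'rV[R]_3) (a b : 'rV[R]_3) F :
  open U -> bounded_set U -> vtest_fun U F ->
  vip U (fun x => a + cross x b) (ccurl F) = vip U (fun=> - 2 *: b) F.
Proof.
move=> oU bU tF.
have sF : vsmooth F by exact: vtest_smooth tF.
pose G k x : R := a 0 k + cross x b 0 k.
pose dF i k := partial i (comp F k).
have [r r0 Ur] := bounded_rowP bU.
have offF k (x : 'rV[R]_3) j : r + 1 <= `|x 0 j| -> comp F k x = 0 /\ forall i, dF i k x = 0.
  move=> rx; have xU : ~ U x.
    by move=> /Ur/(_ j); apply/negP; rewrite -ltNge (lt_le_trans _ rx)// ltrDl.
  split; first exact: (test_off (tF k)).
  by move=> i; apply: (test_off (test_partial i (tF k))).
have dFE i k x : is_derive x (unit3 i) (comp F k) (dF i k x) by exact: smooth_is_derive.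
(* the matrix of the partial derivatives of G *)
pose dG (i k : 'I_3) : R := cross (unit3 i) b 0 k.
have dGE i k x : is_derive x (unit3 i) (G k) (dG i k).
  have dl c d (m n : 'I_3) : is_derive x (unit3 i) (fun y : 'rV[R]_3 => a 0 k + (y 0 m * c - y 0 n * d))
     ((m == i)%:R * c - (n == i)%:R * d).
    have := is_deriveD (is_derive_cst (a 0 k) x (unit3 i))
      (is_deriveB (is_deriveM (coord_is_derive i m x) (is_derive_cst c x (unit3 i)))
                  (is_deriveM (coord_is_derive i n x) (is_derive_cst d x (unit3 i)))).
    move/is_derive_ext; apply => //.
    by rewrite -![_ *: _]/(_ * _) /cst !mulr0 !add0r [c * _]mulrC [d * _]mulrC.
  have [c0 c1 c2] := crossE (unit3 i) b.
  rewrite /dG /G; move: k dl; elim/ord3P => dl.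
  - apply: is_derive_ext (dl (b 0 (inord 2)) (b 0 (inord 1)) (inord 1) (inord 2)) _ _ => [y|].
      by have [-> _ _] := crossE y b.
    by rewrite c0 !mxE !eqxx.
  - apply: is_derive_ext (dl (b 0 (inord 0)) (b 0 (inord 2)) (inord 2) (inord 0)) _ _ => [y|].
      by have [_ -> _] := crossE y b.
    by rewrite c1 !mxE !eqxx.
  - apply: is_derive_ext (dl (b 0 (inord 1)) (b 0 (inord 0)) (inord 0) (inord 1)) _ _ => [y|].
      by have [_ _ ->] := crossE y b.
    by rewrite c2 !mxE !eqxx.
have cG k : continuous (G k) by exact: affine_cross_continuous.
have cF k : continuous (comp F k) by exact: smooth_continuous.
have cdF i k : continuous (dF i k) by apply: smooth_continuous; exact: smooth_partial.
(* the derivative in direction [i] of [F_k G_l - F_l G_k] *)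
pose D2 (i k l : 'I_3) x := (comp F k x * dG i l + G l x * dF i k x) - (comp F l x * dG i k + G k x * dF i l x).
have cD2 i k l : continuous (D2 i k l).
  have cc m n : continuous (fun x => comp F m x * dG i n + G n x * dF i m x).
    move=> x; have H0 : {for x, continuous (fun _ : 'rV[R]_3 => dG i n)} by exact: cst_continuous.
    exact: (continuousD (continuousM (cF m x) H0) (continuousM (cG n x) (cdF i m x))).
  by move=> x; exact: (continuousB (cc k l x) (cc l k x)).
have I0 i k l : integral3 setT (D2 i k l) = 0.
  apply: (@integral_partial_eq0 R (fun x => comp F k x * G l x - comp F l x * G k x) _ i (r + 1)) => //.
  move=> x j rx; have [k0 dk0] := offF k x j rx; have [l0 dl0] := offF l x j rx.
  by rewrite /D2 k0 l0 dk0 dl0 !(mul0r, mulr0) !addr0 subr0.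
have U0 i k l : integral3 U (D2 i k l) = 0.
  rewrite -(I0 i k l); apply/esym/integral3_support => // x xU.
  rewrite /D2 (test_off (tF k) xU) (test_off (tF l) xU) /dF (test_off (test_partial i (tF k)) xU).
  by rewrite (test_off (test_partial i (tF l)) xU) !(mul0r, mulr0) !addr0 subr0.
have L2c g : continuous g -> L2 U g by move=> cg; exact: L2_continuous.
have iD2 i k l : int_on U (D2 i k l) by apply: L2_int => //; exact: L2c.
have G2 : vL2 U (fun x => a + cross x b).
  move=> i; rewrite (_ : comp _ i = G i); first exact: L2c.
  by apply/funext => x; rewrite /comp mxE.
have F2 : vL2 U F by exact: vL2_vsmooth.
have cF2 : vL2 U (ccurl F) by move=> i; apply: L2c; exact: ccurl_continuous.
have bF : vL2 U (fun=> - 2 *: b) by move=> i; exact: L2_cst.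
have iGc := int_on_dot oU bU G2 cF2; have ibF := int_on_dot oU bU bF F2.
have : integral3 U (fun x => dot (a + cross x b) (ccurl F x) + -1 * dot (- 2 *: b) (F x)) = 0.
  transitivity (integral3 U (fun x => D2 (inord 0) (inord 1) (inord 2) x +
      D2 (inord 1) (inord 2) (inord 0) x + D2 (inord 2) (inord 0) (inord 1) x)); last first.
    rewrite (integral3D oU)//; last exact: int_onD.
    by rewrite (integral3D oU)// !U0 !addr0.
  apply: integral3_eq => x _.
  have e i j : (i < 3)%N -> (j < 3)%N -> (unit3 (inord i) : 'rV[R]_3) 0 (inord j) = (j == i)%:R.
    by move=> i3 j3; rewrite mxE eqxx -val_eqE /= !inordK.
  have [e00 e01 e02] := crossE (unit3 (inord 0)) b.
  have [e10 e11 e12] := crossE (unit3 (inord 1)) b.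
  have [e20 e21 e22] := crossE (unit3 (inord 2)) b.
  have d01 : dG (inord 0) (inord 1) = - b 0 (inord 2) by rewrite /dG e01 !e//= mul0r mul1r sub0r.
  have d02 : dG (inord 0) (inord 2) = b 0 (inord 1) by rewrite /dG e02 !e//= mul0r mul1r subr0.
  have d10 : dG (inord 1) (inord 0) = b 0 (inord 2) by rewrite /dG e10 !e//= mul0r mul1r subr0.
  have d12 : dG (inord 1) (inord 2) = - b 0 (inord 0) by rewrite /dG e12 !e//= mul0r mul1r sub0r.
  have d20 : dG (inord 2) (inord 0) = - b 0 (inord 1) by rewrite /dG e20 !e//= mul0r mul1r sub0r.
  have d21 : dG (inord 2) (inord 1) = b 0 (inord 0) by rewrite /dG e21 !e//= mul0r mul1r subr0.
  have [c0 c1 c2] := row3E (partial (inord 1) (comp F (inord 2)) x - partial (inord 2) (comp F (inord 1)) x)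
    (partial (inord 2) (comp F (inord 0)) x - partial (inord 0) (comp F (inord 2)) x)
    (partial (inord 0) (comp F (inord 1)) x - partial (inord 1) (comp F (inord 0)) x).
  rewrite /dot !sum_ord3 /ccurl c0 c1 c2 /D2 d01 d02 d10 d12 d20 d21 /G /dF.
  rewrite (mxE _ _ 0 (inord 0)) (mxE _ _ 0 (inord 1)) (mxE _ _ 0 (inord 2)).
  have s2 k : (-2 *: b) 0 k = -2 * b 0 k by rewrite mxE.
  rewrite !s2 -!/(comp F _ x).
  move: (cross x b 0 (inord 0)) (cross x b 0 (inord 1)) (cross x b 0 (inord 2)) => y0 y1 y2.
  move: (comp F (inord 0)) (comp F (inord 1)) (comp F (inord 2)) => F0 F1 F2'.
  move: (a 0 (inord 0)) (a 0 (inord 1)) (a 0 (inord 2)) (b 0 (inord 0)) (b 0 (inord 1)) (b 0 (inord 2)).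
  move=> a0 a1 a2 b0 b1 b2.
  move: (partial (inord 0) F1 x) (partial (inord 0) F2' x) (partial (inord 1) F0 x) (partial (inord 1) F2' x)
    (partial (inord 2) F0 x) (partial (inord 2) F1 x) (F0 x) (F1 x) (F2' x) => p01 p02 p10 p12 p20 p21 f0 f1 f2.
  ring.
rewrite (integral3D oU)//; last exact: int_onZ.
by rewrite (integral3Z oU)// mulN1r => /eqP; rewrite subr_eq0 => /eqP.
Qed.

End Cells.

(** * Finite element spaces on a mesh *)

#[local] Opaque wgrad wdiv wcurl.

Lemma ae_on_rel (R : realType) (A D : set 'rV[R]_3) (P : 'rV[R]_3 -> Prop) :
  ae_on A P -> ae_on D (fun x => A x -> P x).
Proof. by rewrite /ae_on; apply: filterS => p Pp _. Qed.

Lemma dot_linl (R : realType) (a : R) (b c x : 'rV[R]_3) : dot (a *: b + c) x = a * dot b x + dot c x.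
Proof.
by rewrite /dot mulr_sumr -big_split; apply: eq_bigr => i _; rewrite !mxE mulrDl mulrA.
Qed.

Section Mesh.
Variables (R : realType) (D : set 'rV[R]_3) (M : mesh R).
Hypotheses (oD : open D) (bD : bounded_set D) (intD : D = interior (closure D)).
Hypothesis triD : triangulation D M.
Implicit Types (K : 4.-tuple 'rV[R]_3) (u v w E : 'rV[R]_3 -> 'rV[R]_3).

Let oU_D (U : set 'rV[R]_3) K : K \in M -> open U -> U `<=` hull K -> U `<=` D.
Proof.
move=> KM oU UK; rewrite intD -open_subsetE// => x /UK xK.
by have [_ -> _] := triD; exists K.
Qed.

(** Test fields supported in the open cell determine the weak curl there, and the closed cell exceeds
    the open one by a null set. *)
Lemma wcurl_cell E K (a b : 'rV[R]_3) : Hcurl D E -> K \in M ->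
  ae_on (hull K) (fun x => E x = a + cross x b) ->
  ae_on (hull K) (fun x => wcurl D E x = -2 *: b).
Proof.
move=> cE KM EK; have [nd _ _] := triD; have [U [oU UK KU]] := open_simplex (nd _ KM).
have UD := oU_D KM oU UK.
have bU : bounded_set U by have [r [rr Dr]] := bD; exists r; split=> // s rs x /UD; exact: Dr.
have E2 i : L2 U (comp E i) by apply: (L2S oD oU UD); case: cE => E2 _; exact: E2.
have cE2 i : L2 U (comp (wcurl D E) i) by apply: (L2S oD oU UD); exact: wcurl_L2.
have A2 : vL2 U (fun x => a + cross x b).
  move=> i; apply: L2_continuous => //; rewrite (_ : comp _ i = fun x => a 0 i + cross x b 0 i).
    exact: affine_cross_continuous.
  by apply/funext => x; rewrite /comp mxE.
have : ae_on U (fun x => wcurl D E x = -2 *: b).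
  apply: vip_test_ae_eq => // [i|F tF]; first exact: L2_cst.
  have tFD : vtest_fun D F by move=> i; exact: test_funS UD (tF i).
  rewrite -(integral_curl_affine a b oU bU tF).
  have dot0r (u0 : 'rV[R]_3) : dot u0 0 = 0 by rewrite /dot big1// => i _; rewrite mxE mulr0.
  transitivity (vip D (wcurl D E) F).
    apply/esym/integral3_support => // x xU.
    by rewrite (_ : F x = 0) ?dot0r//; apply/rowP => k; rewrite mxE; exact: (test_off (tF k) xU).
  have [_ /(_ F tFD) <-] := wcurlP cE.
  transitivity (vip U E (ccurl F)).
    by apply: integral3_support => // x xU; rewrite (ccurl_off tF xU).
  apply: vip_ael => //; last exact: ae_onS UK EK.
  by move=> i; apply: L2_continuous => //; apply: ccurl_continuous; exact: vtest_smooth tF.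
by move=> /(ae_on_rel (hull K)); apply: ae_on2 KU => x _ Ux; exact.
Qed.

(** On a cell the curl is constant, and a weak curl with zero tangential trace is divergence free
    with zero normal trace. *)
Lemma Xh0_wcurl E : Xh0 D M E -> RTh0 D M (wcurl D E).
Proof.
move=> [[cE EK] E0]; have [dE _] := wcurl_H0div oD bD E0.
split; last exact: wcurl_H0div.
split=> // K KM; have [a [b Eab]] := EK K KM; exists (-2 *: b), 0.
have := wcurl_cell cE KM Eab.
by apply: ae_on_mono => x _ ->; rewrite scale0r addr0.
Qed.

Lemma ae_on_cells (P : 'rV[R]_3 -> Prop) :
  (forall K, K \in M -> ae_on (hull K) P) -> ae_on D P.
Proof.
move=> PK; have [_ cD _] := triD.
have H : ae_on D (fun x => forall K, K \in M -> hull K x -> P x).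
  apply: ae_on_seq => K /PK; exact: ae_on_rel.
apply: ae_on_mono H => x /subset_closure; rewrite cD => -[K KM xK] H; exact: H xK.
Qed.

Lemma P1_on_lin A (a : R) f g : P1_on A f -> P1_on A g -> P1_on A (fun x => a * f x + g x).
Proof.
move=> [c [b fE]] [c' [b' gE]]; exists (a * c + c'), (a *: b + b') => x Ax.
by rewrite fE// gE// dot_linl; ring.
Qed.

Lemma Qh0_lin (a : R) p q : Qh0 D M p -> Qh0 D M q -> Qh0 D M (fun x => a * p x + q x).
Proof.
move=> [[cp pK] [p2 p0]] [[cq qK] [q2 q0]]; split; split.
- move=> x; have ca : {for x, continuous (fun _ : subspace (closure D) => a)} by exact: cst_continuous.
  exact: (continuousD (continuousM ca (cp x)) (cq x)).
- by move=> K KM; apply: P1_on_lin; [exact: pK|exact: qK].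
- exact: L2_lin.
- have ip := L2_int oD bD p2; have iq := L2_int oD bD q2.
  by rewrite (integral3D oD (int_onZ oD a ip) iq) (integral3Z oD a ip) p0 q0 mulr0 addr0.
Qed.

Lemma Vh0_lin (a : R) u v : Vh0 D M u -> Vh0 D M v -> Vh0 D M (fun x => a *: u x + v x).
Proof.
move=> [[cu uK] u0] [[cv vK] v0]; split; last exact: vH10_lin.
split=> [x|K KM i].
  have ca : {for x, continuous (fun _ : subspace (closure D) => a)} by exact: cst_continuous.
  exact: (continuousD (continuousZ ca (cu x)) (cv x)).
have [c [b [d uE]]] := uK K KM i; have [c' [b' [d' vE]]] := vK K KM i.
exists (a * c + c'), (a *: b + b'), (a * d + d') => x xK.
by rewrite comp_lin uE// vE// dot_linl; move: (bubble K x) => r; ring.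
Qed.

Lemma RTh0_lin (a : R) u v : RTh0 D M u -> RTh0 D M v -> RTh0 D M (fun x => a *: u x + v x).
Proof.
move=> [[du uK] u0] [[dv vK] v0]; split; last exact: H0div_lin.
split=> [|K KM]; first exact: Hdiv_lin.
have [b [c uE]] := uK K KM; have [b' [c' vE]] := vK K KM.
exists (a *: b + b'), (a * c + c').
apply: ae_on2 uE vE => x _ -> ->; rewrite scalerDr scalerDl !scalerA !addrA.
by congr (_ + _); rewrite addrAC.
Qed.

Lemma crossDZl (a : R) (x u v : 'rV[R]_3) : cross x (a *: u + v) = a *: cross x u + cross x v.
Proof.
have [u0 u1 u2] := crossE x u; have [v0 v1 v2] := crossE x v.
have [w0 w1 w2] := crossE x (a *: u + v).
apply/rowP; elim/ord3P; rewrite [RHS]mxE [(a *: cross x u) 0 _]mxE ?u0 ?u1 ?u2 ?v0 ?v1 ?v2 ?w0 ?w1 ?w2.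
all: rewrite ![(a *: u + v) 0 _]mxE ![(a *: u) 0 _]mxE; ring.
Qed.

Lemma Xh0_lin (a : R) u v : Xh0 D M u -> Xh0 D M v -> Xh0 D M (fun x => a *: u x + v x).
Proof.
move=> [[du uK] u0] [[dv vK] v0]; split; last exact: H0curl_lin.
split=> [|K KM]; first exact: Hcurl_lin.
have [b [c uE]] := uK K KM; have [b' [c' vE]] := vK K KM.
exists (a *: b + b'), (a *: c + c').
apply: ae_on2 uE vE => x _ -> ->; rewrite scalerDr crossDZl !addrA.
by congr (_ + _); rewrite addrAC.
Qed.

Lemma Vh_bounded v i : Vh D M v -> exists c : R, ae_on D (fun x => `|comp v i x| <= c).
Proof.
move=> [cv _]; have [|c vc] := @bounded_within R D bD (comp v i).
  move=> x; have ci : {for v x, continuous (fun y : 'rV[R]_3 => y 0 i)} by exact: coord_continuous3.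
  exact: (continuous_comp (cv x) ci).
by exists c; exact: ae_on_all.
Qed.

Lemma RTh_bounded v i : RTh D M v -> exists c : R, ae_on D (fun x => `|comp v i x| <= c).
Proof.
move=> [_ vK]; have [r r0 Dr] := bounded_rowP bD.
have K1 K : K \in M -> exists c : R, ae_on D (fun x => hull K x -> `|comp v i x| <= c).
  move=> /vK[a [c vE]]; exists (`|a 0 i| + `|c| * r).
  apply: ae_on_mono (ae_on_rel D vE) => x Dx xE Kx; rewrite /comp (xE Kx) !mxE.
  rewrite (le_trans (ler_normD _ _))// normrM lerD2l ler_wpM2l//; exact: Dr.
have [c cP] : exists c : R, forall K, K \in M -> ae_on D (fun x => hull K x -> `|comp v i x| <= c).
  elim: (M) K1 => [_|K s ih K1]; first by exists 0.
  have [c cP] := ih (fun L Ls => K1 L (mem_behead (s := K :: s) Ls)).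
  have [c' cP'] := K1 K (mem_head _ _).
  exists (Num.max c c') => L; rewrite inE => /orP[/eqP->|Ls].
    by apply: ae_on_mono cP' => x _ H /H; rewrite le_max => ->; rewrite orbT.
  by apply: ae_on_mono (cP _ Ls) => x _ H /H; rewrite le_max => ->.
exists c; have [_ cD _] := triD.
apply: ae_on_mono (ae_on_seq cP) => x /subset_closure; rewrite cD => -[K KM xK] H; exact: H xK.
Qed.

(** On each cell one element of the finite-dimensional space [W] determines the restriction of a
    finite element function. A relation is enough for counting dimensions: it makes the spaces finite
    dimensional up to null sets, and asks for no basis of conforming functions. *)
Section Coordinates.
Variables (W : vectType R) (T : lmodType R) (Phi : 4.-tuple 'rV[R]_3 -> W -> 'rV[R]_3 -> T).
Hypothesis Phi_lin : forall K (a : R) (w w' : W) x, Phi K (a *: w + w') x = a *: Phi K w x + Phi K w' x.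

Definition coords (v : 'rV[R]_3 -> T) (w : {ffun 'I_(size M) -> W}) : Prop :=
  forall k, ae_on (hull (tnth (in_tuple M) k)) (fun x => v x = Phi (tnth (in_tuple M) k) (w k) x).

Lemma coords_ex (v : 'rV[R]_3 -> T) : (forall K, K \in M -> exists w : W, ae_on (hull K) (fun x => v x = Phi K w x)) ->
  exists c, coords v c.
Proof.
move=> vK; have /choice[w wP] (k : 'I_(size M)) : exists w : W, ae_on (hull (tnth (in_tuple M) k))
    (fun x => v x = Phi (tnth (in_tuple M) k) w x) by apply: vK; exact: mem_tnth.
by exists [ffun k => w k] => k; rewrite ffunE.
Qed.

Lemma coords_lin (a : R) (v v' : 'rV[R]_3 -> T) (w w' : {ffun 'I_(size M) -> W}) : coords v w -> coords v' w' ->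
  coords (fun x => a *: v x + v' x) (a *: w + w').
Proof.
move=> vw vw' k; apply: ae_on2 (vw k) (vw' k) => x _ -> ->.
by rewrite -Phi_lin !ffunE.
Qed.

Lemma coords0 (v : 'rV[R]_3 -> T) : coords v 0 -> ae_on D (fun x => v x = 0).
Proof.
move=> v0; apply: ae_on_cells => K /(@tnthP _ _ (in_tuple M))[k ->]; apply: ae_on_mono (v0 k) => x _ ->.
have := Phi_lin (tnth (in_tuple M) k) (-1) 0 0 x.
by rewrite !ffunE scaleN1r oppr0 addr0 scaleN1r addNr.
Qed.

End Coordinates.

End Mesh.

(** * Square linear systems up to negligible elements *)

Section Solvability.
Variables (R : fieldType) (V : Type) (W : vectType R) (lin : R -> V -> V -> V).
Variables (Y N : V -> Prop) (C : V -> W -> Prop) (a : V -> V -> R) (l : V -> R).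
Hypothesis Ylin : forall c u v, Y u -> Y v -> Y (lin c u v).
Hypothesis Cex : forall u, Y u -> exists w, C u w.
Hypothesis Clin : forall c u v w w', C u w -> C v w' -> C (lin c u v) (c *: w + w').
Hypothesis C0 : forall u, Y u -> C u 0 -> N u.
Hypothesis a_linl : forall c u v w, Y u -> Y v -> Y w -> a (lin c u v) w = c * a u w + a v w.
Hypothesis a_linr : forall c u v w, Y u -> Y v -> Y w -> a w (lin c u v) = c * a w u + a w v.
Hypothesis l_lin : forall c u v, Y u -> Y v -> l (lin c u v) = c * l u + l v.
Hypothesis aN : forall u w, Y u -> Y w -> N w -> a u w = 0.
Hypothesis lN : forall w, Y w -> N w -> l w = 0.
Hypothesis nondeg : forall u, Y u -> (forall w, Y w -> a u w = 0) -> N u.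

Let S (w : W) : Prop := exists2 u, Y u & C u w.

(** A sequence of coordinates of elements of [Y] whose span has maximal dimension. *)
Lemma spanning_seq : exists X : seq W, (forall w, w \in X -> S w) /\
  forall w, S w -> w \in <<X>>%VS.
Proof.
suff H m (X : seq W) : (forall w, w \in X -> S w) -> (\dim (fullv : {vspace W}) - \dim <<X>> <= m)%N ->
    exists X : seq W, (forall w, w \in X -> S w) /\ forall w, S w -> w \in <<X>>%VS.
  by apply: (H _ [::]) => //; exact: leqnn.
elim: m X => [|m ih] X XS.
  rewrite leqn0 subn_eq0 => dX; exists X; split=> // w _.
  have /eqP <- : fullv == <<X>>%VS by rewrite eq_sym -(geq_leqif (dimv_leqif_eq (subvf _))).
  exact: memvf.
move=> dX; have [XS'|/existsNP[w /not_implyP[Sw wX]]] := pselect (forall w, S w -> w \in <<X>>%VS).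
  by exists X.
apply: (ih (w :: X)) => [v|]; first by rewrite inE => /predU1P[->//|/XS].
have sub : (<<X>> <= <<w :: X>>)%VS by rewrite span_cons addvSr.
have lt : (\dim <<X>> < \dim <<w :: X>>)%N.
  rewrite (ltn_leqif (dimv_leqif_sup sub)); apply/negP => H; apply: wX.
  by apply: (subvP H); rewrite span_cons; apply: (subvP (addvSl _ _)); exact: memv_line.
by rewrite -ltnS (leq_trans _ dX)// ltn_sub2l// (leq_trans lt)// dimvS// subvf.
Qed.

Variable v0 : V.
Hypothesis Yv0 : Y v0.
Let z0 := lin (-1) v0 v0.

Section Comb.
Variables (n : nat) (v : 'I_n -> V).
Hypothesis Yv : forall i, Y (v i).

Definition lin_comb (c : 'I_n -> R) (s : seq 'I_n) := foldr (fun i u => lin (c i) (v i) u) z0 s.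
Let comb c := lin_comb c (index_enum 'I_n).

Lemma lin_comb_mem c : Y (comb c).
Proof. by rewrite /comb; elim: (index_enum _) => [|i s ih]; apply: Ylin. Qed.

Lemma lin_comb_eval (f : V -> R) : (forall c u v, Y u -> Y v -> f (lin c u v) = c * f u + f v) ->
  forall c, f (comb c) = \sum_i c i * f (v i).
Proof.
move=> flin c; rewrite /comb; elim: (index_enum _) => [|i s ih] /=.
  by rewrite big_nil /z0 flin// mulN1r addNr.
rewrite big_cons flin ?ih//; elim: s {ih} => [|j s ih]; exact: Ylin.
Qed.

Lemma lin_comb_coord (x : 'I_n -> W) c : (forall i, C (v i) (x i)) -> C (comb c) (\sum_i c i *: x i).
Proof.
move=> Cv; rewrite /comb; elim: (index_enum _) => [|i s ih] /=; last by rewrite big_cons; exact: Clin.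
have [w Cw] := Cex Yv0.
by rewrite big_nil -(addNr w) -scaleN1r; exact: Clin.
Qed.

End Comb.

(** Let [A] be the matrix of the form on a finite family that spans [Y] up to negligible elements. A
    combination of rows of [A] that vanishes comes from a negligible element, by nondegeneracy, and so
    gives a vanishing combination of columns. [A] being square, its left and right kernels coincide;
    hence [l], which kills negligible elements, is orthogonal to the right kernel, and the system is
    solvable. *)
Lemma square_system_solvable : exists2 u, Y u & forall w, Y w -> a u w = l w.
Proof.
have [X [XS SX]] := spanning_seq.
pose n := size X.
have /choice[v vP] (i : 'I_n) : exists v, Y v /\ C v X`_i.
  by have [|u Yu Cu] := XS X`_i; [exact: mem_nth|exists u].
have Yv i : Y (v i) by case: (vP i).
pose comb (x : 'rV[R]_n) := lin_comb v (x 0) (index_enum 'I_n).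
have Yc x : Y (comb x) by exact: lin_comb_mem.
have span u : Y u -> exists x, N (lin (-1) (comb x) u).
  move=> Yu; have [w Cw] := Cex Yu.
  have wX : w \in <<in_tuple X>>%VS by apply: SX; exists u.
  exists (\row_i coord (in_tuple X) i w); apply: C0; first exact: Ylin.
  have -> : 0 = -1 *: w + w by rewrite scaleN1r addNr.
  apply: Clin => //; rewrite {2}(coord_span wX).
  rewrite (eq_bigr (fun i => (\row_i coord (in_tuple X) i w) 0 i *: X`_i)) => [|i _]; last by rewrite mxE.
  by apply: lin_comb_coord => i; case: (vP i).
pose A : 'M[R]_n := \matrix_(i, j) a (v i) (v j).
have cl x w : Y w -> a (comb x) w = \sum_i x 0 i * a (v i) w.
  by move=> Yw; apply: (lin_comb_eval Yv (f := a^~ w)) => *; exact: a_linl.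
have cr x u : Y u -> a u (comb x) = \sum_i x 0 i * a u (v i).
  by move=> Yu; apply: (lin_comb_eval Yv (f := a u)) => *; exact: a_linr.
have cL x : l (comb x) = \sum_i x 0 i * l (v i) by exact: (lin_comb_eval Yv).
have AL x j : (x *m A) 0 j = a (comb x) (v j).
  by rewrite cl// mxE; apply: eq_bigr => i _; rewrite mxE.
have AR x j : (x *m A^T) 0 j = a (v j) (comb x).
  by rewrite cr// mxE; apply: eq_bigr => i _; rewrite !mxE.
(* the values on the spanning family determine those on [Y] *)
have ext (f : V -> R) : (forall c u v, Y u -> Y v -> f (lin c u v) = c * f u + f v) ->
    (forall u, Y u -> N u -> f u = 0) -> (forall j, f (v j) = 0) -> forall u, Y u -> f u = 0.
  move=> flin fN fv u Yu; have [x Nx] := span u Yu.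
  have := fN _ (Ylin (-1) (Yc x) Yu) Nx.
  rewrite flin// (lin_comb_eval Yv flin) big1 ?mulr0 ?add0r// => i _.
  by rewrite fv mulr0.
have kerN x : x *m A = 0 -> N (comb x).
  move=> xA; apply: nondeg => //; apply: ext => [*|u Yu Nu|j].
  - exact: a_linr.
  - exact: aN.
  - by rewrite -AL xA mxE.
have ker_sub : (kermx A <= kermx A^T)%MS.
  apply/row_subP => i; rewrite sub_kermx; apply/eqP/rowP => j; rewrite AR mxE aN//; apply: kerN.
  by apply/eqP; rewrite -sub_kermx row_sub.
have ker_sup : (kermx A^T <= kermx A)%MS.
  by rewrite -(geq_leqif (mxrank_leqif_sup ker_sub)) !mxrank_ker mxrank_tr.
pose b : 'rV[R]_n := \row_j l (v j).
have /submxP[x xE] : (b <= A)%MS.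
  rewrite submxE; apply/eqP/rowP => j.
  pose m := (col j (cokermx A))^T.
  have mA : m *m A^T = 0 by rewrite -trmx_mul colE mulmxA mulmx_coker mul0mx trmx0.
  have : m *m A = 0 by apply/eqP; rewrite -sub_kermx (submx_trans _ ker_sup)// sub_kermx mA.
  move=> /kerN/(lN (Yc m)); rewrite cL => m0; rewrite [RHS]mxE -[RHS]m0 mxE.
  by apply: eq_bigr => i _; rewrite !mxE mulrC.
exists (comb x) => // w Yw; apply/eqP; rewrite -subr_eq0; apply/eqP; move: w Yw.
apply: (ext (fun w => a (comb x) w - l w)) => [c u w Yu Yw|u Yu Nu|j].
- by rewrite a_linr// l_lin//; ring.
- by rewrite aN// lN// subr0.
- by rewrite -AL -xE mxE subrr.
Qed.

End Solvability.

(** * Operators and forms on states *)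

#[local] Opaque wgrad wdiv wcurl vip ip.

Lemma null_wdiv (R : realType) (D : set 'rV[R]_3) (v : 'rV[R]_3 -> 'rV[R]_3) :
  open D -> bounded_set D -> vL2 D v -> vnull D v -> is_wdiv D v (fun=> 0).
Proof.
move=> oD bD v2 v0; split; first by apply: L2_cst.
move=> phi tphi; have s := let: And3 s _ _ := tphi in s.
rewrite ip0l// oppr0 (vip_ael oD bD v2 (vL2_0 oD bD) _ v0) ?vip0l//.
by apply: vL2_vsmooth => //; exact: vsmooth_cgrad.
Qed.

Section States.
Variables (R : realType) (D : set 'rV[R]_3) (M : mesh R).
Hypotheses (oD : open D) (bD : bounded_set D) (intD : D = interior (closure D)).
Hypothesis triD : triangulation D M.
Implicit Types (y z w : state R) (c a : R).
Let Y := inY D M.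

Definition slin c y z : state R := State
  (fun x => c *: vel y x + vel z x) (fun x => c * prs y x + prs z x)
  (fun x => c *: mag y x + mag z x) (fun x => c *: elc y x + elc z x)
  (fun x => c *: cur y x + cur z x).

Definition null_state y : Prop :=
  [/\ vnull D (vel y), null D (prs y), vnull D (mag y), vnull D (elc y) & vnull D (cur y)].

Lemma inY_lin c y z : Y y -> Y z -> Y (slin c y z).
Proof.
move=> [y1 y2 y3 y4 y5] [z1 z2 z3 z4 z5]; split.
- exact: Vh0_lin.
- exact: Qh0_lin.
- exact: RTh0_lin.
- exact: Xh0_lin.
- exact: Xh0_lin.
Qed.

(** Weak derivatives are linear only almost everywhere, and the unknowns are classes modulo null
    fields. Hence linearity of operators is asked up to null sets, and forms must vanish on null
    states. *)
Definition sop (T : state R -> 'rV[R]_3 -> R) : Prop :=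
  [/\ forall y, Y y -> L2 D (T y),
      forall c y z, Y y -> Y z -> ae_on D (fun x => T (slin c y z) x = c * T y x + T z x)
    & forall y, Y y -> null_state y -> null D (T y)].

Definition vop (T : state R -> 'rV[R]_3 -> 'rV[R]_3) : Prop :=
  forall i, sop (fun y => comp (T y) i).

Definition bform (B : state R -> state R -> R) : Prop :=
  [/\ forall c y z w, Y y -> Y z -> Y w -> B (slin c y z) w = c * B y w + B z w,
      forall c y z w, Y y -> Y z -> Y w -> B w (slin c y z) = c * B w y + B w z,
      forall y w, Y y -> Y w -> null_state y -> B y w = 0
    & forall y w, Y y -> Y w -> null_state w -> B y w = 0].

Lemma sop_lin a S T : sop S -> sop T -> sop (fun y x => a * S y x + T y x).
Proof.
move=> [S2 Sl S0] [T2 Tl T0]; split=> [y Yy|c y z Yy Yz|y Yy ny].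
- by apply: L2_lin; [exact: oD|exact: S2|exact: T2].
- by apply: ae_on2 (Sl c y z Yy Yz) (Tl c y z Yy Yz) => x _ -> ->; ring.
- by apply: ae_on2 (S0 y Yy ny) (T0 y Yy ny) => x _ -> ->; rewrite mulr0 addr0.
Qed.

(** The coefficients are the previous velocity and magnetic field, which are essentially bounded. *)
Lemma sop_mul (m : 'rV[R]_3 -> R) (b : R) T : meas_on D m -> ae_on D (fun x => `|m x| <= b) ->
  sop T -> sop (fun y x => m x * T y x).
Proof.
move=> mm mb [T2 Tl T0]; split=> [y Yy|c y z Yy Yz|y Yy ny].
- by apply: L2_mul_ae_bounded mb; [exact: oD|exact: T2|exact: mm].
- by apply: ae_on_mono (Tl c y z Yy Yz) => x _ ->; ring.
- by apply: ae_on_mono (T0 y Yy ny) => x _ ->; rewrite mulr0.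
Qed.

Lemma sop_ext S T : sop S -> (forall y, S y = T y) -> sop T.
Proof. by move=> sS ST; rewrite (_ : T = S)//; apply/funext => y; rewrite ST. Qed.

Lemma vop_L2 T : vop T -> forall y, Y y -> vL2 D (T y).
Proof. by move=> vT y Yy i; have [T2 _ _] := vT i; exact: T2. Qed.

Lemma bform_ip S T : sop S -> sop T -> bform (fun y w => ip D (S y) (T w)).
Proof.
move=> [S2 Sl S0] [T2 Tl T0]; split=> [c y z w Yy Yz Yw|c y z w Yy Yz Yw|y w Yy Yw ny|y w Yy Yw nw].
- have Yl := inY_lin c Yy Yz.
  rewrite (ip_ael oD (S2 _ Yl) _ (T2 _ Yw) (Sl c y z Yy Yz)); last exact: (L2_lin oD c (S2 _ Yy) (S2 _ Yz)).
  exact: (ip_linl oD c (S2 _ Yy) (S2 _ Yz) (T2 _ Yw)).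
- have Yl := inY_lin c Yy Yz.
  rewrite (ip_aer oD (T2 _ Yl) _ (S2 _ Yw) (Tl c y z Yy Yz)); last exact: (L2_lin oD c (T2 _ Yy) (T2 _ Yz)).
  exact: (ip_linr oD c (T2 _ Yy) (T2 _ Yz) (S2 _ Yw)).
- rewrite (ip_ael oD (S2 _ Yy) (L2_cst oD bD 0) (T2 _ Yw) (S0 y Yy ny)); exact: ip0l.
- rewrite ipC (ip_ael oD (T2 _ Yw) (L2_cst oD bD 0) (S2 _ Yy) (T0 w Yw nw)); exact: ip0l.
Qed.

Lemma bform_lin a A B : bform A -> bform B -> bform (fun y w => a * A y w + B y w).
Proof.
move=> [Al Ar An An'] [Bl Br Bn Bn'].
split=> [c y z w Yy Yz Yw|c y z w Yy Yz Yw|y w Yy Yw ny|y w Yy Yw nw].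
- by rewrite Al// Bl//; ring.
- by rewrite Ar// Br//; ring.
- by rewrite An// Bn// mulr0 addr0.
- by rewrite An'// Bn'// mulr0 addr0.
Qed.

Lemma bform0 : bform (fun _ _ => 0).
Proof. by split=> *; rewrite ?mulr0 ?addr0. Qed.

Lemma bformC B : bform B -> bform (fun y w => B w y).
Proof.
move=> [Bl Br Bn Bn']; split=> [c y z w Yy Yz Yw|c y z w Yy Yz Yw|y w Yy Yw ny|y w Yy Yw nw].
- exact: Br.
- exact: Bl.
- exact: Bn'.
- exact: Bn.
Qed.

Lemma bform_ext A B : bform A -> (forall y w, Y y -> Y w -> A y w = B y w) -> bform B.
Proof.
move=> [Al Ar An An'] AB; split=> [c y z w Yy Yz Yw|c y z w Yy Yz Yw|y w Yy Yw ny|y w Yy Yw nw].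
- by rewrite -!AB ?Al//; exact: inY_lin.
- by rewrite -!AB ?Ar//; exact: inY_lin.
- by rewrite -AB ?An.
- by rewrite -AB ?An'.
Qed.

Lemma bform_sum n (B : 'I_n -> state R -> state R -> R) : (forall i, bform (B i)) ->
  bform (fun y w => \sum_i B i y w).
Proof.
move=> bB; elim: (index_enum _) => [|i s ih].
  by apply: bform_ext bform0 _ => y w _ _; rewrite big_nil.
by apply: bform_ext (bform_lin 1 (bB i) ih) _ => y w _ _; rewrite big_cons mul1r.
Qed.

Lemma bform_vip S T : vop S -> vop T -> bform (fun y w => vip D (S y) (T w)).
Proof.
move=> vS vT; apply: bform_ext (bform_sum (fun i => bform_ip (vS i) (vT i))) _ => y w Yy Yw.
by rewrite (vipE oD bD (vop_L2 vS Yy) (vop_L2 vT Yw)).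
Qed.

Lemma sop_prs : sop (@prs R).
Proof.
split=> [y|c y z _ _|y _ []] //; first by case=> _ [_ []].
exact: ae_on_all.
Qed.

Let vop_field (T : state R -> 'rV[R]_3 -> 'rV[R]_3) : (forall y, Y y -> vL2 D (T y)) ->
  (forall c y z, T (slin c y z) = fun x => c *: T y x + T z x) ->
  (forall y, null_state y -> vnull D (T y)) -> vop T.
Proof.
move=> T2 Tl T0 i; split=> [y Yy|c y z _ _|y _ ny].
- exact: T2.
- by apply: ae_on_all => x _; rewrite Tl comp_lin.
- by apply: ae_on_mono (T0 y ny) => x _; rewrite /comp => ->; rewrite mxE.
Qed.

Lemma inY_H1 y : Y y -> H1vec D (vel y).
Proof. by move=> [[_ v0] _ _ _ _] i; have [] := v0 i. Qed.

Lemma inY_elc y : Y y -> Hcurl D (elc y). Proof. by move=> [_ _ _ [[]]]. Qed.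
Lemma inY_cur y : Y y -> Hcurl D (cur y). Proof. by move=> [_ _ _ _ [[]]]. Qed.

Lemma vop_vel : vop (@vel R).
Proof. by apply: vop_field => [y /inY_H1 v1 i|//|y []//]; have [] := v1 i. Qed.

Lemma vop_mag : vop (@mag R).
Proof. by apply: vop_field => [y [_ _ [[[b2 _] _] _] _ _]|//|y []//]. Qed.

Lemma vop_elc : vop (@elc R).
Proof. by apply: vop_field => [y /inY_elc[]|//|y []//]. Qed.

Lemma vop_cur : vop (@cur R).
Proof. by apply: vop_field => [y /inY_cur[]|//|y []//]. Qed.

Lemma sop_wdiv : sop (fun y => wdiv D (vel y)).
Proof.
split=> [y /inY_H1 v1|c y z /inY_H1 v1 /inY_H1 w1|y /inY_H1 v1 [v0 _ _ _ _]].
- by apply: wdiv_L2; exact: H1vec_Hdiv.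
- by apply: wdiv_lin => //; exact: H1vec_Hdiv.
- apply: wdiv_unique => //; first exact: H1vec_Hdiv.
  by apply: null_wdiv => // i; have [] := v1 i.
Qed.

Lemma vop_wgrad i : vop (fun y => wgrad D (comp (vel y) i)).
Proof.
move=> k; split=> [y /inY_H1 v1|c y z /inY_H1 v1 /inY_H1 w1|y /inY_H1 v1 [v0 _ _ _ _]].
- exact: wgrad_L2.
- have := wgrad_lin oD bD c (v1 i) (w1 i).
  rewrite -(comp_lin c (vel y) (vel z) i) => H; apply: ae_on_mono H => x _ H.
  by rewrite [LHS]/comp [LHS](congr1 (fun v : 'rV[R]_3 => v 0 k) H) !mxE.
- have H : ae_on D (fun x => wgrad D (comp (vel y) i) x = 0).
    apply: wgrad_unique => //; apply: null_wgrad => //; first by have [] := v1 i.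
    by apply: ae_on_mono v0 => x _; rewrite /comp => ->; rewrite mxE.
  by apply: ae_on_mono H => x _; rewrite /comp => ->; rewrite mxE.
Qed.

Let vop_wcurl (T : state R -> 'rV[R]_3 -> 'rV[R]_3) : (forall y, Y y -> Hcurl D (T y)) ->
  (forall c y z, T (slin c y z) = fun x => c *: T y x + T z x) ->
  (forall y, null_state y -> vnull D (T y)) -> vop (fun y => wcurl D (T y)).
Proof.
move=> Tc Tl T0 k; split=> [y /Tc Ty|c y z /Tc Ty /Tc Tz|y /Tc Ty /T0 ny].
- exact: wcurl_L2.
- have := wcurl_lin oD bD c Ty Tz.
  by apply: ae_on_mono => x _ H; rewrite Tl /comp H !mxE.
- have H : ae_on D (fun x => wcurl D (T y) x = 0).
    by apply: wcurl_unique => //; apply: null_wcurl => //; case: Ty.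
  by apply: ae_on_mono H => x _; rewrite /comp => ->; rewrite mxE.
Qed.

Lemma vop_curl_elc : vop (fun y => wcurl D (elc y)).
Proof. by apply: vop_wcurl => [y /inY_elc|//|y []]. Qed.

Lemma vop_curl_cur : vop (fun y => wcurl D (cur y)).
Proof. by apply: vop_wcurl => [y /inY_cur|//|y []]. Qed.

Section Previous.
Variable yp : state R.
Hypothesis Yp : Y yp.

Lemma vop_convect : vop (fun y => convect D (vel yp) (vel y)).
Proof.
move=> i; have [vY _ _ _ _] := Yp; have vp2 := vop_L2 vop_vel Yp.
have g k : sop (fun y x => comp (vel yp) k x * comp (wgrad D (comp (vel y) i)) k x).
  have [b vb] := Vh_bounded bD k (let: conj h _ := vY in h).
  by apply: sop_mul vb _; [exact: L2_meas (vp2 k)|exact: vop_wgrad].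
apply: sop_ext (sop_lin 1 (g (inord 0)) (sop_lin 1 (g (inord 1)) (g (inord 2)))) _ => y.
apply/funext => x; rewrite !mul1r /comp /convect [RHS]mxE sum_ord3 addrA.
by rewrite !mxE.
Qed.

Lemma vop_fcross T : vop T -> vop (fun y => fcross (T y) (mag yp)).
Proof.
move=> vT; have [_ _ BY _ _] := Yp; have bp2 := vop_L2 vop_mag Yp.
have m i k : sop (fun y x => comp (mag yp) k x * comp (T y) i x).
  have [b vb] := RTh_bounded bD triD k (let: conj h _ := BY in h).
  by apply: sop_mul vb _; [exact: L2_meas (bp2 k)|exact: vT].
have d i j k l := sop_lin (-1) (m i j) (m k l).
apply: ord3P.
- apply: sop_ext (d (inord 2) (inord 1) (inord 1) (inord 2)) _ => y; apply/funext => x.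
  by have [e _ _] := crossE (T y x) (mag yp x); rewrite /comp /fcross e; ring.
- apply: sop_ext (d (inord 0) (inord 2) (inord 2) (inord 0)) _ => y; apply/funext => x.
  by have [_ e _] := crossE (T y x) (mag yp x); rewrite /comp /fcross e; ring.
- apply: sop_ext (d (inord 1) (inord 0) (inord 0) (inord 1)) _ => y; apply/funext => x.
  by have [_ _ e] := crossE (T y x) (mag yp x); rewrite /comp /fcross e; ring.
Qed.

End Previous.

Lemma mipE y w : Y y -> Y w -> mip D (vgrad D (vel y)) (vgrad D (vel w)) =
  \sum_(i < 3) vip D (wgrad D (comp (vel y) i)) (wgrad D (comp (vel w) i)).
Proof.
move=> Yy Yw; rewrite /mip.
rewrite (_ : (fun x => _) = fun x => \sum_(i < 3) dot (wgrad D (comp (vel y) i) x) (wgrad D (comp (vel w) i) x)); last first.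
  by apply/funext => x; apply: eq_bigr => i _; apply: eq_bigr => j _; rewrite !mxE.
rewrite (@integral3_sum _ _ oD bD _ (fun i x => dot (wgrad D (comp (vel y) i) x) (wgrad D (comp (vel w) i) x)))//.
by move=> i; apply: int_on_dot => //; exact: (vop_L2 (vop_wgrad i)).
Qed.

Lemma bform_mip : bform (fun y w => mip D (vgrad D (vel y)) (vgrad D (vel w))).
Proof.
apply: bform_ext (bform_sum (fun i => bform_vip (vop_wgrad i) (vop_wgrad i))) _ => y w Yy Yw.
by rewrite mipE.
Qed.

End States.

(** * Coordinates of a state *)

#[local] Opaque wgrad wdiv wcurl vip ip mip.

Section StateCoordinates.
Variables (R : realType) (D : set 'rV[R]_3) (M : mesh R).
Hypothesis triD : triangulation D M.
Let n := size M.
Let Y := inY D M.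

Definition local_V K (w : 'rV[R]_3 * 'M[R]_3 * 'rV[R]_3) (x : 'rV[R]_3) : 'rV[R]_3 :=
  w.1.1 + x *m w.1.2 + bubble K x *: w.2.
Definition local_Q (K : 4.-tuple 'rV[R]_3) (w : R^o * 'rV[R]_3) (x : 'rV[R]_3) : R^o := w.1 + dot w.2 x.
Definition local_RT (K : 4.-tuple 'rV[R]_3) (w : 'rV[R]_3 * R^o) (x : 'rV[R]_3) : 'rV[R]_3 := w.1 + w.2 *: x.
Definition local_X (K : 4.-tuple 'rV[R]_3) (w : 'rV[R]_3 * 'rV[R]_3) (x : 'rV[R]_3) : 'rV[R]_3 :=
  w.1 + cross x w.2.

Lemma local_V_lin K a w w' x : local_V K (a *: w + w') x = a *: local_V K w x + local_V K w' x.
Proof.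
rewrite /local_V /= mulmxDr -scalemxAr !scalerDr !scalerA [a * _]mulrC !addrA.
rewrite -!addrA; congr (_ + _); rewrite !addrA.
by rewrite [LHS](AC (5) ((2*4*1*3*5)))/= ?addrA.
Qed.

Lemma local_Q_lin K a w w' x : local_Q K (a *: w + w') x = a *: local_Q K w x + local_Q K w' x.
Proof. by rewrite /local_Q /= dot_linl -![_ *: _]/(_ * _); ring. Qed.

Lemma local_RT_lin K a w w' x : local_RT K (a *: w + w') x = a *: local_RT K w x + local_RT K w' x.
Proof. by rewrite /local_RT /= scalerDl scalerDr scalerA addrACA. Qed.

Lemma local_X_lin K a w w' x : local_X K (a *: w + w') x = a *: local_X K w x + local_X K w' x.
Proof. by rewrite /local_X /= crossDZl scalerDr addrACA. Qed.

Definition coord_type : Type := ({ffun 'I_n -> 'rV[R]_3 * 'M[R]_3 * 'rV[R]_3} *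
  {ffun 'I_n -> R^o * 'rV[R]_3} * {ffun 'I_n -> 'rV[R]_3 * R^o} *
  {ffun 'I_n -> 'rV[R]_3 * 'rV[R]_3} * {ffun 'I_n -> 'rV[R]_3 * 'rV[R]_3})%type.

Definition coord_space : vectType R := coord_type.

Definition state_coords (y : state R) (w : coord_type) : Prop :=
  [/\ coords local_V (vel y) w.1.1.1.1, coords local_Q (prs y) w.1.1.1.2,
      coords local_RT (mag y) w.1.1.2, coords local_X (elc y) w.1.2 & coords local_X (cur y) w.2].

Lemma state_coords_ex y : Y y -> exists w, state_coords y w.
Proof.
move=> [[[_ vK] _] [[_ qK] _] [[_ bK] _] [[_ eK] _] [[_ jK] _]].
have [|w1 C1] := @coords_ex R M _ _ local_V (vel y).
  move=> K KM; have /choice[c cP] := vK K KM; have /choice[b bP] := cP; have /choice[d dP] := bP.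
  exists (\row_i c i, \matrix_(j, i) b i 0 j, \row_i d i); apply: ae_on_all => x xK.
  apply/rowP => i; have -> : vel y x 0 i = comp (vel y) i x by [].
  rewrite dP// /local_V !mxE /dot mulrC; congr (_ + _ + _).
  by apply: eq_bigr => j _; rewrite mxE mulrC.
have [|w2 C2] := @coords_ex R M _ _ local_Q (prs y).
  move=> K KM; have [c [b H]] := qK K KM; exists (c, b); exact: ae_on_all.
have [|w3 C3] := @coords_ex R M _ _ local_RT (mag y).
  by move=> K KM; have [b [c H]] := bK K KM; exists (b, c).
have [|w4 C4] := @coords_ex R M _ _ local_X (elc y).
  by move=> K KM; have [b [c H]] := eK K KM; exists (b, c).
have [|w5 C5] := @coords_ex R M _ _ local_X (cur y).
  by move=> K KM; have [b [c H]] := jK K KM; exists (b, c).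
by exists (w1, w2, w3, w4, w5).
Qed.

Lemma state_coords_lin (c : R) y z (w w' : coord_type) : state_coords y w -> state_coords z w' ->
  state_coords (slin c y z) (c *: w + w').
Proof.
move=> [y1 y2 y3 y4 y5] [z1 z2 z3 z4 z5]; split.
- exact: (coords_lin local_V_lin c y1 z1).
- exact: (coords_lin local_Q_lin c y2 z2).
- exact: (coords_lin local_RT_lin c y3 z3).
- exact: (coords_lin local_X_lin c y4 z4).
- exact: (coords_lin local_X_lin c y5 z5).
Qed.

Lemma state_coords0 y : state_coords y 0 -> null_state D y.
Proof.
move=> [y1 y2 y3 y4 y5]; split.
- exact: (coords0 triD local_V_lin y1).
- exact: (coords0 triD local_Q_lin y2).
- exact: (coords0 triD local_RT_lin y3).
- exact: (coords0 triD local_X_lin y4).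
- exact: (coords0 triD local_X_lin y5).
Qed.

End StateCoordinates.

(** * One step of the scheme *)

#[local] Opaque wgrad wdiv wcurl vip ip mip.

Section OneStep.
Variables (R : realType) (D : set 'rV[R]_3) (M : mesh R).
Hypotheses (oD : open D) (bD : bounded_set D) (intD : D = interior (closure D)).
Hypothesis triD : triangulation D M.
Variables nu eta sigma alpha1 alpha2 tau : R.
Hypotheses (nu0 : 0 < nu) (sigma0 : 0 <= sigma) (alpha10 : 0 <= alpha1) (alpha20 : 0 <= alpha2).
Hypothesis tau0 : 0 < tau.
Variable yp : state R.
Hypothesis Yp : inY D M yp.
Implicit Types (y z w : state R).
Let Y := inY D M.

Definition zero_state : state R := State (fun=> 0) (fun=> 0) (fun=> 0) (fun=> 0) (fun=> 0).
Definition vel_part w := State (vel w) (fun=> 0) (fun=> 0) (fun=> 0) (fun=> 0).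
Definition prs_part w := State (fun=> 0) (prs w) (fun=> 0) (fun=> 0) (fun=> 0).
Definition mag_part w := State (fun=> 0) (fun=> 0) (mag w) (fun=> 0) (fun=> 0).
Definition elc_part w := State (fun=> 0) (fun=> 0) (fun=> 0) (elc w) (fun=> 0).
Definition cur_part w := State (fun=> 0) (fun=> 0) (fun=> 0) (fun=> 0) (cur w).

Lemma inY0 : Y zero_state.
Proof.
have -> : zero_state = slin (-1) yp yp; last exact: inY_lin.
by rewrite /slin /zero_state; congr State; apply/funext => x; rewrite ?scaleN1r ?mulN1r addNr.
Qed.

Lemma inY_parts w : Y w ->
  [/\ Y (vel_part w), Y (prs_part w), Y (mag_part w), Y (elc_part w) & Y (cur_part w)].
Proof. move=> [w1 w2 w3 w4 w5]; have [z1 z2 z3 z4 z5] := inY0.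
by split; [exact: (And5 w1 z2 z3 z4 z5)|exact: (And5 z1 w2 z3 z4 z5)|exact: (And5 z1 z2 w3 z4 z5)|
  exact: (And5 z1 z2 z3 w4 z5)|exact: (And5 z1 z2 z3 z4 w5)]. Qed.

Lemma null_zero : null_state D zero_state.
Proof. by split; apply: ae_on_all. Qed.

(** The time derivative contributes [(mass y w - mass yp w) / tau], and [stiff] collects the other
    terms. The index is that of the equation: momentum, Faraday, Ohm, Ampere, incompressibility. *)
Let mass1 y w := vip D (vel y) (vel w) + alpha1 * mip D (vgrad D (vel y)) (vgrad D (vel w)).
Let mass2 y w := vip D (mag y) (mag w).
Let mass3 y w := alpha2 * vip D (cur y) (elc w).
Let stiff1 y w := nu * mip D (vgrad D (vel y)) (vgrad D (vel w))
  + 2^-1 * (vip D (convect D (vel yp) (vel y)) (vel w) - vip D (convect D (vel yp) (vel w)) (vel y))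
  - ip D (prs y) (wdiv D (vel w)) - vip D (fcross (cur y) (mag yp)) (vel w).
Let stiff2 y w := vip D (wcurl D (elc y)) (mag w).
Let stiff3 y w := sigma * vip D (cur y) (elc w) + eta * vip D (fcross (cur y) (mag yp)) (elc w)
  - vip D (elc y) (elc w) - vip D (fcross (vel y) (mag yp)) (elc w).
Let stiff4 y w := vip D (cur y) (cur w) - vip D (mag y) (wcurl D (cur w)).
Let stiff5 y w := ip D (wdiv D (vel y)) (prs w).

Let form1 y w := tau^-1 * mass1 y w + stiff1 y w.
Let form2 y w := tau^-1 * mass2 y w + stiff2 y w.
Let form3 y w := tau^-1 * mass3 y w + stiff3 y w.
Definition scheme_form y w := form1 y w + form2 y w + form3 y w + stiff4 y w + stiff5 y w.
Definition scheme_rhs z w := tau^-1 * (mass1 z w + mass2 z w + mass3 z w).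

Let vip_form := @bform_vip R D M oD bD.
Let ip_form := @bform_ip R D M oD bD.
Let form_ext := @bform_ext R D M oD bD.
Let s_div : sop D M (fun y => wdiv D (vel y)). Proof. exact: sop_wdiv. Qed.
Let v_curlE : vop D M (fun y => wcurl D (elc y)). Proof. exact: vop_curl_elc. Qed.
Let v_curlJ : vop D M (fun y => wcurl D (cur y)). Proof. exact: vop_curl_cur. Qed.
Let b_vel : bform D M (fun y w => vip D (vel y) (vel w)). Proof. exact: vip_form (vop_vel D M) (vop_vel D M). Qed.
Let b_grad : bform D M (fun y w => mip D (vgrad D (vel y)) (vgrad D (vel w))).
Proof. exact: bform_mip. Qed.
Let b_mag : bform D M mass2. Proof. exact: vip_form (vop_mag D M) (vop_mag D M). Qed.
Let b_cur : bform D M (fun y w => vip D (cur y) (elc w)). Proof. exact: vip_form (vop_cur D M) (vop_elc D M). Qed.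
Let b_mass1 : bform D M mass1.
Proof. by apply: form_ext (bform_lin alpha1 b_grad b_vel) _ => y w _ _; rewrite addrC. Qed.
Let b_mass3 : bform D M mass3.
Proof. by apply: form_ext (bform_lin alpha2 b_cur (bform0 D M)) _ => y w _ _; rewrite addr0. Qed.
Let b_conv : bform D M (fun y w => vip D (convect D (vel yp) (vel y)) (vel w)).
Proof. exact: vip_form (vop_convect oD bD Yp) (vop_vel D M). Qed.
Let b_pdiv : bform D M (fun y w => ip D (prs y) (wdiv D (vel w))).
Proof. exact: ip_form (sop_prs D M) s_div. Qed.
Let b_lor : bform D M (fun y w => vip D (fcross (cur y) (mag yp)) (vel w)).
Proof. exact: vip_form (vop_fcross oD bD triD Yp (vop_cur D M)) (vop_vel D M). Qed.
Let b_stiff1 : bform D M stiff1.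
Proof.
have c : bform D M (fun y w => vip D (convect D (vel yp) (vel y)) (vel w) - vip D (convect D (vel yp) (vel w)) (vel y)).
  by apply: form_ext (bform_lin (-1) (bformC b_conv) b_conv) _ => y w _ _; rewrite mulN1r addrC.
apply: form_ext (bform_lin nu b_grad (bform_lin 2^-1 c (bform_lin (-1) b_pdiv (bform_lin (-1) b_lor (bform0 D M))))) _.
by move=> y w _ _; rewrite /stiff1 !mulN1r addr0 !addrA.
Qed.
Let b_stiff2 : bform D M stiff2. Proof. exact: vip_form v_curlE (vop_mag D M). Qed.
Let b_hall : bform D M (fun y w => vip D (fcross (cur y) (mag yp)) (elc w)).
Proof. exact: vip_form (vop_fcross oD bD triD Yp (vop_cur D M)) (vop_elc D M). Qed.
Let b_elc : bform D M (fun y w => vip D (elc y) (elc w)). Proof. exact: vip_form (vop_elc D M) (vop_elc D M). Qed.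
Let b_emf : bform D M (fun y w => vip D (fcross (vel y) (mag yp)) (elc w)).
Proof. exact: vip_form (vop_fcross oD bD triD Yp (vop_vel D M)) (vop_elc D M). Qed.
Let b_stiff3 : bform D M stiff3.
Proof.
apply: form_ext (bform_lin sigma b_cur (bform_lin eta b_hall (bform_lin (-1) b_elc (bform_lin (-1) b_emf (bform0 D M))))) _.
by move=> y w _ _; rewrite /stiff3 !mulN1r addr0 !addrA.
Qed.
Let b_jj : bform D M (fun y w => vip D (cur y) (cur w)). Proof. exact: vip_form (vop_cur D M) (vop_cur D M). Qed.
Let b_bcurl : bform D M (fun y w => vip D (mag y) (wcurl D (cur w))).
Proof. exact: vip_form (vop_mag D M) v_curlJ. Qed.
Let b_stiff4 : bform D M stiff4.
Proof.
apply: form_ext (bform_lin (-1) b_bcurl b_jj) _ => y w _ _.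
by rewrite /stiff4 mulN1r addrC.
Qed.
Let b_stiff5 : bform D M stiff5. Proof. exact: ip_form s_div (sop_prs D M). Qed.
Let b_form1 : bform D M form1. Proof. exact: bform_lin. Qed.
Let b_form2 : bform D M form2. Proof. exact: bform_lin. Qed.
Let b_form3 : bform D M form3. Proof. exact: bform_lin. Qed.

Lemma bform_scheme : bform D M scheme_form.
Proof.
apply: form_ext (bform_lin 1 b_form1 (bform_lin 1 b_form2 (bform_lin 1 b_form3 (bform_lin 1 b_stiff4 b_stiff5)))) _.
by move=> y w _ _; rewrite /scheme_form !mul1r !addrA.
Qed.

Let right0 B y : bform D M B -> Y y -> B y zero_state = 0.
Proof. by move=> [_ _ _ H] Yy; apply: H => //; [exact: inY0|exact: null_zero]. Qed.

(** A test state with one nonzero component isolates one of the five equations. *)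
Lemma scheme_split z y w : Y z -> Y y -> Y w ->
  (forall w, Y w -> scheme_form y w = scheme_rhs z w) ->
  [/\ form1 y w = tau^-1 * mass1 z w, form2 y w = tau^-1 * mass2 z w,
      form3 y w = tau^-1 * mass3 z w, stiff4 y w = 0 & stiff5 y w = 0].
Proof.
move=> Yz Yy /inY_parts[w1 w2 w3 w4 w5] H.
have f1 := right0 b_form1 Yy; have f2 := right0 b_form2 Yy; have f3 := right0 b_form3 Yy.
have f4 := right0 b_stiff4 Yy; have f5 := right0 b_stiff5 Yy.
have m1 := right0 b_mass1 Yz; have m2 := right0 b_mag Yz; have m3 := right0 b_mass3 Yz.
split.
- have := H _ w1; rewrite /scheme_form /scheme_rhs.
  change (form1 y w + form2 y zero_state + form3 y zero_state + stiff4 y zero_state + stiff5 y zero_state =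
    tau^-1 * (mass1 z w + mass2 z zero_state + mass3 z zero_state) -> form1 y w = tau^-1 * mass1 z w).
  by rewrite f2 f3 f4 f5 m2 m3 !addr0.
- have := H _ w3; rewrite /scheme_form /scheme_rhs.
  change (form1 y zero_state + form2 y w + form3 y zero_state + stiff4 y zero_state + stiff5 y zero_state =
    tau^-1 * (mass1 z zero_state + mass2 z w + mass3 z zero_state) -> form2 y w = tau^-1 * mass2 z w).
  by rewrite f1 f3 f4 f5 m1 m3 !addr0 !add0r.
- have := H _ w4; rewrite /scheme_form /scheme_rhs.
  change (form1 y zero_state + form2 y zero_state + form3 y w + stiff4 y zero_state + stiff5 y zero_state =
    tau^-1 * (mass1 z zero_state + mass2 z zero_state + mass3 z w) -> form3 y w = tau^-1 * mass3 z w).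
  by rewrite f1 f2 f4 f5 m1 m2 !addr0 !add0r.
- have := H _ w5; rewrite /scheme_form /scheme_rhs.
  change (form1 y zero_state + form2 y zero_state + form3 y zero_state + stiff4 y w + stiff5 y zero_state =
    tau^-1 * (mass1 z zero_state + mass2 z zero_state + mass3 z zero_state) -> stiff4 y w = 0).
  by rewrite f1 f2 f3 f5 m1 m2 m3 !addr0 !add0r mulr0.
- have := H _ w2; rewrite /scheme_form /scheme_rhs.
  change (form1 y zero_state + form2 y zero_state + form3 y zero_state + stiff4 y zero_state + stiff5 y w =
    tau^-1 * (mass1 z zero_state + mass2 z zero_state + mass3 z zero_state) -> stiff5 y w = 0).
  by rewrite f1 f2 f3 f4 m1 m2 m3 !addr0 !add0r mulr0.
Qed.

(** The difference quotient, written with combinations under which the spaces are closed. *)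
Let increment y := slin (- tau^-1) yp (slin (tau^-1 - 1) y y).

Let dtauE (u u0 : 'rV[R]_3 -> 'rV[R]_3) :
  dtau tau u u0 = fun x => (- tau^-1) *: u0 x + ((tau^-1 - 1) *: u x + u x).
Proof.
apply/funext => x; rewrite /dtau scalerBr scalerBl scale1r subrK scaleNr addrC.
by [].
Qed.

Let incrementE B y w : bform D M B -> Y y -> Y w ->
  B (increment y) w = tau^-1 * B y w - tau^-1 * B yp w.
Proof.
move=> [Bl _ _ _] Yy Yw; rewrite /increment Bl//; last exact: inY_lin.
by rewrite Bl//; ring.
Qed.

Lemma stepE y : Y y -> step D M nu eta sigma alpha1 alpha2 tau yp y <->
  forall w, Y w -> scheme_form y w = scheme_rhs yp w.
Proof.
move=> Yy.
have e (i j s : R) : i - j + s = 0 <-> i + s = j.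
  by rewrite addrAC; split=> [/eqP|->]; rewrite ?subrr// subr_eq0 => /eqP.
have e1 w : Y w -> momentum D nu alpha1 tau yp y w <-> form1 y w = tau^-1 * mass1 yp w.
  move=> Yw; rewrite -e -(incrementE b_mass1 Yy Yw) /momentum (dtauE (vel y) (vel yp)) -/(vel (increment y)).
  have A6 (p q r s t l : R) : p + q + r + s - t - l = 0 <-> p + q + (r + s - t - l) = 0 by rewrite !addrA.
  exact: A6.
have e2 w : Y w -> faraday D tau yp y w <-> form2 y w = tau^-1 * mass2 yp w.
  by move=> Yw; rewrite -e -(incrementE b_mag Yy Yw) /faraday (dtauE (mag y) (mag yp)) -/(mag (increment y)).
have e3 w : Y w -> ohm D eta sigma alpha2 tau yp y w <-> form3 y w = tau^-1 * mass3 yp w.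
  move=> Yw; rewrite -e -(incrementE b_mass3 Yy Yw) /ohm (dtauE (cur y) (cur yp)) -/(cur (increment y)).
  have A5 (p q r s t : R) : p + q + r = s + t <-> p + (q + r - s - t) = 0.
    by rewrite addrA addrA addrA -addrA -opprD; split=> [->|/eqP]; rewrite ?subrr// subr_eq0 => /eqP.
  exact: A5.
split=> [st w Yw|H w Yw].
  have [s1 s2 s3 s4 s5] := st w Yw.
  move/(e1 _ Yw): s1 => s1; move/(e2 _ Yw): s2 => s2; move/(e3 _ Yw): s3 => s3.
  have s4' : stiff4 y w = 0 by exact: s4.
  have s5' : stiff5 y w = 0 by exact: s5.
  by rewrite /scheme_form /scheme_rhs s1 s2 s3 s4' s5' !addr0 !mulrDr.
have [s1 s2 s3 s4 s5] := scheme_split Yp Yy Yw H.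
by split=> //; [exact/e1|exact/e2|exact/e3].
Qed.

Let zero_ip : integral3 D (fun=> 0 : R) = 0.
Proof. by rewrite -[RHS](ip0l oD bD (fun=> 0)); apply: integral3_eq => x _; rewrite mulr0. Qed.

Lemma dot_cross_skew (u v b : 'rV[R]_3) : dot (cross u b) v + dot (cross v b) u = 0.
Proof.
have [u0 u1 u2] := crossE u b; have [v0 v1 v2] := crossE v b.
by rewrite /dot !sum_ord3 u0 u1 u2 v0 v1 v2; ring.
Qed.

Lemma vip_fcross_skew (u v b : 'rV[R]_3 -> 'rV[R]_3) : vL2 D u -> vL2 D v ->
  vL2 D (fcross u b) -> vL2 D (fcross v b) ->
  vip D (fcross u b) v + vip D (fcross v b) u = 0.
Proof.
move=> u2 v2 ub2 vb2; have i1 := int_on_dot oD bD ub2 v2; have i2 := int_on_dot oD bD vb2 u2.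
rewrite -[RHS]zero_ip -[LHS](integral3D oD i1 i2).
by apply: integral3_eq => x _; exact: dot_cross_skew.
Qed.

(** If the pressure were not null, all quotients in the supremum would be zero. *)
Lemma inf_sup_pressure (beta : R) q : 0 < beta -> inf_sup D M beta -> Qh0 D M q ->
  (forall v, Vh0 D M v -> ip D (wdiv D v) q = 0) -> null D q.
Proof.
move=> beta0 infsup q0 orth; apply: contrapT => qn.
have : (beta%:E <= 0)%E; last by rewrite lee_fin leNgt beta0.
apply: le_trans infsup _; apply: ge_ereal_inf; eexists; first by exists q.
by apply: ge_ereal_sup => _ [v [v0 _] <-]; rewrite orth// mul0r.
Qed.

(** Test with the solution itself, but with the current in Ohm's law and the electric field in
    Ampere's law. The convective terms, the pressure and the divergence, the curl terms, the products
    of current and electric field, and the two Lorentz terms cancel in pairs, and the Hall term is zero since [cross J B] is orthogonal to [J].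
    What remains is a sum of nonnegative terms. *)
Lemma energy y : Y y -> (forall w, Y w -> scheme_form y w = 0) ->
  vnull D (vel y) /\ vnull D (mag y).
Proof.
move=> Yy H; have [v0 q0 B0 E0 J0] := Yy.
pose w := State (vel y) (prs y) (mag y) (cur y) (elc y).
have Yw : Y w by exact: (And5 v0 q0 B0 J0 E0).
have v2 := vop_L2 (vop_vel D M) Yy; have j2 := vop_L2 (vop_cur D M) Yy.
have b2 := vop_L2 (vop_mag D M) Yy.
have vb2 := vop_L2 (vop_fcross oD bD triD Yp (vop_vel D M)) Yy.
have jb2 := vop_L2 (vop_fcross oD bD triD Yp (vop_cur D M)) Yy.
have X := vip_fcross_skew j2 v2 jb2 vb2; have X2 := vip_fcross_skew j2 j2 jb2 jb2.
have := H w Yw; rewrite /scheme_form /form1 /form2 /form3 /mass1 /mass2 /mass3.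
rewrite /stiff1 /stiff2 /stiff3 /stiff4 /stiff5 /w /=.
rewrite (ipC D (wdiv D (vel y)) (prs y)) (vipC D (elc y) (cur y)) (vipC D (wcurl D (elc y)) (mag y)).
have U0 := vip_ge0 oD bD v2; have P0 := vip_ge0 oD bD b2; have Q0 := vip_ge0 oD bD j2.
have G0 : 0 <= mip D (vgrad D (vel y)) (vgrad D (vel y)).
  by rewrite (mipE oD bD Yy Yy); apply: sumr_ge0 => i _; apply: vip_ge0 => //; exact: (vop_L2 (@vop_wgrad _ _ M oD bD i) Yy).
move: (vip_eq0 oD bD v2) (vip_eq0 oD bD b2).
move: X X2 U0 P0 Q0 G0.
move: (vip D (convect D (vel yp) (vel y)) (vel y)) => c.
move: (vip D (fcross (cur y) (mag yp)) (vel y)) (vip D (fcross (vel y) (mag yp)) (cur y))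
  (vip D (fcross (cur y) (mag yp)) (cur y)) => X1 X3 X2.
move: (vip D (mag y) (wcurl D (elc y))) (vip D (cur y) (elc y)) (ip D (prs y) (wdiv D (vel y))) => s t r.
move: (vip D (vel y) (vel y)) (vip D (mag y) (mag y)) (vip D (cur y) (cur y)) (mip D _ _) => Un Pn Qn Gn.
move=> X13 X20 U0 P0 Q0 G0 HU HP E.
have ti : 0 < tau^-1 by rewrite invr_gt0.
have tU : 0 <= tau^-1 * Un by rewrite mulr_ge0// ltW.
have tP : 0 <= tau^-1 * Pn by rewrite mulr_ge0// ltW.
have tG : 0 <= tau^-1 * (alpha1 * Gn) by rewrite mulr_ge0 ?mulr_ge0// ltW.
have nG : 0 <= nu * Gn by rewrite mulr_ge0// ltW.
have tQ : 0 <= tau^-1 * (alpha2 * Qn) by rewrite mulr_ge0 ?mulr_ge0// ltW.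
have sQ : 0 <= sigma * Qn by rewrite mulr_ge0.
have X2z : X2 = 0 by lra.
have S : tau^-1 * Un + tau^-1 * (alpha1 * Gn) + nu * Gn + tau^-1 * Pn + tau^-1 * (alpha2 * Qn) + sigma * Qn = 0.
  move: E; rewrite X2z mulr0 subrr mulr0 => E; rewrite -[RHS]E.
  have -> : X3 = - X1 by lra.
  ring.
have tU0 : tau^-1 * Un = 0 by lra.
have tP0 : tau^-1 * Pn = 0 by lra.
split; [apply: HU|apply: HP].
- by apply/eqP; move/eqP: tU0; rewrite mulf_eq0 gt_eqF.
- by apply/eqP; move/eqP: tP0; rewrite mulf_eq0 gt_eqF.
Qed.

(** The energy identity controls the velocity and the magnetic field only, as [sigma] and [alpha2] may
    vanish. The other fields follow one after the other. *)
Lemma scheme_nondegenerate (beta : R) y : 0 < beta -> inf_sup D M beta -> Y y ->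
  (forall w, Y w -> scheme_form y w = 0) -> null_state D y.
Proof.
move=> beta0 infsup Yy H; have [un Bn] := energy Yy H.
have [Y1 _ Y3 _ Y5] := inY_parts Yy.
have o : ae_on D (fun _ => (0 : 'rV[R]_3) = 0) by exact: ae_on_all.
have o' : ae_on D (fun _ => (0 : R) = 0) by exact: ae_on_all.
have n1 : null_state D (vel_part y) by exact: (And5 un o' o o o).
have n3 : null_state D (mag_part y) by exact: (And5 o o' Bn o o).
have eqs w : Y w -> [/\ form1 y w = 0, form3 y w = 0 & stiff4 y w = 0].
  move=> Yw; have z1 : mass1 zero_state w = 0 by case: b_mass1 => _ _ h _; exact: h inY0 Yw null_zero.
  have z3 : mass3 zero_state w = 0 by case: b_mass3 => _ _ h _; exact: h inY0 Yw null_zero.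
  have [|s1 _ s3 s4 _] := scheme_split inY0 Yy Yw.
    move=> w' Yw'; rewrite H// /scheme_rhs.
    have -> : mass1 zero_state w' = 0 by case: b_mass1 => _ _ h _; exact: h inY0 Yw' null_zero.
    have -> : mass2 zero_state w' = 0 by case: b_mag => _ _ h _; exact: h inY0 Yw' null_zero.
    have -> : mass3 zero_state w' = 0 by case: b_mass3 => _ _ h _; exact: h inY0 Yw' null_zero.
    by rewrite !addr0 mulr0.
  by split=> //; rewrite ?s1 ?s3 ?z1 ?z3 mulr0.
(* Ampere's law with the current itself as test function *)
have Jn : vnull D (cur y).
  have j2 := vop_L2 (vop_cur D M) Yy.
  apply: (vip_eq0 oD bD j2); have [_ _] := eqs y Yy; rewrite /stiff4.
  have -> : vip D (mag y) (wcurl D (cur y)) = 0.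
    by case: b_bcurl => _ _ h _; exact: (h (mag_part y) y Y3 Yy n3).
  by rewrite subr0.
have n5 : null_state D (cur_part y) by exact: (And5 o o' o o Jn).
(* Ohm's law with the electric field *)
have En : vnull D (elc y).
  have e2 := vop_L2 (vop_elc D M) Yy.
  apply: (vip_eq0 oD bD e2); have [_ + _] := eqs y Yy; rewrite /form3 /mass3 /stiff3.
  have -> : vip D (cur y) (elc y) = 0 by case: b_cur => _ _ h _; exact: (h (cur_part y) y Y5 Yy n5).
  have -> : vip D (fcross (cur y) (mag yp)) (elc y) = 0.
    by case: b_hall => _ _ h _; exact: (h (cur_part y) y Y5 Yy n5).
  have -> : vip D (fcross (vel y) (mag yp)) (elc y) = 0.
    by case: b_emf => _ _ h _; exact: (h (vel_part y) y Y1 Yy n1).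
  by rewrite !mulr0 !add0r subr0 => /eqP; rewrite oppr_eq0 => /eqP.
split=> //; have [_ q0 _ _ _] := Yy.
apply: (inf_sup_pressure beta0 infsup q0) => v v0.
have [_ z2 z3 z4 z5] := inY0.
pose w := State v (fun=> 0) (fun=> 0) (fun=> 0) (fun=> 0).
have Yw : Y w by exact: (And5 v0 z2 z3 z4 z5).
have [+ _ _] := eqs w Yw; rewrite /form1 /mass1 /stiff1.
have -> : vip D (vel y) (vel w) = 0 by case: b_vel => _ _ h _; exact: (h (vel_part y) w Y1 Yw n1).
have -> : mip D (vgrad D (vel y)) (vgrad D (vel w)) = 0.
  by case: b_grad => _ _ h _; exact: (h (vel_part y) w Y1 Yw n1).
have -> : vip D (convect D (vel yp) (vel y)) (vel w) = 0.
  by case: b_conv => _ _ h _; exact: (h (vel_part y) w Y1 Yw n1).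
have -> : vip D (convect D (vel yp) (vel w)) (vel y) = 0.
  by case: b_conv => _ _ _ h; exact: (h w (vel_part y) Yw Y1 n1).
have -> : vip D (fcross (cur y) (mag yp)) (vel w) = 0.
  by case: b_lor => _ _ h _; exact: (h (cur_part y) w Y5 Yw n5).
rewrite ipC !mulr0 !subr0 !mulr0 !add0r mulr0 add0r => /eqP; rewrite oppr_eq0 => /eqP.
exact.
Qed.

Lemma step_exists (beta : R) : 0 < beta -> inf_sup D M beta ->
  exists2 y, Y y & step D M nu eta sigma alpha1 alpha2 tau yp y.
Proof.
move=> beta0 infsup.
have [al ar aN1 aN2] := bform_scheme.
have [m1l m1r _ m1n] := b_mass1; have [m2l m2r _ m2n] := b_mag; have [m3l m3r _ m3n] := b_mass3.
have [||||||||||y Yy yE] := @square_system_solvable R (state R) (coord_space M) (@slin R) Y (null_state D) (@state_coords R M)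
  scheme_form (scheme_rhs yp) _ _ _ _ _ _ _ _ _ _ yp Yp.
- by move=> c u v; exact: inY_lin.
- by move=> u Yu; exact: (state_coords_ex Yu).
- by move=> c u v w w'; exact: state_coords_lin.
- by move=> u _; exact: state_coords0.
- exact: al.
- exact: ar.
- move=> c u v Yu Yv; rewrite /scheme_rhs m1r// m2r// m3r//.
  by move: (mass1 yp u) (mass2 yp u) (mass3 yp u) (mass1 yp v) (mass2 yp v) (mass3 yp v) => *; ring.
- exact: aN2.
- by move=> w Yw nw; rewrite /scheme_rhs m1n// m2n// m3n// !addr0 mulr0.
- by move=> u Yu; exact: (scheme_nondegenerate beta0 infsup).
by exists y => //; apply/stepE.
Qed.

Lemma step_unique (beta : R) y z : 0 < beta -> inf_sup D M beta -> Y y -> Y z ->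
  step D M nu eta sigma alpha1 alpha2 tau yp y -> step D M nu eta sigma alpha1 alpha2 tau yp z ->
  same_state D z y.
Proof.
move=> beta0 infsup Yy Yz /(stepE Yy) ys /(stepE Yz) zs.
have [al _ _ _] := bform_scheme.
have : null_state D (slin (-1) y z).
  apply: (scheme_nondegenerate beta0 infsup); first exact: inY_lin.
  by move=> w Yw; rewrite al// ys// zs// mulN1r addNr.
case=> n1 n2 n3 n4 n5; split.
- by apply: ae_on_mono n1 => x _ /= /eqP; rewrite scaleN1r addrC subr_eq0 => /eqP.
- by apply: ae_on_mono n2 => x _ /= /eqP; rewrite mulN1r addrC subr_eq0 => /eqP.
- by apply: ae_on_mono n3 => x _ /= /eqP; rewrite scaleN1r addrC subr_eq0 => /eqP.
- by apply: ae_on_mono n4 => x _ /= /eqP; rewrite scaleN1r addrC subr_eq0 => /eqP.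
- by apply: ae_on_mono n5 => x _ /= /eqP; rewrite scaleN1r addrC subr_eq0 => /eqP.
Qed.

(** Faraday's law, tested with its own residual, holds almost everywhere: the residual is a
    Raviart-Thomas field since the curl of a Nedelec field is one. A curl with zero tangential trace is
    orthogonal to gradients. *)
Lemma step_div y : Y y -> step D M nu eta sigma alpha1 alpha2 tau yp y ->
  wdiv D (mag y) = wdiv D (mag yp).
Proof.
move=> Yy st; have [_ _ B1 E1 _] := Yy; have [_ _ B0 _ _] := Yp.
have cE := Xh0_wcurl oD bD intD triD E1.
have [z1 z2 _ z4 z5] := inY0.
have b1 := vop_L2 (vop_mag D M) Yy; have b0 := vop_L2 (vop_mag D M) Yp.
have c2 : vL2 D (wcurl D (elc y)) := vop_L2 v_curlE Yy.
pose d : 'rV[R]_3 -> 'rV[R]_3 := fun x => -1 *: mag yp x + mag y x.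
have d2 : vL2 D d by exact: vL2_lin.
pose r : 'rV[R]_3 -> 'rV[R]_3 := fun x => tau^-1 *: d x + wcurl D (elc y) x.
have r2 : vL2 D r by exact: vL2_lin.
have r0 : RTh0 D M r.
  apply: (RTh0_lin oD bD _ _ cE); exact: RTh0_lin.
pose w := State (fun=> 0) (fun=> 0) r (fun=> 0) (fun=> 0).
have Yw : Y w by exact: (And5 z1 z2 r0 z4 z5).
have rn : vnull D r.
  apply: (vip_eq0 oD bD r2); rewrite {1}/r (vip_linl oD bD _ d2 c2 r2).
  have [_ far _ _ _] := st w Yw; rewrite -[RHS]far /=; congr (_ + _).
  have -> : dtau tau (mag y) (mag yp) = fun x => (tau^-1 - 1) *: d x + d x.
    apply/funext => x; rewrite /dtau scalerBl scale1r subrK; congr (_ *: _).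
    by rewrite /d scaleN1r addrC.
  by rewrite (vip_linl oD bD _ d2 d2 r2); ring.
apply: wdiv_eq => phi tphi.
have sphi := let: And3 s _ _ := tphi in s.
have g2 : vL2 D (cgrad phi) by apply: vL2_vsmooth => //; exact: vsmooth_cgrad.
have : vip D r (cgrad phi) = 0.
  by rewrite (vip_ael oD bD r2 (vL2_0 oD bD) g2 rn); exact: vip0l.
rewrite {1}/r (vip_linl oD bD _ d2 c2 g2) (wcurl_orth_cgrad oD bD _ sphi); last by case: E1.
rewrite addr0 {1}/d (vip_linl oD bD _ b0 b1 g2) mulN1r => /eqP.
by rewrite mulf_eq0 invr_eq0 gt_eqF//= addrC subr_eq0 => /eqP.
Qed.

End OneStep.

Theorem proposition3p1 (R : realType) (D : set 'rV[R]_3) (Hs : set R)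
    (Th : R -> mesh R) (T nu eta sigma alpha1 alpha2 tau : R)
    (hD : admissible_domain D)
    (hTh : quasi_uniform_family D Hs Th)
    (hinfsup : exists2 beta : R, 0 < beta &
       forall h, Hs h -> inf_sup D (Th h) beta)
    (hT : 0 < T) (hnu : 0 < nu) (heta : 0 < eta) (hsigma : 0 <= sigma)
    (halpha1 : 0 <= alpha1) (halpha2 : 0 <= alpha2) (htau : 0 < tau)
    (h : R) (hh : Hs h) :
  let N := Num.truncn (T / tau) in
  let Y := inY D (Th h) in
  let scheme := step D (Th h) nu eta sigma alpha1 alpha2 tau in
  (forall n : nat, (1 <= n <= N)%N ->
     forall yprev : state R, Y yprev ->
     exists y : state R, [/\ Y y, scheme yprev y &
       forall z : state R, Y z -> scheme yprev z -> same_state D z y]) /\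
  (forall y : nat -> state R, Y (y 0%N) ->
     (forall n : nat, (1 <= n <= N)%N ->
        Y (y n) /\ scheme (y n.-1) (y n)) ->
     (forall n : nat, (n <= N)%N ->
        ae_on D (fun x => wdiv D (mag (y n)) x = wdiv D (mag (y 0%N)) x)) /\
     (ae_on D (fun x => wdiv D (mag (y 0%N)) x = 0) ->
      forall n : nat, (n <= N)%N ->
        ae_on D (fun x => wdiv D (mag (y n)) x = 0))).
Proof.
have [oD _ bD _ [intD _]] := hD; have [/(_ h hh)[_ triD _] _] := hTh.
have [beta beta0 /(_ h hh) infsup] := hinfsup.
move=> N Y scheme; split=> [n _ yp Yp|y Y0 ys].
  have [y Yy sy] := step_exists oD bD triD eta hnu hsigma halpha1 halpha2 htau Yp beta0 infsup.
  exists y; split=> // z Yz sz.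
  exact: (step_unique oD bD triD hnu hsigma halpha1 halpha2 htau Yp beta0 infsup Yy Yz sy sz).
have div n : (n <= N)%N -> Y (y n) /\ wdiv D (mag (y n)) = wdiv D (mag (y 0%N)).
  elim: n => [//|n ih] nN; have [Yn <-] := ih (ltnW nN).
  have [YS sS] := ys n.+1 nN; split=> //.
  exact: (step_div oD bD intD triD htau Yn YS sS).
split=> [n nN|d0 n nN]; have [_ ->] := div n nN; last exact: d0.
exact: ae_on_all.
Qed.
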